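(* Let $\mathcal{K}$ be a knot and assume that the orthogonal Labastida–Mariño–Ooguri–Vafa (LMOV) conjecture holds for $\mathcal{K}$, i.e. that there are integers $N_{\mu,g,\beta}$ (for partitions $\mu\neq 0$, $g\in\mathbb{Z}_{\ge 0}$, $\beta\in\mathbb{Z}$), vanishing for each $\mu$ when $g$ or $|\beta|$ is sufficiently large, such that for every $\mu\ne 0$ $$\frac{\mathfrak{z}_{\mu}[1]^{2}\,\big(g_{\mu}(\mathcal{K};q,t)-g_{\mu}(\mathcal{K};q,-t)\big)}{2[\mu]}=\sum_{g=0}^{\infty}\sum_{\beta\in\mathbb{Z}}N_{\mu,g,\beta}(q-q^{-1})^{g}t^{\beta}.$$ Let $n_{\mu,g,\beta}$ be the integers, vanishing for each $\mu$ when $g$ or $|\beta|$ is sufficiently large, such that for all $\mu\ne0$ and $\beta$ $$\sum_{g=0}^{\infty}N_{\mu,g,\beta}(q-q^{-1})^{g}=\sum_{g=0}^{\infty}n_{\mu,g,\beta}\sum_{k=0}^{g}q^{g-2k}.$$ Then, for $|q|<1$, $$\frac{Z_{CS}^{SO}(\mathcal{K};q,t;w)}{Z_{CS}^{SO}(\mathcal{K};q,-t;w)}=\prod_{\mu\neq 0}\ \prod_{g=0}^{\infty}\ \prod_{\beta\in\mathbb{Z}}\ \prod_{m=1}^{\infty}\ \prod_{k=0}^{g}\left(\frac{\big\langle 1+q^{g-2k+2m}t^{\beta}z^{\mu}\big\rangle}{\big\langle 1-q^{g-2k+2m}t^{\beta}z^{\mu}\big\rangle}\right)^{\frac{m\,n_{\mu,g,\beta}}{\mathfrak{z}_{\mu}}},$$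 where $\mu$ runs over all non-empty partitions.
   Context: **Partitions.** $\mathcal{P}$ is the set of all partitions (Young diagrams), including the empty one, denoted $0$. For $\mu=(\mu_1\ge\dots\ge\mu_\ell>0)$ put $\ell(\mu)=\ell$, $|\mu|=\sum_i\mu_i$, $\mathfrak{z}_\mu=\prod_{j\ge1}j^{m_j}m_j!$ with $m_j$ the number of parts equal to $j$. Put $[n]=q^n-q^{-n}$ and $[\mu]=\prod_{i}[\mu_i]$. For a positive integer $k$, $k\mid\mu$ means that $k$ divides every part of $\mu$, and then $\mu/k=(\mu_1/k,\mu_2/k,\dots)$. **Orthogonal quantum group invariants.** Let $\mathfrak{g}=so_{2N+1}$ and $t=q^{2N}$. A Young diagram $A$ labels the irreducible $U_q(so_{2N+1})$-module $V_A$ whose highest weight $\Lambda_A$ corresponds to $A$. Present $\mathcal K$ as the closure of a braid on $m$ strands, color all strands by $V_A$, and let each braid generator $\sigma_i^{\pm1}$ act on $V_A^{\otimes m}$ by $\check R^{\pm1}$ in positions $i,i+1$, where $\check R=P_{12}R$, $R$ is the universal $R$-matrix and $P_{12}$ is the flip; call the resulting operator $\pi(\mathcal K)$. Then $$W_A^{SO}(\mathcal K;q,t)=q^{d(\mathcal K)}\,\mathrm{Tr}_{V_A^{\otimes m}}(\mu^{\otimes m}\,\pi(\mathcal K)),\qquad d(\mathcal K)=-\omega(\mathcal K)(\Lambda_A,\Lambda_A+2\rho),$$ where in this formula $\mu$ is the element of the Cartan part associated with the Weyl vector $\rho$ that defines the quantum trace (so that $W_A^{SO}$ of the unknot is the quantum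 dimension of $V_A$), and $\omega(\mathcal K)$ is the writhe of the diagram. It is regarded as a function of $q$ and $t$ (the colored Kauffman polynomial); for $A=(1)$ it is the Kauffman polynomial up to the universal factor $1+\frac{t-t^{-1}}{q-q^{-1}}$. **Brauer algebra characters.** $Br_n$ is the (semisimple) Brauer algebra, containing $\mathbb{C}[S_n]$. Its set of irreducible representations $\widehat{Br}_n$ is labeled by the partitions of $n-2k$, $k=0,1,\dots,\lfloor n/2\rfloor$. For $A\in\widehat{Br}_n$, $\chi_A$ is its character, and for $\mu\vdash n$, $\gamma_\mu\in S_n\subset Br_n$ is a permutation of cycle type $\mu$. **Partition function and reformulated invariants.** For variables $z=\{z_i\}_{-\infty<i<\infty}$ let $pb_n(z)=\sum_{i=-\infty}^{\infty}z_i^n$ and $pb_\mu(z)=\prod_{i=1}^{\ell(\mu)}pb_{\mu_i}(z)$. The orthogonal Chern–Simons partition function is $$Z_{CS}^{SO}(\mathcal K;q,t;z)=\sum_{\mu\in\mathcal P}\frac{pb_\mu(z)}{\mathfrak z_\mu}\sum_{A\in\widehat{Br}_{|\mu|}}\chi_A(\gamma_\mu)\,W^{SO}_A(\mathcal K;q,t).$$ Its logarithm is expanded as $\log Z_{CS}^{SO}(\mathcal K;q,t;z)=\sum_{\mu\ne0}F_\mu(\mathcal K;q,t)\,pb_\mu(z)$, and $$g_\mu(\mathcal K;q,t)=\sum_{k\mid\mu}\frac{\mu(k)}{k}F_{\mu/k}(\mathcal K;q^k,t^k),$$ where $\mu(k)$ is the Möbius function. Replacing $t$ by $-t$ means substituting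 $-t$ for $t$ in these functions of $(q,t)$. **The variables $w$.** $w=z*q^\rho$ denotes the specialization determined by $pb_n(w)=pb_n(z)/[n]$ for all $n\ge1$, hence $pb_\mu(w)=pb_\mu(z)/[\mu]$; thus $Z_{CS}^{SO}(\mathcal K;q,t;w)$ is obtained from $Z_{CS}^{SO}(\mathcal K;q,t;z)$ by replacing each $pb_\mu(z)$ by $pb_\mu(z)/[\mu]$. **Symmetric product.** For a quantity $\omega$ and a partition $\mu$, $$\big\langle1\pm\omega z^\mu\big\rangle=\prod_{i_1,\dots,i_{\ell(\mu)}\in\mathbb{Z}}\big(1\pm\omega z_{i_1}^{\mu_1}\cdots z_{i_{\ell(\mu)}}^{\mu_{\ell(\mu)}}\big).$$ The product formula is an identity of formal series in the variables $z_i$ with constant term $1$; rational powers are defined by $f^{r}=\exp(r\log f)$, and rational functions of $q$ are expanded in $|q|<1$. *)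

(* Defs.v *)
From HB Require Import structures.
From mathcomp Require Import all_boot all_order all_algebra all_fingroup.
From mathcomp Require Import finmap generic_quotient fraction.
From mathcomp Require Export complex reals.

Set Implicit Arguments.
Unset Strict Implicit.
Unset Printing Implicit Defensive.

Import Order.TTheory GRing.Theory Num.Theory.
Local Open Scope ring_scope.

Definition is_intpart (s : seq nat) := sorted geq s && (0%N \notin s).

Record intpart := IntPart { parts_of :> seq nat; _ : is_intpart parts_of }.

HB.instance Definition _ := [isSub for parts_of].
HB.instance Definition _ := [Countable of intpart by <:].

Lemma mkpart_subproof (s : seq nat) :
  is_intpart (sort geq [seq i <- s | 0 < i]%N).
Proof.
apply/andP; split; last by rewrite mem_sort mem_filter ltnn.
by apply: sort_sorted => m n; exact: leq_total.
Qed.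

(* The partition whose parts are the nonzero entries of s, in any order. *)
Definition mkpart (s : seq nat) : intpart := IntPart (mkpart_subproof s).

Definition part0 : intpart := mkpart [::].

Definition psize (mu : intpart) : nat := sumn mu.

(* A partition of n, padded with zeros, is an n-tuple of integers in 0..n. *)
Definition partitions_of (n : nat) : seq intpart :=
  undup [seq mkpart [seq val i | i <- t]
        | t : n.-tuple 'I_n.+1 in [pred t : n.-tuple 'I_n.+1 | sumn [seq val i | i <- t] == n]].

Definition zee (mu : intpart) : nat :=
  (\prod_(1 <= j < (psize mu).+1) (j ^ count_mem j mu * (count_mem j mu)`!))%N.

Definition pdvd (k : nat) (mu : intpart) : bool := all (fun i => k %| i)%N mu.

Definition pdiv_by (mu : intpart) (k : nat) : intpart :=
  mkpart [seq (i %/ k)%N | i <- mu].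

Definition moebius (k : nat) : int :=
  if all (fun p => logn p k == 1%N) (primes k) then (-1) ^+ size (primes k)
  else 0.

Definition zmon := {fsfun int -> nat with 0%N}.

Definition mon0 : zmon := [fsfun].

Definition mondeg (m : zmon) : nat := (\sum_(i <- finsupp m) m i)%N.

Definition mondivs (m : zmon) : seq zmon :=
  [seq ([fsfun i : finsupp m => nat_of_ord (h i)] : zmon)
  | h : {ffun finsupp m -> 'I_(mondeg m).+1}
      in [pred h : {ffun finsupp m -> 'I_(mondeg m).+1} | [forall i, h i <= m (val i)]%N]].

Definition monquo (m d : zmon) : zmon := [fsfun i in finsupp m => (m i - d i)%N].

(* z_{i_1}^{mu_1} ... z_{i_l}^{mu_l}; the indices i_j may coincide. *)
Definition monpow (mu : intpart) (idx : 'I_(size mu) -> int) : zmon :=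
  [fsfun k in [fset idx j | j in 'I_(size mu)]%fset =>
     (\sum_(j < size mu | idx j == k) nth 0 mu j)%N].

Section Series.
Variable K : fieldType.

Definition series := zmon -> K.

Definition oneS : series := fun m => (m == mon0)%:R.

Definition mulS (f g : series) : series :=
  fun m => \sum_(d <- mondivs m) f d * g (monquo m d).

Definition scaleS (c : K) (f : series) : series := fun m => c * f m.

Definition subS (f g : series) : series := fun m => f m - g m.

Definition powS (f : series) (n : nat) : series := iter n (mulS f) oneS.

(* In the next three definitions f (or 1 - f) has no constant term, so its
   n-th power has no monomial of degree < n and the sums over n are finite. *)
Definition invS (f : series) : series :=
  fun m => \sum_(0 <= n < (mondeg m).+1) powS (subS oneS f) n m.

Definition logS (f : series) : series :=
  fun m => \sum_(1 <= n < (mondeg m).+1)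
             (-1) ^+ n.-1 / n%:R * powS (subS f oneS) n m.

Definition expS (f : series) : series :=
  fun m => \sum_(0 <= n < (mondeg m).+1) (n`!%:R)^-1 * powS f n m.

Definition rpowS (f : series) (r : K) : series := expS (scaleS r (logS f)).

(* For n >= 1 only: z_i^n then has support {i}. *)
Definition pb (n : nat) : series :=
  fun m => \sum_(i <- finsupp m) (m == [fsfun k in [fset i]%fset => n])%:R.

Definition pmu (p : nat -> series) (mu : intpart) : series :=
  \big[mulS/oneS]_(n <- (mu : seq nat)) p n.

(* \sum_mu c_mu p_mu, for p_n homogeneous of degree n: p_mu then contributes
   only to monomials of degree |mu|. *)
Definition psum (p : nat -> series) (c : intpart -> K) : series :=
  fun m => \sum_(0 <= n < (mondeg m).+1)
             \sum_(mu <- partitions_of n) c mu * pmu p mu m.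

(* < 1 + w z^mu >. A factor whose indices are not all in the support of m is
   1 modulo monomials which do not divide m, so that the coefficient of m in
   the infinite product is its coefficient in the finite product over the
   indices in the support of m. *)
Definition symprod (w : K) (mu : intpart) : series :=
  fun m => (\big[mulS/oneS]_(h : {ffun 'I_(size mu) -> finsupp m})
     (fun m' => oneS m' + w * (m' == monpow (fun j => val (h j)))%:R)) m.

(* The factor of the product formula with index (mu, g, beta, m, k);
   n is the exponent n_{mu,g,beta}. *)
Definition lmov_factor (q t : K) (n : intpart -> nat -> int -> int)
    (x : intpart * nat * int * nat * nat) : series :=
  let: (mu, g, beta, m, k) := x in
  let w := q ^ (g%:Z - (k.*2)%:Z + (m.*2)%:Z) * t ^ beta in
  rpowS (mulS (symprod w mu) (invS (symprod (- w) mu)))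
        (m%:R * (n mu g beta)%:~R / (zee mu)%:R).

End Series.

Definition lmov_index (x : intpart * nat * int * nat * nat) : bool :=
  let: (mu, g, beta, m, k) := x in [&& mu != part0, (0 < m)%N & (k <= g)%N].

(* The coefficient of the monomial M in the partial products of
   \prod_(i | P i) f i tends to v along the finite subsets of the index set
   (unconditional convergence; it does not depend on any order of the factors
   and entails convergence of the iterated products). *)
Definition coef_uprod_cvg (C : numFieldType) (I : choiceType) (P : pred I)
    (f : I -> series C) (M : zmon) (v : C) : Prop :=
  forall eps : C, 0 < eps -> exists J0 : {fset I}, forall J : {fset I},
    (J0 `<=` J)%fset ->
    `|(\big[@mulS C/@oneS C]_(i <- enum_fset J | P i) f i) M - v| < eps.

Local Notation "x %:F" := (FracField.tofrac x).

(* The outer variable is q, the inner one is t. *)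
Definition Kqt (C : fieldType) := {fraction {poly {poly C}}}.

Definition qK (C : fieldType) : Kqt C := ('X : {poly {poly C}})%:F.
Definition tK (C : fieldType) : Kqt C := ((('X : {poly C})%:P) : {poly {poly C}})%:F.
Definition cK (C : fieldType) (c : C) : Kqt C := ((c%:P)%:P : {poly {poly C}})%:F.

Section RationalFunctions.
Variable C : fieldType.

Definition eval2 (S : fieldType) (phi : C -> S) (a b : S)
    (p : {poly {poly C}}) : S :=
  (map_poly (fun c : {poly C} => (map_poly phi c).[b]) p).[a].

(* f is regular at (q, t) = (a, b), with value v. *)
Definition has_value (S : fieldType) (phi : C -> S) (a b : S) (f : Kqt C)
    (v : S) : Prop :=
  exists n d : {poly {poly C}},
    [/\ eval2 phi a b d != 0, f = n%:F / d%:F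
      & v = eval2 phi a b n / eval2 phi a b d].

(* f(a, b); used for algebraically independent a and b only, where it does not
   depend on the chosen numerator and denominator of f. *)
Definition subst2 (a b : Kqt C) (f : Kqt C) : Kqt C :=
  let x := generic_quotient.repr f in
  eval2 (@cK C) a b \n_x / eval2 (@cK C) a b \d_x.

Definition neg_t (f : Kqt C) : Kqt C := subst2 (qK C) (- tK C) f.

Definition qbrK (n : nat) : Kqt C := qK C ^+ n - qK C ^- n.

Definition qbrK_part (mu : intpart) : Kqt C :=
  \prod_(i <- (mu : seq nat)) qbrK i.

(* chi n A mu is the character of Br_n labeled by A at a permutation of cycle
   type mu. *)
Definition ZSO_coef (chi : nat -> intpart -> intpart -> C) (W : intpart -> Kqt C)
    (mu : intpart) : Kqt C :=
  let n := psize mu in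
  (zee mu)%:R^-1 *
  \sum_(0 <= k < n./2.+1) \sum_(A <- partitions_of (n - k.*2))
     cK (chi n A mu) * W A.

(* p is the family of the power sums: pb n for Z(z), pb n / [n] for Z(w). *)
Definition ZSO (chi : nat -> intpart -> intpart -> C) (W : intpart -> Kqt C)
    (p : nat -> series (Kqt C)) : series (Kqt C) :=
  psum p (ZSO_coef chi W).

Definition pb_w (n : nat) : series (Kqt C) :=
  scaleS (qbrK n)^-1 (@pb (Kqt C) n).

Definition is_log_expansion (Z : series (Kqt C)) (F : intpart -> Kqt C) : Prop :=
  logS Z =1 psum (@pb (Kqt C)) (fun mu => if mu == part0 then 0 else F mu).

Definition reformulated (F : intpart -> Kqt C) (mu : intpart) : Kqt C :=
  \sum_(1 <= k < (psize mu).+1 | pdvd k mu)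
     (moebius k)%:~R / k%:R * subst2 (qK C ^+ k) (tK C ^+ k) (F (pdiv_by mu k)).

Definition supp_bounded (B : nat) (f : nat -> int -> int) : Prop :=
  forall g beta, f g beta != 0 -> (g <= B)%N /\ `|beta| <= B%:Z.

(* In the next two definitions B bounds the supports, so that the sums are the
   full ones. *)
Definition orthogonal_LMOV (F : intpart -> Kqt C)
    (N : intpart -> nat -> int -> int) : Prop :=
  forall mu : intpart, mu != part0 -> exists B : nat,
    supp_bounded B (N mu) /\
    (zee mu)%:R * qbrK 1 ^+ 2 *
      (reformulated F mu - neg_t (reformulated F mu)) / (2%:R * qbrK_part mu)
    = \sum_(0 <= g < B.+1) \sum_(0 <= b < B.*2.+1)
        (N mu g (b%:Z - B%:Z))%:~R * (qK C - (qK C)^-1) ^+ g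
          * tK C ^ (b%:Z - B%:Z).

Definition character_expansion (N n : intpart -> nat -> int -> int) : Prop :=
  forall mu : intpart, mu != part0 -> exists B : nat,
    [/\ supp_bounded B (N mu), supp_bounded B (n mu) &
        forall beta : int,
          \sum_(0 <= g < B.+1) (N mu g beta)%:~R * (qK C - (qK C)^-1) ^+ g
          = \sum_(0 <= g < B.+1) (n mu g beta)%:~R *
              \sum_(0 <= k < g.+1) qK C ^ (g%:Z - (k.*2)%:Z)].

End RationalFunctions.

Section Brauer.
Variable C : fieldType.
Variable delta : C.

(* Top points are inl i, bottom points are inr i; a diagram is a perfect
   matching of them, given by its partner function. *)
Definition bpt (n : nat) : finType := ('I_n + 'I_n)%type.

Definition is_diagram n (d : {ffun bpt n -> bpt n}) : bool :=
  [forall x, (d (d x) == x) && (d x != x)].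

Definition row3_up n (x : bpt n) : 'I_3 * 'I_n :=
  match x with inl i => (inord 0, i) | inr i => (inord 1, i) end.
Definition row3_down n (x : bpt n) : 'I_3 * 'I_n :=
  match x with inl i => (inord 1, i) | inr i => (inord 2, i) end.
Definition row3_out n (x : bpt n) : 'I_3 * 'I_n :=
  match x with inl i => (inord 0, i) | inr i => (inord 2, i) end.

(* d1 stacked on top of d2, on three rows of n points. *)
Definition stack_edge n (d1 d2 : {ffun bpt n -> bpt n}) : rel ('I_3 * 'I_n) :=
  fun p p' =>
    [exists x, (p == row3_up x) && (p' == row3_up (d1 x))]
    || [exists x, (p == row3_down x) && (p' == row3_down (d2 x))].

Definition diag_comp n (d1 d2 : {ffun bpt n -> bpt n}) : {ffun bpt n -> bpt n} :=
  [ffun x => odflt x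
    [pick y | (y != x) && connect (stack_edge d1 d2) (row3_out x) (row3_out y)]].

Definition diag_loops n (d1 d2 : {ffun bpt n -> bpt n}) : nat :=
  #|[set [set p' | connect (stack_edge d1 d2) p p'] | p : 'I_3 * 'I_n
     & [forall x, ~~ connect (stack_edge d1 d2) p (row3_out x)]]|.

Definition perm_diag n (s : 'S_n) : {ffun bpt n -> bpt n} :=
  [ffun x : bpt n => match x with inl i => inr (s i) | inr i => inl ((s^-1)%g i) end].

(* Representations of Br_n(delta) of degree d, given on the basis of diagrams
   (the values of rho outside diagrams are irrelevant). *)
Definition brauer_rep n d (rho : {ffun bpt n -> bpt n} -> 'M[C]_d) : Prop :=
  rho (perm_diag (1%g : 'S_n)) = 1%:M /\
  forall d1 d2, is_diagram d1 -> is_diagram d2 ->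
    rho d1 *m rho d2 = delta ^+ diag_loops d1 d2 *: rho (diag_comp d1 d2).

(* The row space of U, transposed, is a submodule. *)
Definition brauer_stable n d (rho : {ffun bpt n -> bpt n} -> 'M[C]_d)
    (U : 'M[C]_d) : Prop :=
  forall x, is_diagram x -> (U *m (rho x)^T <= U)%MS.

Definition brauer_irreducible n d (rho : {ffun bpt n -> bpt n} -> 'M[C]_d) : Prop :=
  (0 < d)%N /\
  forall U : 'M[C]_d, brauer_stable rho U -> U != 0 -> row_full U.

Definition brauer_semisimple n : Prop :=
  forall d (rho : {ffun bpt n -> bpt n} -> 'M[C]_d), brauer_rep rho ->
  forall U : 'M[C]_d, brauer_stable rho U ->
  exists U' : 'M[C]_d,
    [/\ brauer_stable rho U', row_full (U + U')%MS & (U :&: U' = 0)%MS].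

Definition through_strands n (d : {ffun bpt n -> bpt n}) : nat :=
  #|[set i : 'I_n | if d (inl i) is inr _ then true else false]|.

(* Vertical strands at the first r points; the points r, r+1, ... are joined
   two by two, on the top row and on the bottom row. *)
Definition cupcap n (r : nat) : {ffun bpt n -> bpt n} :=
  let nb (i : 'I_n) : 'I_n := insubd i (if odd (i - r) then i.-1 else i.+1) in
  [ffun x : bpt n => match x with
    | inl i => if (i < r)%N then inr i else inl (nb i)
    | inr i => if (i < r)%N then inl i else inr (nb i)
    end].

(* The Young diagram A is filled row by row with 0, 1, ..., |A| - 1;
   reshape_index and reshape_offset give the row and the column of an entry. *)
Definition young_stab n (A : intpart) (pos : nat -> nat) : {set 'S_n} :=
  [set s : 'S_n | [forall i : 'I_n,
     if (i < psize A)%N then pos (s i) == pos i else s i == i]].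

(* Action of the Young symmetrizer of A in C[S_|A|], contained in Br_n through
   the first |A| points. *)
Definition young_symmetrizer n d (rho : {ffun bpt n -> bpt n} -> 'M[C]_d)
    (A : intpart) : 'M[C]_d :=
  (\sum_(s in young_stab n A (reshape_index A)) rho (perm_diag s)) *m
  (\sum_(s in young_stab n A (reshape_offset A))
     (-1) ^+ (odd_perm s) *: rho (perm_diag s)).

(* An irreducible V is labeled by A, a partition of r = n - 2k, when r is the
   least number of through strands of a diagram acting nontrivially on V and
   the S_r-module (cupcap r) V is the irreducible module C[S_r] c_A, where c_A
   is the Young symmetrizer of A. *)
Definition brauer_label n d (rho : {ffun bpt n -> bpt n} -> 'M[C]_d)
    (A : intpart) : Prop :=
  (forall x, is_diagram x -> (through_strands x < psize A)%N -> rho x = 0) /\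
  rho (cupcap n (psize A)) *m young_symmetrizer rho A != 0.

Definition cycle_type n (s : 'S_n) : intpart :=
  mkpart [seq #|pred_of_set c| | c <- enum (porbits s)].

Definition is_brauer_characters (chi : nat -> intpart -> intpart -> C) : Prop :=
  forall (n : nat) (A : intpart) (k : nat), psize A = (n - k.*2)%N -> (k.*2 <= n)%N ->
  exists (d : nat) (rho : {ffun bpt n -> bpt n} -> 'M[C]_d),
    [/\ brauer_rep rho, brauer_irreducible rho, brauer_label rho A
      & forall s : 'S_n, chi n A (cycle_type s) = \tr (rho (perm_diag s))].

End Brauer.

(* Braid words on n.+1 strands; (i, true) is the generator on the strands i and
   i+1, (i, false) its inverse. *)
Definition braid (n : nat) := seq ('I_n * bool).

Definition strand_l n (i : 'I_n) : 'I_n.+1 := widen_ord (leqnSn n) i.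
Definition strand_r n (i : 'I_n) : 'I_n.+1 := lift ord0 i.

Definition braid_perm n (b : braid n) : 'S_n.+1 :=
  (\prod_(x <- b) tperm (strand_l x.1) (strand_r x.1))%g.

Definition closure_is_knot n (b : braid n) : bool := #|porbits (braid_perm b)| == 1%N.

Definition writhe n (b : braid n) : int :=
  \sum_(x <- b) (if x.2 then 1 else -1).

(* Operators on the space with basis T, acting on column vectors. *)
Section Operators.
Variable L : fieldType.

Definition kerop (T : finType) (k : T -> T -> L) : 'M[L]_#|T| :=
  \matrix_(i, j) k (enum_val i) (enum_val j).

Definition entry (T : finType) (X : 'M[L]_#|T|) (x y : T) : L :=
  X (enum_rank x) (enum_rank y).

Definition diagop (T : finType) (f : T -> L) : 'M[L]_#|T| :=
  kerop (fun x y => f x *+ (x == y)).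

Definition tensop (T1 T2 : finType) (X : 'M[L]_#|T1|) (Y : 'M[L]_#|T2|) :
    'M[L]_#|{: T1 * T2}| :=
  kerop (fun x y => entry X x.1 y.1 * entry Y x.2 y.2).

Definition flipop (T : finType) : 'M[L]_#|{: T * T}| :=
  kerop (fun x y => ((x.1 == y.2) && (x.2 == y.1))%:R).

(* X acting on the factors i and i+1 of the (n+1)-st tensor power. *)
Definition localop (T : finType) (n : nat) (i : 'I_n) (X : 'M[L]_#|{: T * T}|) :
    'M[L]_#|{ffun 'I_n.+1 -> T}| :=
  kerop (fun f g : {ffun 'I_n.+1 -> T} =>
    entry X (f (strand_l i), f (strand_r i)) (g (strand_l i), g (strand_r i))
    *+ [forall j, (j != strand_l i) && (j != strand_r i) ==> (f j == g j)]).

End Operators.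

(* The ground field is C(s), where s = q^{1/2}. *)
Definition Ls (C : fieldType) := {fraction {poly C}}.
Definition sL (C : fieldType) : Ls C := ('X : {poly C})%:F.
Definition cL (C : fieldType) (c : C) : Ls C := (c%:P : {poly C})%:F.

Section QuantumGroup.
Variables (C : fieldType) (N : nat).
Local Notation L := (Ls C).

(* Weights are written in the orthonormal basis eps_1, ..., eps_N. *)
Definition weight := 'I_N -> int.

Definition ip (x y : weight) : int := \sum_(j < N) x j * y j.

(* eps_i - eps_(i+1), and eps_N for the last simple root. *)
Definition sroot (i : 'I_N) : weight :=
  fun j => (j == i)%:Z - (nat_of_ord j == i.+1)%:Z.

(* The sum 2 rho of the positive roots: 2N - 1, 2N - 3, ..., 1. *)
Definition rho2 : weight := fun i => (N.*2)%:Z - (i.*2.+1)%:Z.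

Definition qpow (z : int) : L := sL C ^ (z * 2%:Z).

(* q_i = q^{(alpha_i, alpha_i)/2}. *)
Definition qi (i : 'I_N) : L := sL C ^ ip (sroot i) (sroot i).

Definition qint (v : L) (n : nat) : L := (v ^+ n - v ^- n) / (v - v^-1).
Definition qfact (v : L) (n : nat) : L := \prod_(1 <= j < n.+1) qint v j.
Definition qbinom (v : L) (n k : nat) : L :=
  qfact v n / (qfact v k * qfact v (n - k)).

(* 1 - a_ij for i != j, where a_ij = 2 (alpha_i, alpha_j)/(alpha_i, alpha_i). *)
Definition serre_exp (i j : 'I_N) : nat :=
  `|1 - ((2%:Z * ip (sroot i) (sroot j)) %/ ip (sroot i) (sroot i))%Z|%N.

(* A finite-dimensional weight module with weights in Z^N (the root lattice),
   with a basis of weight vectors. *)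
Record wmod := WMod {
  bas : finType;
  wt : bas -> weight;
  Eop : 'I_N -> 'M[L]_#|bas|;
  Fop : 'I_N -> 'M[L]_#|bas| }.

Definition Kop (V : wmod) (i : 'I_N) : 'M[L]_#|bas V| :=
  diagop (fun a => qpow (ip (sroot i) (wt a))).
Definition Kinv (V : wmod) (i : 'I_N) : 'M[L]_#|bas V| :=
  diagop (fun a => qpow (- ip (sroot i) (wt a))).

Definition serre (n : nat) (X : 'I_N -> 'M[L]_n) : Prop :=
  forall i j : 'I_N, i != j ->
    \sum_(0 <= r < (serre_exp i j).+1)
      ((-1) ^+ r * qbinom (qi i) (serre_exp i j) r) *:
        (X i ^+ (serre_exp i j - r) *m X j *m X i ^+ r) = 0.

Definition is_wmod (V : wmod) : Prop :=
  [/\ forall i j, Kop V i *m Eop V j = qpow (ip (sroot i) (sroot j)) *: (Eop V j *m Kop V i),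
      forall i j, Kop V i *m Fop V j = qpow (- ip (sroot i) (sroot j)) *: (Fop V j *m Kop V i),
      forall i j, Eop V i *m Fop V j - Fop V j *m Eop V i
                  = ((i == j)%:R / (qi i - (qi i)^-1)) *: (Kop V i - Kinv V i),
      serre (Eop V) & serre (Fop V)].

(* Coproduct E -> E*K + 1*E, F -> F*1 + K^-1*F. *)
Definition tensE (V W : wmod) (i : 'I_N) : 'M[L]_#|{: bas V * bas W}| :=
  tensop (Eop V i) (Kop W i) + tensop 1%:M (Eop W i).
Definition tensF (V W : wmod) (i : 'I_N) : 'M[L]_#|{: bas V * bas W}| :=
  tensop (Fop V i) 1%:M + tensop (Kinv V i) (Fop W i).

Definition tensEop (V W : wmod) (i : 'I_N) : 'M[L]_#|{: bas V * bas W}| :=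
  tensop (Kop V i) (Eop W i) + tensop (Eop V i) 1%:M.
Definition tensFop (V W : wmod) (i : 'I_N) : 'M[L]_#|{: bas V * bas W}| :=
  tensop 1%:M (Fop W i) + tensop (Fop V i) (Kinv W i).

Definition tens (V W : wmod) : wmod :=
  WMod (bas := (bas V * bas W)%type) (fun x j => wt x.1 j + wt x.2 j)
       (tensE V W) (tensF V W).

Definition wordop (n : nat) (X : 'I_N -> 'M[L]_n) (u : seq 'I_N) : 'M[L]_n :=
  foldr (fun i Y => X i *m Y) 1%:M u.

(* Action on V * W of the element q^{H*H} \sum_{u,v} c(u,v) E_u * F_v of the
   completion of U_q * U_q, where c(u,v) = 0 unless E_u and F_v have opposite
   weights. A word of length dim V in the E_i acts by 0 on V, since it would
   take a vector through more than dim V distinct weights. *)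
Definition Raction (c : seq 'I_N -> seq 'I_N -> L) (V W : wmod) :
    'M[L]_#|{: bas V * bas W}| :=
  diagop (fun x : bas V * bas W => qpow (ip (wt x.1) (wt x.2))) *m
  \sum_(0 <= k < #|bas V|.+1) \sum_(u : k.-tuple 'I_N) \sum_(v : k.-tuple 'I_N)
     c u v *: tensop (wordop (Eop V) u) (wordop (Fop W) v).

(* The axioms of the universal R-matrix, R D(x) = D^op(x) R,
   (D * id)R = R_13 R_23 and (id * D)R = R_13 R_12, tested on modules. *)
Definition is_universal_R (c : seq 'I_N -> seq 'I_N -> L) : Prop :=
  [/\ c [::] [::] = 1,
      forall u v, c u v != 0 -> perm_eq u v,
      forall V W, is_wmod V -> is_wmod W -> forall i,
        Raction c V W *m tensE V W i = tensEop V W i *m Raction c V W /\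
        Raction c V W *m tensF V W i = tensFop V W i *m Raction c V W,
      forall U V W, is_wmod U -> is_wmod V -> is_wmod W ->
        forall (x x' : bas U) (y y' : bas V) (z z' : bas W),
        entry (Raction c (tens U V) W) ((x, y), z) ((x', y'), z')
        = \sum_(z1 : bas W) entry (Raction c U W) (x, z) (x', z1)
                            * entry (Raction c V W) (y, z1) (y', z')
    & forall U V W, is_wmod U -> is_wmod V -> is_wmod W ->
        forall (x x' : bas U) (y y' : bas V) (z z' : bas W),
        entry (Raction c U (tens V W)) (x, (y, z)) (x', (y', z'))
        = \sum_(x1 : bas U) entry (Raction c U W) (x, z) (x1, z')
                            * entry (Raction c U V) (x1, y) (x', y')].

Definition is_irreducible (V : wmod) : Prop :=
  (0 < #|bas V|)%N /\
  forall S : 'M[L]_#|bas V|,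
    (forall i, [/\ (S *m (Eop V i)^T <= S)%MS, (S *m (Fop V i)^T <= S)%MS,
                   (S *m (Kop V i)^T <= S)%MS & (S *m (Kinv V i)^T <= S)%MS]) ->
    S != 0 -> row_full S.

Definition has_highest_weight (V : wmod) (lam : weight) : Prop :=
  exists2 v : 'cV[L]_#|bas V|, v != 0 &
    forall i, Eop V i *m v = 0 /\ Kop V i *m v = qpow (ip (sroot i) lam) *: v.

Definition young_weight (A : intpart) : weight := fun i => (nth 0%N A i)%:Z.

Definition Rcheck (c : seq 'I_N -> seq 'I_N -> L) (V : wmod) :
    'M[L]_#|{: bas V * bas V}| :=
  flipop L (bas V) *m Raction c V V.

Definition braid_op (c : seq 'I_N -> seq 'I_N -> L) (V : wmod) n (b : braid n) :
    'M[L]_#|{ffun 'I_n.+1 -> bas V}| :=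
  foldr (fun x Y =>
    localop x.1 (if x.2 then Rcheck c V else invmx (Rcheck c V)) *m Y) 1%:M b.

(* With this coproduct S^2 is the conjugation by K_{2 rho}, which therefore
   defines the quantum trace. *)
Definition qtrace_op (V : wmod) n : 'M[L]_#|{ffun 'I_n.+1 -> bas V}| :=
  diagop (fun f : {ffun 'I_n.+1 -> bas V} =>
            \prod_(j < n.+1) qpow (ip rho2 (wt (f j)))).

(* x is the invariant W_A of the closure of b, for so_{2N+1}. *)
Definition is_so_invariant (A : intpart) n (b : braid n) (x : L) : Prop :=
  exists (V : wmod) (c : seq 'I_N -> seq 'I_N -> L),
    [/\ is_wmod V, is_irreducible V, has_highest_weight V (young_weight A),
        is_universal_R c
      & x = qpow (- (writhe b) *
                  ip (young_weight A) (fun i => young_weight A i + rho2 i))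
            * \tr (qtrace_op V n *m braid_op c V b)].

End QuantumGroup.

(* W_A(q, t) is the rational function which gives the so_{2N+1} invariant at
   t = q^{2N} for all large N (in particular N >= l(A)); this determines it. *)
Definition is_colored_Kauffman (C : fieldType) n (b : braid n)
    (W : intpart -> Kqt C) : Prop :=
  forall A : intpart, exists N0 : nat, forall N : nat,
    (N0 <= N)%N -> (size A <= N)%N -> (0 < N)%N ->
    exists2 x : Ls C,
      has_value (@cL C) (sL C ^+ 2) (sL C ^+ (4 * N)) (W A) x
      & @is_so_invariant C N A n b x.

(* Main.v *)
Require Import Defs.
From HB Require Import structures.
From mathcomp Require Import all_boot all_order all_algebra all_fingroup.
From mathcomp Require Import finmap generic_quotient fraction.
From mathcomp Require Import boolp.
From mathcomp Require Import zify ring lra.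

(** Both sides are exponentials of series without constant term, and the two
exponents agree coefficient by coefficient.

The left-hand side.  The power sums pb_mu are linearly independent
([psum_pb_inj]), so the expansion log Z(z) = sum_mu F_mu pb_mu is an identity
between the coefficients, and it survives the replacement of every pb_n by
pb_n / [n]: log Z(w) = sum_mu F_mu / [mu] pb_mu ([logS_Zw]).  Hence the logarithm
of the quotient is sum_mu (F_mu(q,t) - F_mu(q,-t)) / [mu] pb_mu ([Zw_ratio]).
Moebius inversion gives F_mu(q,t) = sum_(k | mu) 1/k g_(mu/k)(q^k,t^k)
([moebius_inversion]); for even k the sign of t disappears in t^k, so that only
odd k contribute to the difference, and for those the integrality hypothesis
evaluates g_(mu/k)(q^k,t^k) - g_(mu/k)(q^k,-t^k).  The factor [mu] cancels, since
[mu/k] becomes [mu] under q -> q^k, and a factor 1/[k]^2 remains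
([log_coef_difference]).

The right-hand side.  The logarithm of <1 + w z^mu> / <1 - w z^mu> is
sum_(k odd) 2/k w^k pb_(k mu) ([logS_symratio]).  In the sum over m >= 1 the
variable m only enters through sum_m m q^(2km) = q^(2k) / (1 - q^(2k))^2, which is
1/[k]^2: this is where the multiplicity m of the factors comes from, and it is
the only infinite sum, because the coefficient of a given monomial involves
finitely many mu, g and beta ([limit_log_product]).  The coefficient of M in the
exponential of a series is a polynomial in the coefficients of that series at
the divisors of M.  Unconditional convergence and evaluation at (q0, t0) are
compatible with sums and products, so that both pass from the logarithms to the
coefficients in question ([relS_expS]).

The constant term.  The logarithm of Z makes sense because Z has constant term
1 ([ZSO_coef0]), which rests on W_0 = 1: an irreducible module with highest
weight 0 is trivial ([Fv_eq0]), and a rational function of q and t that is 1 at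
t = q^(2N) for all large N is 1 ([ev2_infinitely_many_zeros]).

The laws of log and exp are obtained from the Euler derivation, which multiplies
the coefficient of a monomial by its degree: log f is the solution without
constant term of f * Der L = Der f, and exp g is the solution with constant term
1 of Der E = Der g * E. *)

Set Implicit Arguments.
Unset Strict Implicit.
Unset Printing Implicit Defensive.

Import Order.TTheory GRing.Theory Num.Theory.
Local Open Scope ring_scope.

(** * Monomials *)

Definition addmon (a b : zmon) : zmon :=
  [fsfun i in (finsupp a `|` finsupp b)%fset => (a i + b i)%N].

Lemma addmonE a b i : addmon a b i = (a i + b i)%N.
Proof.
rewrite /addmon fsfun_fun in_fsetU.
by case: finsuppP => //= _; case: finsuppP.
Qed.

Lemma zmonP (a b : zmon) : (forall i, a i = b i) -> a = b.
Proof. by move=> ab; apply/fsfunP. Qed.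

Lemma mon0E i : mon0 i = 0%N.
Proof. exact: fsfun0E. Qed.

Fact addmonA : associative addmon.
Proof. by move=> a b c; apply: zmonP => i; rewrite !addmonE addnA. Qed.
Fact addmonC : commutative addmon.
Proof. by move=> a b; apply: zmonP => i; rewrite !addmonE addnC. Qed.
Fact add0mon : left_id mon0 addmon.
Proof. by move=> a; apply: zmonP => i; rewrite !addmonE mon0E. Qed.

HB.instance Definition _ := Choice.on zmon.
HB.instance Definition _ := GRing.isNmodule.Build zmon addmonA addmonC add0mon.

Lemma mondE (a b : zmon) i : (a + b) i = (a i + b i)%N.
Proof. exact: addmonE. Qed.

Lemma zmon0E i : (0 : zmon) i = 0%N.
Proof. exact: mon0E. Qed.

Lemma mon_sumE (J : Type) (r : seq J) (P : pred J) (F : J -> zmon) i :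
  (\sum_(j <- r | P j) F j) i = (\sum_(j <- r | P j) F j i)%N.
Proof. by elim/big_rec2: _ => [|j x y _ <-]; rewrite ?zmon0E ?mondE. Qed.

Lemma monMnE (a : zmon) k i : (a *+ k) i = (k * a i)%N.
Proof. by elim: k => [|k IH]; rewrite ?mulr0n ?zmon0E // mulrS mondE IH mulSn. Qed.

Lemma monquoE (m d : zmon) i : monquo m d i = (m i - d i)%N.
Proof. by rewrite /monquo fsfun_fun; case: finsuppP. Qed.

Lemma mondeg_sub (S : {fset int}) (m : zmon) :
  (finsupp m `<=` S)%fset -> mondeg m = (\sum_(i <- S) m i)%N.
Proof.
move=> sS; rewrite /mondeg (big_fset_incl _ sS) //= => i _ .
by case: finsuppP.
Qed.

Lemma mondegD (a b : zmon) : mondeg (a + b) = (mondeg a + mondeg b)%N.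
Proof.
set S := (finsupp a `|` (finsupp b `|` finsupp (a + b)%R))%fset.
have s1 : (finsupp a `<=` S)%fset by rewrite fsubsetUl.
have s2 : (finsupp b `<=` S)%fset by rewrite /S fsetUCA fsubsetUl.
have s3 : (finsupp (a + b)%R `<=` S)%fset by rewrite /S fsetUA fsubsetUr.
rewrite !(@mondeg_sub S) //.
by rewrite -big_split; apply: eq_bigr => i _; rewrite mondE.
Qed.

Lemma mondeg0 : mondeg 0 = 0%N.
Proof. by rewrite /mondeg finsupp0 big_seq_fset0. Qed.

Lemma mondeg_eq0 (m : zmon) : (mondeg m == 0%N) = (m == 0).
Proof.
apply/idP/eqP => [|->]; last by rewrite mondeg0.
rewrite /mondeg => h; apply: zmonP => i; rewrite zmon0E.
case: finsuppP => // hi; apply/eqP.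
by move: h; rewrite (big_fsetD1 i) //= addn_eq0 => /andP[].
Qed.

Lemma leq_mondeg (m : zmon) i : (m i <= mondeg m)%N.
Proof.
case: finsuppP => // hi.
by rewrite /mondeg (big_fsetD1 i) //= leq_addr.
Qed.

Definition mondvd (d m : zmon) : bool := `[< forall i, (d i <= m i)%N >].

Lemma mondvdP (d m : zmon) : reflect (forall i, d i <= m i)%N (mondvd d m).
Proof. exact: asboolP. Qed.

Lemma mem_mondivs m d : (d \in mondivs m) = mondvd d m.
Proof.
apply/imageP/mondvdP => [[h hP ->] i|dm].
  move: hP; rewrite inE => /forallP hP.
  rewrite /= fsfun_ffun; case: insubP => //= u _ <-; exact: hP.
have h i : (d i < (mondeg m).+1)%N.
  by rewrite ltnS (leq_trans (dm i)) // leq_mondeg.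
exists [ffun i : finsupp m => Ordinal (h (val i))].
  by rewrite inE; apply/forallP => i; rewrite ffunE /=; exact: dm.
apply: zmonP => i; rewrite fsfun_ffun; case: insubP => [u _ <-|/negbTE hi] /=.
  by rewrite ffunE.
by apply/eqP; rewrite -leqn0 (leq_trans (dm i)) // fsfun_dflt // hi.
Qed.

Lemma uniq_mondivs m : uniq (mondivs m).
Proof.
rewrite map_inj_in_uniq ?enum_uniq // => h1 h2 _ _ /fsfunP e.
apply/ffunP => i; apply: val_inj; have := e (val i).
rewrite !fsfun_ffun; case: insubP => [u _ /val_inj ->//|].
by rewrite (valP i).
Qed.

Lemma mondvdnn m : mondvd m m. Proof. exact/mondvdP. Qed.
Lemma mondvd0 m : mondvd 0 m. Proof. by apply/mondvdP => i; rewrite zmon0E. Qed.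
Lemma mondvd_trans m2 m1 m3 : mondvd m1 m2 -> mondvd m2 m3 -> mondvd m1 m3.
Proof.
by move=> /mondvdP h /mondvdP g; apply/mondvdP => i; exact: leq_trans (h i) (g i).
Qed.
Lemma mondvdD (a b : zmon) : mondvd a (a + b).
Proof. by apply/mondvdP => i; rewrite mondE leq_addr. Qed.

Lemma monquoK (d m : zmon) : mondvd d m -> d + monquo m d = m.
Proof. by move=> /mondvdP h; apply: zmonP => i; rewrite mondE monquoE subnKC. Qed.
Lemma addmonK (d m : zmon) : monquo (d + m) d = m.
Proof. by apply: zmonP => i; rewrite monquoE mondE addKn. Qed.
Lemma addmonI (a : zmon) : injective (+%R a).
Proof. by move=> b c e; rewrite -(addmonK a b) e addmonK. Qed.
Lemma mondvd_quo (d m : zmon) : mondvd (monquo m d) m.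
Proof. by apply/mondvdP => i; rewrite monquoE leq_subr. Qed.
Lemma monquoKK (d m : zmon) : mondvd d m -> monquo m (monquo m d) = d.
Proof. by move=> h; rewrite -{1}(monquoK h) addrC addmonK. Qed.
Lemma mondvd_deg (d m : zmon) : mondvd d m -> (mondeg d <= mondeg m)%N.
Proof. by move=> h; rewrite -(monquoK h) mondegD leq_addr. Qed.
Lemma mondvd_finsupp (d m : zmon) : mondvd d m -> (finsupp d `<=` finsupp m)%fset.
Proof.
move=> /mondvdP h; apply/fsubsetP => i; rewrite !mem_finsupp -!lt0n => hd.
exact: leq_trans hd (h i).
Qed.

Lemma mondivs0 : mondivs 0 = [:: 0].
Proof.
apply: perm_small_eq => //; apply: uniq_perm => [||d] //; first exact: uniq_mondivs.
rewrite mem_mondivs inE; apply/mondvdP/eqP => [h|-> //].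
by apply: zmonP => i; apply/eqP; have := h i; rewrite !zmon0E leqn0.
Qed.

(** * The ring of series *)

(** An alias of [series], so that the ring structure given by [mulS] cannot be
confused with a pointwise one. *)
Definition ser (K : fieldType) := series K.

Section Ring.
Variable K : fieldType.
Implicit Types f g h : ser K.

HB.instance Definition _ := gen_eqMixin (ser K).
HB.instance Definition _ := gen_choiceMixin (ser K).

Definition addser f g : ser K := fun m => f m + g m.
Definition oppser f : ser K := fun m => - f m.
Definition zeroser : ser K := fun=> 0.
Fact addserA : associative addser.
Proof. by move=> f g h; apply: funext => m; rewrite /addser addrA. Qed.
Fact addserC : commutative addser.
Proof. by move=> f g; apply: funext => m; rewrite /addser addrC. Qed.
Fact add0ser : left_id zeroser addser.
Proof. by move=> f; apply: funext => m; rewrite /addser add0r. Qed.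
Fact addNser : left_inverse zeroser oppser addser.
Proof. by move=> f; apply: funext => m; rewrite /addser addNr. Qed.
HB.instance Definition _ :=
  GRing.isZmodule.Build (ser K) addserA addserC add0ser addNser.

Let mulser : ser K -> ser K -> ser K := @mulS K.

Fact mulserC : commutative mulser.
Proof.
move=> f g; apply: funext => m; rewrite /mulser /mulS.
have p : perm_eq (mondivs m) (map (monquo m) (mondivs m)).
  apply: uniq_perm => [||d]; rewrite ?uniq_mondivs //.
    rewrite map_inj_in_uniq ?uniq_mondivs // => a b.
    by rewrite !mem_mondivs => ha hb e; rewrite -(monquoKK ha) e monquoKK.
  rewrite mem_mondivs; apply/idP/mapP => [h|[c _ ->]]; last exact: mondvd_quo.
  by exists (monquo m d); rewrite ?mem_mondivs ?mondvd_quo ?monquoKK.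
rewrite (perm_big _ p) big_map big_seq [RHS]big_seq; apply: eq_bigr => d.
by rewrite mem_mondivs => h; rewrite monquoKK // mulrC.
Qed.

Fact mulserA : associative mulser.
Proof.
move=> f g h; apply/esym/funext => m; rewrite /mulser /mulS.
under eq_bigr do rewrite mulr_suml.
have L : forall d, d \in mondivs m ->
   \sum_(e <- mondivs d) f e * g (monquo d e) * h (monquo m d)
   = \sum_(e <- mondivs m | mondvd e d) f e * g (monquo d e) * h (monquo m d).
  move=> d; rewrite mem_mondivs => dm; rewrite -[RHS]big_filter; apply: perm_big.
  apply: uniq_perm; rewrite ?filter_uniq ?uniq_mondivs // => e.
  rewrite mem_filter !mem_mondivs; case: (boolP (mondvd e d)) => //= ed.
  by rewrite (mondvd_trans ed dm).
rewrite big_seq (eq_bigr _ L) -big_seq (exchange_big_dep predT) //= {L}.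
rewrite big_seq [RHS]big_seq; apply: eq_bigr => e.
rewrite mem_mondivs => em; rewrite mulr_sumr.
have p : perm_eq (filter (mondvd e) (mondivs m))
   (map (+%R e) (mondivs (monquo m e))).
  apply: uniq_perm; rewrite ?filter_uniq ?uniq_mondivs //.
    by rewrite map_inj_uniq ?uniq_mondivs //; exact: addmonI.
  move=> d; rewrite mem_filter mem_mondivs; apply/andP/mapP => [[ed dm]|[c]].
    exists (monquo d e); last by rewrite monquoK.
    rewrite mem_mondivs; apply/mondvdP => i; rewrite !monquoE leq_sub2r //.
    exact/mondvdP.
  rewrite mem_mondivs => cm ->; split; first exact: mondvdD.
  apply/mondvdP => i; rewrite mondE -(monquoK em) mondE leq_add2l.
  exact/mondvdP.
rewrite -big_filter (perm_big _ p) big_map; apply: eq_bigr => c _.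
rewrite addmonK -mulrA; congr (_ * (_ * h _)).
by apply: zmonP => i; rewrite !monquoE mondE subnDA.
Qed.

Fact mul1ser : left_id (@oneS K : ser K) mulser.
Proof.
move=> f; apply: funext => m; rewrite /mulser /mulS.
rewrite (bigD1_seq mon0) ?uniq_mondivs ?mem_mondivs ?mondvd0 //=.
rewrite big1 => [|d /negbTE dn]; last by rewrite /oneS dn mul0r.
rewrite addr0 /oneS eqxx mul1r; congr (f _).
by apply: zmonP => i; rewrite monquoE mon0E subn0.
Qed.

Fact mulserDl : left_distributive mulser addser.
Proof.
move=> f g h; apply: funext => m; rewrite /mulser /mulS /addser -big_split /=.
by apply: eq_bigr => d _; rewrite mulrDl.
Qed.

Fact oner_ser_neq0 : (@oneS K : ser K) != 0.
Proof.
apply/eqP => /(congr1 (fun f : ser K => f mon0)).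
by rewrite /oneS eqxx => /eqP; rewrite oner_eq0.
Qed.

HB.instance Definition _ := GRing.Zmodule_isComNzRing.Build (ser K)
  mulserA mulserC mul1ser mulserDl oner_ser_neq0.

Lemma serP f g : (forall m, f m = g m) -> f = g.
Proof. exact: funext. Qed.

Lemma serME f g m : (f * g) m = \sum_(d <- mondivs m) f d * g (monquo m d).
Proof. by []. Qed.

Lemma serDE f g m : (f + g) m = f m + g m. Proof. by []. Qed.
Lemma serNE f m : (- f) m = - f m. Proof. by []. Qed.
Lemma serBE f g m : (f - g) m = f m - g m. Proof. by []. Qed.
Lemma ser0E m : (0 : ser K) m = 0. Proof. by []. Qed.
Lemma ser1E m : (1 : ser K) m = (m == mon0)%:R. Proof. by []. Qed.

Lemma ser_sumE (J : Type) (r : seq J) (P : pred J) (F : J -> ser K) m :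
  (\sum_(j <- r | P j) F j) m = \sum_(j <- r | P j) F j m.
Proof. by elim/big_rec2: _ => [|j x y _ <-]; rewrite ?ser0E ?serDE. Qed.

Lemma serM0 f g : (f * g) mon0 = f mon0 * g mon0.
Proof.
rewrite serME mondivs0 big_seq1; congr (_ * g _).
by apply: zmonP => i; rewrite monquoE !zmon0E.
Qed.

Lemma powSE f n : powS f n = (f : ser K) ^+ n.
Proof. by elim: n => //= n ->; rewrite exprS. Qed.

Definition scal (c : K) f : ser K := scaleS c f.

Lemma scalE c f m : scal c f m = c * f m. Proof. by []. Qed.
Lemma scalAl c f g : scal c f * g = scal c (f * g).
Proof.
apply: serP => m; rewrite scalE !serME mulr_sumr.
by apply: eq_bigr => d _; rewrite scalE mulrA.
Qed.
Lemma scalAr c f g : f * scal c g = scal c (f * g).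
Proof. by rewrite mulrC scalAl mulrC. Qed.

(** Congruence modulo the ideal of the series whose coefficients vanish at all
divisors of M.  It is the right notion of truncation here: the infinite products
and the infinite sums over powers become finite modulo this ideal. *)
Definition eqser (M : zmon) f g := forall d, mondvd d M -> f d = g d.

Lemma eqser_refl M f : eqser M f f. Proof. by []. Qed.
Lemma eqserM M f f' g g' :
  eqser M f f' -> eqser M g g' -> eqser M (f * g) (f' * g').
Proof.
move=> hf hg d dM; rewrite !serME big_seq [RHS]big_seq; apply: eq_bigr => e.
rewrite mem_mondivs => ed; rewrite hf ?hg //.
  exact: mondvd_trans (mondvd_quo _ _) dM.
exact: mondvd_trans dM.
Qed.
Lemma eqserX M f f' n : eqser M f f' -> eqser M (f ^+ n) (f' ^+ n).
Proof. by move=> h; elim: n => // n IH; rewrite !exprS; apply: eqserM. Qed.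
Lemma eqser_prod M (J : Type) (r : seq J) (P : pred J) (F G : J -> ser K) :
  (forall j, P j -> eqser M (F j) (G j)) ->
  eqser M (\prod_(j <- r | P j) F j) (\prod_(j <- r | P j) G j).
Proof.
by move=> h; elim/big_rec2: _ => // j x y /h hj IH; apply: eqserM.
Qed.

Definition monS (a : zmon) : ser K := fun m => (m == a)%:R.

Lemma monSD a b : monS (a + b) = monS a * monS b.
Proof.
apply: serP => m; rewrite serME.
have [am|am] := boolP (mondvd a m); last first.
  rewrite big_seq big1 => [|d].
    by rewrite /monS; case: eqP => // mab; case/negP: am; rewrite mab mondvdD.
  rewrite mem_mondivs => dm; rewrite /monS; case: eqP => [da|_]; rewrite ?mul0r //.
  by rewrite da (negbTE am) in dm.
rewrite (bigD1_seq a) ?uniq_mondivs ?mem_mondivs //= big1 => [|d /negbTE da].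
  rewrite addr0 /monS eqxx mul1r; congr (_%:R); congr nat_of_bool.
  by apply/eqP/eqP => [->|<-]; rewrite ?addmonK ?monquoK.
by rewrite /monS da mul0r.
Qed.
Lemma monS_prod (J : Type) (r : seq J) (P : pred J) (F : J -> zmon) :
  \prod_(j <- r | P j) monS (F j) = monS (\sum_(j <- r | P j) F j).
Proof. by elim/big_rec2: _ => // j x y _ ->; rewrite monSD. Qed.

End Ring.

(** * The Euler derivation, logarithm and exponential *)

Section LogExp.
Variable K : fieldType.
Hypothesis char0 : forall n, n.+1%:R != 0 :> K.
Implicit Types f g h u : ser K.

Definition Der f : ser K := fun m => (mondeg m)%:R * f m.

Lemma DerE f m : Der f m = (mondeg m)%:R * f m. Proof. by []. Qed.
Lemma Der_mon0 f : Der f mon0 = 0.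
Proof. by rewrite DerE mondeg0 mul0r. Qed.
Lemma one_mon0 : (1 : ser K) mon0 = 1.
Proof. by rewrite ser1E eqxx. Qed.
Lemma Der1 : Der 1 = 0.
Proof.
apply: serP => m; rewrite DerE ser1E.
by case: eqP => [->|_]; rewrite ?mondeg0 ?mul0r ?mulr0.
Qed.
Lemma DerD f g : Der (f + g) = Der f + Der g.
Proof. by apply: serP => m; rewrite !(DerE, serDE) mulrDr. Qed.
Lemma DerB f g : Der (f - g) = Der f - Der g.
Proof. by apply: serP => m; rewrite !(DerE, serBE) mulrBr. Qed.
Lemma Der_scal c f : Der (scal c f) = scal c (Der f).
Proof. by apply: serP => m; rewrite !(DerE, scalE) mulrCA. Qed.
Lemma Der_sum (J : Type) (r : seq J) (P : pred J) (F : J -> ser K) :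
  Der (\sum_(j <- r | P j) F j) = \sum_(j <- r | P j) Der (F j).
Proof.
apply: serP => m; rewrite DerE !ser_sumE mulr_sumr.
by apply: eq_bigr => j _.
Qed.
Lemma DerM f g : Der (f * g) = Der f * g + f * Der g.
Proof.
apply: serP => m; rewrite DerE serDE !serME mulr_sumr -big_split /=.
rewrite big_seq [RHS]big_seq; apply: eq_bigr => d; rewrite mem_mondivs => dm.
rewrite !DerE -[in mondeg m](monquoK dm) mondegD natrD mulrDl mulrA.
by congr (_ + _); rewrite mulrCA.
Qed.
Lemma DerX f n : Der (f ^+ n.+1) = scal n.+1%:R (f ^+ n * Der f).
Proof.
elim: n => [|n IH]; first by apply: serP => m; rewrite scalE expr1 expr0 !mul1r.
rewrite exprS DerM IH; apply: serP => m.
by rewrite scalAr serDE !scalE [Der f * _]mulrC (mulrA f) -exprS -[n.+2%:R]natr1 mulrDl mul1r addrC.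
Qed.
Lemma eqserDer M f g : eqser M f g -> eqser M (Der f) (Der g).
Proof. by move=> h d dM; rewrite !DerE h. Qed.

Lemma natr_inj_char0 n : n%:R = 0 :> K -> n = 0%N.
Proof. by case: n => // n /eqP; rewrite (negbTE (char0 n)). Qed.

Lemma Der_eq0 f : Der f = 0 -> f mon0 = 0 -> f = 0.
Proof.
move=> Df f0; apply: serP => m; rewrite ser0E.
have /eqP : Der f m = 0 by rewrite Df.
rewrite DerE mulf_eq0 => /orP[/eqP/natr_inj_char0/eqP|/eqP //].
by rewrite mondeg_eq0 => /eqP ->.
Qed.

Definition ordge n f := forall m, (mondeg m < n)%N -> f m = 0.

Lemma ordgeM a b f g : ordge a f -> ordge b g -> ordge (a + b) (f * g).
Proof.
move=> hf hg m hm; rewrite serME big_seq big1 // => d; rewrite mem_mondivs => dm.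
have [/hf ->|da] := ltnP (mondeg d) a; first by rewrite mul0r.
rewrite hg ?mulr0 // -(ltn_add2l (mondeg d)) -mondegD monquoK //.
by apply: leq_trans hm _; rewrite leq_add2r.
Qed.
Lemma ordge1 f : f mon0 = 0 -> ordge 1 f.
Proof. by move=> f0 m; rewrite ltnS leqn0 mondeg_eq0 => /eqP ->. Qed.
Lemma ordgeX f n : f mon0 = 0 -> ordge n (f ^+ n).
Proof.
move=> f0; elim: n => // n IH; rewrite exprS -add1n.
by apply: ordgeM => //; exact: ordge1.
Qed.

(** The equation expresses deg(m) h_m through coefficients of h of smaller degree,
since u has no constant term. *)
Lemma linear_ode_eq0 h u : u mon0 = 0 -> h mon0 = 0 -> Der h = u * h -> h = 0.
Proof.
move=> u0 h0 Dh.
suff H n : ordge n h by apply: serP => m; exact: (H _ _ (ltnSn _)).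
elim: n => // n IH m hm.
have /eqP : Der h m = 0.
  by rewrite Dh (ordgeM (ordge1 u0) IH) // add1n.
rewrite DerE mulf_eq0 => /orP[/eqP/natr_inj_char0/eqP|/eqP //].
by rewrite mondeg_eq0 => /eqP ->.
Qed.

(** The three series inverse, logarithm and exponential are substitutions of a
series without constant term into a univariate series with coefficients c. *)
Definition subser (a : nat) (c : nat -> K) u : ser K :=
  fun m => \sum_(a <= n < (mondeg m).+1) c n * (u ^+ n) m.

(** A power u^n has no monomial of degree less than n. *)
Lemma subser_eq a c u M : (a <= 1)%N -> u mon0 = 0 ->
  eqser M (subser a c u) (\sum_(a <= n < (mondeg M).+1) scal (c n) (u ^+ n)).
Proof.
move=> a1 u0 d dM; rewrite ser_sumE /subser.
have leD : ((mondeg d).+1 <= (mondeg M).+1)%N by rewrite ltnS mondvd_deg.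
rewrite [RHS](big_cat_nat (leq_trans a1 (ltn0Sn (mondeg d))) leD) /=.
rewrite [X in _ + X]big_nat_cond [X in _ + X]big1 ?addr0 // => n.
by rewrite andbT => /andP[hn _]; rewrite scalE (ordgeX u0) ?mulr0.
Qed.

Lemma subser_mon0 a c u : (a <= 1)%N -> subser a c u mon0 = (a == 0%N)%:R * c 0%N.
Proof.
rewrite /subser mondeg0; case: a => [|[|//]] _.
  by rewrite big_nat1 expr0 ser1E eqxx mulr1 mul1r.
by rewrite big_nil mul0r.
Qed.

Lemma logSE f : logS f = subser 1 (fun n => (-1) ^+ n.-1 / n%:R) (f - 1).
Proof. by apply: serP => m; apply: eq_bigr => n _; rewrite powSE. Qed.
Lemma expSE f : expS f = subser 0 (fun n => n`!%:R^-1) f.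
Proof. by apply: serP => m; apply: eq_bigr => n _; rewrite powSE. Qed.
Lemma invSE f : invS f = subser 0 (fun=> 1) (1 - f).
Proof. by apply: serP => m; apply: eq_bigr => n _; rewrite powSE mul1r. Qed.

Lemma logS_mon0 f : logS f mon0 = 0.
Proof. by rewrite logSE subser_mon0 //= mul0r. Qed.
Lemma expS_mon0 f : expS f mon0 = 1.
Proof. by rewrite expSE subser_mon0 //= mul1r fact0 invr1. Qed.
Lemma invS_mon0 f : invS f mon0 = 1.
Proof. by rewrite invSE subser_mon0 //= mul1r. Qed.

(** Telescoping of the geometric series of 1 - f. *)
Lemma invSK f : f mon0 = 1 -> f * (invS f : ser K) = 1.
Proof.
move=> f0; apply: serP => M; rewrite invSE.
have u0 : (1 - f) mon0 = 0 by rewrite serBE f0 ser1E eqxx subrr.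
rewrite (eqserM (@eqser_refl _ M f) (subser_eq (M := M) _ (leq0n 1) u0)); last exact: mondvdnn.
set S := \sum_(_ <= _ < _) _.
have -> : S = \sum_(i < (mondeg M).+1) (1 - f) ^+ i.
  by rewrite /S big_mkord; apply: eq_bigr => i _; apply: serP => m; rewrite scalE mul1r.
have e : f = 1 - (1 - f) by rewrite opprB addrCA subrr addr0.
move: (1 - f) u0 e => v u0 ->.
by rewrite -[1 - v]opprB mulNr -subrX1 opprB serBE (ordgeX u0) ?subr0.
Qed.

Lemma ser_unit_cancel f g : f mon0 = 1 -> f * g = 0 -> g = 0.
Proof.
by move=> f0 fg; rewrite -[g]mul1r -(invSK f0) mulrAC fg mul0r.
Qed.

(** Differentiating the series of log (1 + u) term by term leaves the geometric
series of - u, whose partial sums telescope against 1 + u. *)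
Lemma Der_logS f : f mon0 = 1 -> f * Der (logS f) = Der f.
Proof.
move=> f0; apply: serP => M; rewrite logSE.
set u := f - 1; have u0 : u mon0 = 0 by rewrite /u serBE f0 ser1E eqxx subrr.
have eu : Der u = Der f by rewrite /u DerB Der1 subr0.
rewrite (eqserM (@eqser_refl _ M f) (eqserDer (subser_eq (M := M) _ (leqnn 1) u0))); last exact: mondvdnn.
have -> : Der (\sum_(1 <= n < (mondeg M).+1) scal ((-1) ^+ n.-1 / n%:R) (u ^+ n))
   = (\sum_(i < mondeg M) (- u) ^+ i) * Der f.
  rewrite Der_sum big_add1 /= big_mkord mulr_suml; apply: eq_bigr => i _.
  rewrite Der_scal DerX eu; apply: serP => m; rewrite !scalE mulrA mulfVK //.
  rewrite (exprNn u) -mulrA /=; move: (_ * Der f) => x.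
  rewrite -[(-1) ^+ i in LHS]signr_odd -[(-1) ^+ i in RHS]signr_odd.
  by case: (odd i); rewrite ?expr1 ?mulN1r ?expr0 ?mul1r.
have e : f = 1 + u by rewrite /u addrCA subrr addr0.
rewrite mulrA {1}e -[1 + u]opprK opprD addrC -mulrA mulNr mulrA -[- u - 1]/(- u + - 1).
rewrite -subrX1 -mulNr opprB mulrBl mul1r serBE.
have v0 : (- u) mon0 = 0 by rewrite serNE u0 oppr0.
by rewrite (ordgeM (ordgeX (n := mondeg M) v0) (ordge1 (Der_mon0 f))) ?subr0 ?addn1.
Qed.

Lemma Der_expS g : g mon0 = 0 -> Der (expS g) = Der g * (expS g : ser K).
Proof.
move=> g0; apply: serP => M; rewrite expSE.
rewrite (eqserDer (subser_eq (M := M) _ (leq0n 1) g0)) ?mondvdnn //.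
rewrite (eqserM (@eqser_refl _ M _) (subser_eq (M := M) _ (leq0n 1) g0)) ?mondvdnn //.
rewrite Der_sum big_nat_recl // expr0 Der_scal Der1 [in RHS]big_nat_recr //=.
rewrite mulrDr !serDE scalE ser0E mulr0 add0r scalAr scalE.
rewrite (ordgeM (ordge1 (Der_mon0 g)) (ordgeX (n := mondeg M) g0)) ?add1n // mulr0 addr0.
rewrite mulr_sumr; congr (_ M); apply: eq_bigr => n _.
apply: serP => m; rewrite Der_scal DerX scalAr !scalE factS natrM invfM [Der g * _]mulrC.
by rewrite mulrA [_ * _ * _%:R]mulrAC mulVf // mul1r.
Qed.

(** Injectivity of Der on series without constant term: the logarithmic derivative
determines the logarithm, which turns all the laws of log into the Leibniz rule. *)
Lemma logS_uniq f (L : ser K) : f mon0 = 1 -> L mon0 = 0 -> f * Der L = Der f ->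
  logS f = L :> ser K.
Proof.
move=> f0 L0 h; apply/eqP; rewrite -subr_eq0; apply/eqP/Der_eq0.
  by apply: (ser_unit_cancel f0); rewrite DerB mulrBr Der_logS // h subrr.
by rewrite serBE logS_mon0 L0 subrr.
Qed.

Lemma logS1 : logS (1 : ser K) = 0 :> ser K.
Proof.
apply: logS_uniq; rewrite ?one_mon0 //.
by rewrite Der1 mul1r; apply: serP => m; rewrite DerE mulr0.
Qed.

Lemma logSM f g : f mon0 = 1 -> g mon0 = 1 ->
  logS (f * g) = (logS f : ser K) + logS g :> ser K.
Proof.
move=> f0 g0; apply: logS_uniq; rewrite ?serM0 ?f0 ?g0 ?mulr1 //.
  by rewrite serDE !logS_mon0 addr0.
rewrite DerD DerM -(Der_logS f0) -(Der_logS g0) mulrDr.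
by rewrite (mulrAC f g) -(mulrA f g).
Qed.

Lemma prod_mon0 (J : Type) (r : seq J) (P : pred J) (F : J -> ser K) :
  (forall j, P j -> F j mon0 = 1) -> (\prod_(j <- r | P j) F j) mon0 = 1.
Proof.
by move=> h; elim/big_rec: _ => [|j x /h hj hx]; rewrite ?one_mon0 // serM0 hj hx mulr1.
Qed.

Lemma logS_prod (J : Type) (r : seq J) (P : pred J) (F : J -> ser K) :
  (forall j, P j -> F j mon0 = 1) ->
  logS (\prod_(j <- r | P j) F j) = \sum_(j <- r | P j) (logS (F j) : ser K) :> ser K.
Proof.
move=> h; elim: r => [|j r IH]; first by rewrite !big_nil logS1.
rewrite !big_cons; case: ifP => // Pj.
by rewrite logSM ?IH ?h // prod_mon0.
Qed.

Lemma logSV f : f mon0 = 1 -> logS (invS f) = - (logS f : ser K) :> ser K.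
Proof.
move=> f0; apply/eqP; rewrite -addr_eq0 addrC -logSM ?invS_mon0 //.
by rewrite invSK // logS1.
Qed.

Lemma expS_uniq f g : f mon0 = 1 -> g mon0 = 0 -> Der f = Der g * f -> expS g = f :> ser K.
Proof.
move=> f0 g0 h; apply/eqP; rewrite -subr_eq0; apply/eqP.
apply: (@linear_ode_eq0 _ (Der g)); rewrite ?Der_mon0 //.
  by rewrite serBE expS_mon0 f0 subrr.
by rewrite DerB mulrBr Der_expS // h.
Qed.

Lemma expS0 : expS (0 : ser K) = 1 :> ser K.
Proof.
apply: expS_uniq; rewrite ?one_mon0 // Der1; apply: serP => m.
by rewrite (_ : Der 0 = 0) ?mul0r //; apply: serP => n; rewrite DerE mulr0.
Qed.

Lemma logSK f : f mon0 = 1 -> expS (logS f) = f :> ser K.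
Proof.
move=> f0; apply: expS_uniq; rewrite ?logS_mon0 //.
by rewrite mulrC Der_logS.
Qed.

Lemma expSD f g : f mon0 = 0 -> g mon0 = 0 ->
  expS (f + g) = (expS f : ser K) * expS g :> ser K.
Proof.
move=> f0 g0; apply: expS_uniq; rewrite ?serM0 ?expS_mon0 ?mulr1 //.
  by rewrite serDE f0 g0 addr0.
by rewrite DerD mulrDl DerM !Der_expS // (mulrA (Der f)) (mulrCA (Der g)).
Qed.

Lemma sum_mon0 (J : Type) (r : seq J) (P : pred J) (F : J -> ser K) :
  (forall j, P j -> F j mon0 = 0) -> (\sum_(j <- r | P j) F j) mon0 = 0.
Proof. by move=> h; rewrite ser_sumE big1. Qed.

Lemma expS_sum (J : Type) (r : seq J) (P : pred J) (F : J -> ser K) :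
  (forall j, P j -> F j mon0 = 0) ->
  expS (\sum_(j <- r | P j) F j) = \prod_(j <- r | P j) (expS (F j) : ser K) :> ser K.
Proof.
move=> h; elim: r => [|j r IH]; first by rewrite !big_nil expS0.
rewrite !big_cons; case: ifP => // Pj.
by rewrite expSD ?IH ?h // sum_mon0.
Qed.

Lemma eqser_logS M f g : f mon0 = 1 -> g mon0 = 1 ->
  eqser M f g -> eqser M (logS f) (logS g).
Proof.
move=> f0 g0 fg d dM; rewrite !logSE /subser; apply: eq_bigr => n _; congr (_ * _).
by apply: (eqserX (M := M)) => // e eM; rewrite !serBE fg.
Qed.

End LogExp.

(** * Partitions and power sums *)

Lemma intpart_sorted (mu : intpart) : sorted geq mu.
Proof. by case: mu => s /= /andP[]. Qed.
Lemma intpart_pos (mu : intpart) n : n \in (mu : seq nat) -> (0 < n)%N.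
Proof. by case: mu => s /= /andP[_ h] hn; rewrite lt0n; apply: contraNneq h => <-. Qed.

Lemma geq_trans : transitive geq. Proof. by move=> a b c h g; exact: leq_trans g h. Qed.
Lemma geq_anti : antisymmetric geq. Proof. by move=> a b; rewrite andbC; exact: anti_leq. Qed.

Lemma intpart_eq (mu nu : intpart) : perm_eq mu nu -> mu = nu.
Proof.
move=> h; apply: val_inj; apply: (sorted_eq geq_trans geq_anti) => //; exact: intpart_sorted.
Qed.

Lemma mkpart_perm (s : seq nat) : perm_eq (mkpart s) [seq i <- s | 0 < i]%N.
Proof. by rewrite /= perm_sort. Qed.
Lemma mkpart_perm_pos (s : seq nat) : all (leq 1) s -> perm_eq (mkpart s) s.
Proof. by move=> h; rewrite (permPl (mkpart_perm s)) (all_filterP h). Qed.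
Lemma intpart_all_pos (mu : intpart) : all (leq 1) mu.
Proof. by apply/allP => n /intpart_pos. Qed.

Lemma sumn_pos (s : seq nat) : sumn [seq i <- s | 0 < i]%N = sumn s.
Proof. by elim: s => // -[|a] s /= ->. Qed.
Lemma psize_mkpart s : psize (mkpart s) = sumn s.
Proof. by rewrite /psize (perm_sumn (mkpart_perm s)) sumn_pos. Qed.

Lemma size_psize (mu : intpart) : (size mu <= psize mu)%N.
Proof.
rewrite /psize; elim: (mu : seq nat) (intpart_all_pos mu) => //= a s IH /andP[a0 /IH h].
by rewrite -add1n leq_add.
Qed.
Lemma part_le_psize (mu : intpart) i : i \in (mu : seq nat) -> (i <= psize mu)%N.
Proof.
rewrite /psize; elim: (mu : seq nat) => //= a s IH; rewrite inE => /orP[/eqP ->|/IH h].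
  exact: leq_addr.
exact: leq_trans h (leq_addl _ _).
Qed.

Lemma mem_partitions_of n mu : (mu \in partitions_of n) = (psize mu == n).
Proof.
rewrite mem_undup; apply/imageP/eqP => [[t]|<-].
  by rewrite inE => /eqP e ->; rewrite psize_mkpart.
have sz : size [seq inord i : 'I_(psize mu).+1
    | i <- (mu : seq nat) ++ nseq (psize mu - size mu) 0%N] == psize mu.
  by rewrite size_map size_cat size_nseq subnKC ?size_psize.
have e : [seq val i | i <- Tuple sz]
    = (mu : seq nat) ++ nseq (psize mu - size mu) 0%N.
  rewrite /= -map_comp -[RHS]map_id; apply/eq_in_map => i /=.
  rewrite mem_cat mem_nseq => h; rewrite inordK // ltnS.
  by case/orP: h => [/part_le_psize//|/andP[_ /eqP ->]].
exists (Tuple sz).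
  by rewrite inE e sumn_cat sumn_nseq mul0n addn0.
rewrite e; apply: intpart_eq; rewrite perm_sym.
rewrite (permPl (mkpart_perm _)) filter_cat.
have -> : [seq i <- nseq (psize mu - size mu) 0%N | (0 < i)%N] = [::].
  by elim: (_ - _)%N.
by rewrite cats0 (all_filterP (intpart_all_pos mu)).
Qed.

Lemma uniq_partitions_of n : uniq (partitions_of n).
Proof. exact: undup_uniq. Qed.

Definition partunion (mu nu : intpart) := mkpart ((mu : seq nat) ++ nu).

Lemma partunion_perm (mu nu : intpart) :
  perm_eq (partunion mu nu) ((mu : seq nat) ++ nu).
Proof. by apply: mkpart_perm_pos; rewrite all_cat !intpart_all_pos. Qed.

Lemma psize0 : psize part0 = 0%N.
Proof. by rewrite psize_mkpart. Qed.
Lemma psize_eq0 mu : (psize mu == 0%N) = (mu == part0).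
Proof.
apply/eqP/eqP => [h|->]; last exact: psize0.
have : size mu == 0%N by rewrite -leqn0 -h size_psize.
by move=> /nilP e; apply: intpart_eq; rewrite e.
Qed.

Lemma partitions_of0 : partitions_of 0 = [:: part0].
Proof.
apply: perm_small_eq => //; apply: uniq_perm; rewrite ?uniq_partitions_of // => mu.
by rewrite mem_partitions_of psize_eq0 inE.
Qed.

Definition parts_upto (N : nat) : seq intpart :=
  [seq mu | n <- iota 0 N.+1, mu <- partitions_of n].

Lemma mem_parts_upto N mu : (mu \in parts_upto N) = (psize mu <= N)%N.
Proof.
apply/allpairsPdep/idP => [[n [nu [hn]]]|h].
  by rewrite mem_partitions_of => /eqP e ->; rewrite mem_iota in hn; rewrite e.
by exists (psize mu), mu; rewrite mem_iota mem_partitions_of.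
Qed.
Lemma uniq_parts_upto N : uniq (parts_upto N).
Proof.
apply: allpairs_uniq_dep; [exact: iota_uniq | by move=> n _; exact: uniq_partitions_of |].
move=> x y /allpairsPdep[n [mu [_ h ->]]] /allpairsPdep[k [nu [_ h' ->]]] /= e.
by move: h h'; rewrite !mem_partitions_of e => /eqP h1 /eqP h2; rewrite -h1 -h2.
Qed.

Section PowerSums.
Variable K : fieldType.
Implicit Types f g h u : ser K.

Definition homog n f := forall m, mondeg m != n -> f m = 0.

Lemma homogM a b f g : homog a f -> homog b g -> homog (a + b) (f * g).
Proof.
move=> hf hg m hm; rewrite serME big_seq big1 // => d; rewrite mem_mondivs => dm.
have [ea|/hf ->] := eqVneq (mondeg d) a; last by rewrite mul0r.
rewrite hg ?mulr0 //; apply: contraNneq hm => eb.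
by rewrite -(monquoK dm) mondegD ea eb.
Qed.

Lemma pmuE (p : nat -> ser K) mu : pmu p mu = \prod_(n <- (mu : seq nat)) p n :> ser K.
Proof. by []. Qed.

Lemma homog_prod (p : nat -> ser K) s :
  (forall n, n \in s -> homog n (p n)) -> homog (sumn s) (\prod_(n <- s) p n).
Proof.
elim: s => [_ m|n s IH h]; rewrite ?big_nil ?big_cons /=.
  by rewrite mondeg_eq0 ser1E => /negbTE ->.
apply: homogM; first by apply: h; rewrite mem_head.
by apply: IH => k hk; apply: h; rewrite inE hk orbT.
Qed.

Variable p : nat -> ser K.
Hypothesis hp : forall n, (0 < n)%N -> homog n (p n).

Lemma homog_pmu mu : homog (psize mu) (pmu p mu).
Proof. by apply: homog_prod => n /intpart_pos; exact: hp. Qed.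

Lemma pmu0 : pmu p part0 = 1 :> ser K.
Proof. by rewrite pmuE big_nil. Qed.
Lemma pmu_union mu nu :
  pmu p (partunion mu nu) = (pmu p mu : ser K) * pmu p nu :> ser K.
Proof. by rewrite !pmuE (perm_big _ (partunion_perm mu nu)) big_cat. Qed.

(** The power sum p_mu is homogeneous of degree |mu|. *)
Lemma psumE_size c m :
  psum p c m = \sum_(mu <- partitions_of (mondeg m)) c mu * pmu p mu m.
Proof.
rewrite /psum big_nat_recr //= big_nat_cond big1 ?add0r // => n.
rewrite andbT => /andP[_ nm]; rewrite big_seq big1 // => mu.
rewrite mem_partitions_of => /eqP e.
by rewrite homog_pmu ?mulr0 // e gtn_eqF.
Qed.

Lemma psumE_ge c m N : (mondeg m <= N)%N ->
  psum p c m = \sum_(mu <- parts_upto N) c mu * pmu p mu m.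
Proof.
move=> mN; rewrite psumE_size big_seq [RHS](bigID (mem (partitions_of (mondeg m)))) /=.
rewrite [X in _ + X]big1 ?addr0 => [|mu]; last first.
  by rewrite mem_partitions_of eq_sym => h; rewrite homog_pmu ?mulr0.
rewrite -big_seq -[RHS]big_filter; apply: perm_big.
apply: uniq_perm; rewrite ?filter_uniq ?uniq_partitions_of ?uniq_parts_upto //.
move=> mu; rewrite mem_filter mem_parts_upto; case: (boolP (mu \in _)) => //=.
by rewrite mem_partitions_of => /eqP ->; rewrite mN.
Qed.

Lemma psum_mon0 c : psum p c mon0 = c part0.
Proof.
rewrite psumE_size mondeg0 partitions_of0.
by rewrite big_seq1 pmu0 one_mon0 mulr1.
Qed.

(** The product of the power sums of nu and la is the power sum of their union, so
this is the coefficient of p_mu in a product of two expansions. *)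
Definition pconv (a b : intpart -> K) (mu : intpart) : K :=
  \sum_(nu <- parts_upto (psize mu)) \sum_(la <- parts_upto (psize mu))
    (partunion nu la == mu)%:R * (a nu * b la).

(** Multiplication of expansions does not depend on the family p: identities between
the coefficients transfer from pb_n to pb_n / [n]. *)
Lemma psumM a b : (psum p a : ser K) * psum p b = psum p (pconv a b) :> ser K.
Proof.
apply: serP => m; set N := mondeg m.
pose S c : ser K := \sum_(mu <- parts_upto N) scal (c mu) (pmu p mu).
have eS c : eqser m (psum p c) (S c).
  move=> d dm; rewrite (psumE_ge _ (mondvd_deg dm)) /S ser_sumE.
  by apply: eq_bigr => mu _.
rewrite (eqserM (eS a) (eS b)) ?mondvdnn // psumE_size -/N.
have -> : \sum_(mu <- partitions_of N) pconv a b mu * pmu p mu m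
  = \sum_(mu <- partitions_of N) \sum_(nu <- parts_upto N) \sum_(la <- parts_upto N)
     (partunion nu la == mu)%:R * (a nu * b la) * pmu p mu m.
  rewrite big_seq [RHS]big_seq; apply: eq_bigr => mu.
  rewrite mem_partitions_of => /eqP e; rewrite /pconv e mulr_suml.
  by apply: eq_bigr => nu _; rewrite mulr_suml.
have -> : (S a * S b) m = \sum_(nu <- parts_upto N) \sum_(la <- parts_upto N)
    a nu * b la * pmu p (partunion nu la) m.
  rewrite /S mulr_suml ser_sumE; apply: eq_bigr => nu _.
  rewrite mulr_sumr ser_sumE; apply: eq_bigr => la _.
  by rewrite scalAl scalAr !scalE mulrA -pmu_union.
rewrite [RHS]exchange_big /=; apply: eq_bigr => nu _.
rewrite [RHS]exchange_big /=; apply: eq_bigr => la _.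
have [h|h] := eqVneq (psize (partunion nu la)) N.
  rewrite (bigD1_seq (partunion nu la)) ?uniq_partitions_of ?mem_partitions_of ?h //=.
  rewrite big1 ?addr0 ?eqxx ?mul1r // => mu /negbTE ne.
  by rewrite eq_sym ne !mul0r.
rewrite homog_pmu 1?eq_sym // mulr0 big_seq big1 // => mu.
rewrite mem_partitions_of => /eqP e; case: eqP => [e'|_]; last by rewrite !mul0r.
by rewrite e' e eqxx in h.
Qed.

Lemma Der_psum a : Der (psum p a) = psum p (fun mu => (psize mu)%:R * a mu) :> ser K.
Proof.
apply: serP => m; rewrite DerE !psumE_size mulr_sumr big_seq [RHS]big_seq.
apply: eq_bigr => mu; rewrite mem_partitions_of => /eqP ->.
by rewrite mulrA.
Qed.

End PowerSums.

Section PowerSumScale.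
Variable K : fieldType.
Variables (p : nat -> ser K) (s : nat -> K).

Definition pscale (mu : intpart) : K := \prod_(n <- (mu : seq nat)) s n.

Lemma pmu_scale mu :
  pmu (fun n => scal (s n) (p n)) mu = scal (pscale mu) (pmu p mu).
Proof.
rewrite !pmuE /pscale; elim: (mu : seq nat) => [|n t IH].
  by rewrite !big_nil; apply: serP => m; rewrite scalE mul1r.
rewrite !big_cons IH scalAl scalAr; apply: serP => m.
by rewrite !scalE mulrA.
Qed.

Lemma psum_scale c :
  psum (fun n => scal (s n) (p n)) c = psum p (fun mu => c mu * pscale mu) :> ser K.
Proof.
apply: serP => m; apply: eq_bigr => n _; apply: eq_bigr => mu _.
by rewrite pmu_scale scalE mulrA.
Qed.
End PowerSumScale.

Definition mone (i : int) : zmon := [fsfun k in [fset i]%fset => 1%N].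

Lemma moneE i k : mone i k = (k == i).
Proof. by rewrite /mone fsfun_fun inE; case: eqP. Qed.

Lemma monz_mone i n : ([fsfun k in [fset i]%fset => n] : zmon) = mone i *+ n.
Proof.
by apply: zmonP => k; rewrite monMnE moneE fsfun_fun inE; case: eqP; rewrite ?muln1 ?muln0.
Qed.

Lemma mondeg_mone i : mondeg (mone i) = 1%N.
Proof.
rewrite (@mondeg_sub [fset i]%fset); first by rewrite big_seq_fset1 moneE eqxx.
apply/fsubsetP => k; by rewrite mem_finsupp moneE inE; case: (k == i).
Qed.
Lemma mondegMn a k : mondeg (a *+ k) = (k * mondeg a)%N.
Proof. by elim: k => [|k IH]; rewrite ?mulr0n ?mondeg0 // mulrS mondegD IH mulSn. Qed.

Section PB.
Variable K : fieldType.
Hypothesis char0 : forall n, n.+1%:R != 0 :> K.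
Implicit Types f g h u : ser K.

Lemma pbE (S : {fset int}) n m : (0 < n)%N -> (finsupp m `<=` S)%fset ->
  @pb K n m = \sum_(i : S) monS K (mone (val i) *+ n) m.
Proof.
move=> n0 sS; rewrite /pb (big_fset_incl _ sS) /=.
  rewrite big_seq_fsetE /=; apply: eq_bigr => i _.
  by rewrite /monS monz_mone.
move=> i _ him; rewrite monz_mone; case: eqP => // e; case/negP: him.
by rewrite mem_finsupp e monMnE moneE eqxx muln1 -lt0n.
Qed.

Lemma homog_pb n : (0 < n)%N -> homog n (@pb K n).
Proof.
move=> n0 m hm; rewrite /pb big1 // => i _; rewrite monz_mone.
by case: eqP => // e; rewrite e mondegMn mondeg_mone muln1 eqxx in hm.
Qed.

(** The monomial of [monpow], for a sequence of parts which need not be a partition. *)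
Definition smonpow (s : seq nat) (idx : 'I_(size s) -> int) : zmon :=
  \sum_(j < size s) mone (idx j) *+ nth 0%N s j.

(** Expanding a product of sums: one chooses an index for every part.  The factor k
is kept outside so that the parts of k mu and of mu are indexed by the same type. *)
Lemma prod_pbE (S : {fset int}) (s : seq nat) k m :
  (0 < k)%N -> all (leq 1) s -> (finsupp m `<=` S)%fset ->
  (\prod_(n <- s) (@pb K (k * n)%N : ser K)) m
  = \sum_(h : {ffun 'I_(size s) -> S}) monS K (smonpow (fun j => val (h j)) *+ k) m.
Proof.
move=> k0 s0 mS.
have e : eqser m (\prod_(n <- s) (@pb K (k * n)%N : ser K))
    (\prod_(j < size s) \sum_(i : S) monS K (mone (val i) *+ (k * nth 0%N s j))).
  rewrite (big_nth 0%N) big_mkord; apply: eqser_prod => j _ d dm.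
  rewrite (@pbE S) ?ser_sumE ?muln_gt0 ?k0 //=.
    by apply: (allP s0); rewrite mem_nth.
  by apply: fsubset_trans mS; exact: mondvd_finsupp.
rewrite e ?mondvdnn // bigA_distr_bigA /= ser_sumE; apply: eq_bigr => h _.
rewrite monS_prod; congr (monS K _ m).
rewrite /smonpow -sumrMnl; apply: eq_bigr => j _.
by rewrite -mulrnA mulnC.
Qed.

Lemma pmu_pbE (S : {fset int}) (mu : intpart) m : (finsupp m `<=` S)%fset ->
  pmu (@pb K) mu m
  = \sum_(h : {ffun 'I_(size mu) -> S}) (m == smonpow (fun j => val (h j)))%:R.
Proof.
move=> mS; have -> : pmu (@pb K) mu = \prod_(n <- (mu : seq nat)) (@pb K (1 * n)%N : ser K).
  by apply: eq_bigr => n _; rewrite mul1n.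
by rewrite (prod_pbE (k := 1) _ (intpart_all_pos mu) mS).
Qed.

(** The monomial z_0^(la_0) z_1^(la_1) ..., at which pb_la is the first power sum that
does not vanish, for the order by number of parts. *)
Definition mon_of_part (la : intpart) : zmon :=
  smonpow (s := la) (fun j => (nat_of_ord j)%:Z).

Lemma smonpowE s (idx : 'I_(size s) -> int) i :
  smonpow idx i = (\sum_(j < size s | idx j == i) nth 0%N s j)%N.
Proof.
rewrite mon_sumE [RHS]big_mkcond; apply: eq_bigr => j _.
by rewrite monMnE moneE eq_sym; case: eqP => _; rewrite ?muln1 ?muln0.
Qed.

Lemma mondeg_smonpow s (idx : 'I_(size s) -> int) : mondeg (smonpow idx) = sumn s.
Proof.
rewrite /smonpow (big_morph mondeg mondegD mondeg0) sumnE (big_nth 0%N) big_mkord.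
by apply: eq_bigr => j _; rewrite mondegMn mondeg_mone muln1.
Qed.

Lemma mon_of_partE (la : intpart) (j : 'I_(size la)) :
  mon_of_part la (nat_of_ord j)%:Z = nth 0%N la j.
Proof.
by rewrite smonpowE (big_pred1 j).
Qed.

Lemma card_part_supp (la : intpart) : #|` finsupp (mon_of_part la)| = size la.
Proof.
have -> : finsupp (mon_of_part la) = [fset (nat_of_ord j)%:Z | j in 'I_(size la)]%fset.
  apply/fsetP => i; rewrite mem_finsupp; apply/idP/imfsetP => /= [|[j _ ->]].
    rewrite smonpowE => h.
    have [j /eqP e|h0] := pickP (fun j : 'I_(size la) => (nat_of_ord j)%:Z == i).
      by exists j; rewrite ?e.
    by rewrite big_pred0 in h.
  by rewrite mon_of_partE -lt0n; apply: (@intpart_pos la); rewrite mem_nth.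
rewrite card_imfset /=; last by move=> i j /= [/val_inj].
by rewrite size_enum_ord.
Qed.

(** Every index in the support of M is hit, so M has at most as many indices as mu
has parts; in case of equality no two parts are merged. *)
Lemma smonpow_supp (mu : intpart) (M : zmon)
    (h : 'I_(size mu) -> finsupp M) :
  M = smonpow (fun j => val (h j)) ->
  (#|` finsupp M| <= size mu)%N /\
  (#|` finsupp M| = size mu -> perm_eq mu [seq M (val x) | x <- enum {: finsupp M}]).
Proof.
move=> e.
have surj x : x \in codom h.
  have : M (val x) != 0%N by rewrite -mem_finsupp (valP x).
  rewrite {1}e smonpowE => hx.
  have [j /eqP ej|h0] := pickP (fun j => val (h j) == val x).
    by apply/codomP; exists j; apply: val_inj.
  by rewrite big_pred0 in hx.
have le : (#|{: finsupp M}| <= size mu)%N.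
  have -> : size mu = size (codom h) by rewrite size_codom card_ord.
  rewrite cardE; apply: uniq_leq_size; first exact: enum_uniq.
  by move=> x _; exact: surj.
split; first by rewrite cardfE.
move=> eq; rewrite cardfE in eq.
have injh : injective h.
  apply/injectiveP; rewrite /injectiveb /dinjectiveb.
  have := leq_size_uniq (s1 := enum {: finsupp M}) (s2 := codom h) (enum_uniq _).
  apply; first by move=> x _; exact: surj.
  by rewrite size_codom card_ord -cardE eq.
have -> : (mu : seq nat) = [seq M (val (h j)) | j <- enum 'I_(size mu)].
  rewrite -[LHS](mkseq_nth 0%N) /mkseq -val_enum_ord -map_comp.
  apply: eq_map => j /=; rewrite {1}e smonpowE (big_pred1 j) // => i /=.
  by apply/eqP/eqP => [/val_inj/injh|->].
rewrite (map_comp (fun x => M (val x)) h); apply: perm_map.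
apply: uniq_perm => [||x].
- by rewrite map_inj_uniq // enum_uniq.
- exact: enum_uniq.
by rewrite mem_enum /= inE; have := surj x; rewrite /codom /image_mem => ->.
Qed.

Definition idx_part (la : intpart) (j : 'I_(size la)) : finsupp (mon_of_part la).
Proof.
apply: (@FSetSub _ _ (nat_of_ord j)%:Z).
by rewrite mem_finsupp mon_of_partE -lt0n; apply: (@intpart_pos la); rewrite mem_nth.
Defined.

Lemma pmu_pb_diag (la : intpart) : pmu (@pb K) la (mon_of_part la) != 0.
Proof.
rewrite (pmu_pbE _ (fsubset_refl _)) -natr_sum.
rewrite (bigD1 [ffun j => idx_part j]) //=.
have /eqP -> : mon_of_part la = smonpow (fun j => val ([ffun j0 => @idx_part la j0] j)).
  by apply: eq_bigr => j _; rewrite ffunE.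
exact: char0.
Qed.

(** The coefficient of pb_mu at the monomial of la vanishes unless la is obtained by
merging parts of mu: the matrix of these coefficients is triangular. *)
Lemma pmu_pb_tri (mu la : intpart) : pmu (@pb K) mu (mon_of_part la) != 0 ->
  mu = la \/ (size la < size mu)%N.
Proof.
rewrite (pmu_pbE _ (fsubset_refl _)) => H.
have [h /eqP eh|h0] := pickP (fun h : {ffun 'I_(size mu) -> finsupp (mon_of_part la)} =>
    mon_of_part la == smonpow (fun j => val (h j))); last first.
  by rewrite big1 ?eqxx // in H => h _; rewrite h0.
have [le eq] := smonpow_supp eh.
rewrite card_part_supp in le eq.
have [lt|ge] := ltnP (size la) (size mu); first by right.
left; apply: intpart_eq.
have /eq p1 : size la = size mu by apply/eqP; rewrite eqn_leq le ge.
rewrite (permPl p1) perm_sym.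
have [_] := @smonpow_supp la (mon_of_part la) (@idx_part la) erefl.
by rewrite card_part_supp; apply.
Qed.

(** Linear independence of the power sums, by triangularity: the coefficient at the
monomial of la isolates c_la once the c_mu with more parts are known to vanish. *)
Lemma psum_pb_inj a b : psum (@pb K) a =1 psum (@pb K) b -> a =1 b.
Proof.
move=> ab la.
suff H k : forall mu, psize mu = psize la -> (psize la - size mu < k)%N -> a mu = b mu.
  exact: (H _ la erefl (ltnSn _)).
elim: k => // k IH mu hmu hk; apply/eqP; rewrite -subr_eq0.
have /eqP := ab (mon_of_part mu).
rewrite !(psumE_size homog_pb) mondeg_smonpow -/(psize mu) hmu -subr_eq0 -sumrB.
rewrite (bigD1_seq mu) ?uniq_partitions_of ?mem_partitions_of ?hmu //=.
rewrite big_seq_cond big1 ?addr0 => [|nu /andP[]].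
  by rewrite -mulrBl mulf_eq0 (negbTE (pmu_pb_diag mu)) orbF.
rewrite mem_partitions_of => /eqP hnu ne.
have [->|/pmu_pb_tri[e|lt]] := eqVneq (pmu (@pb K) nu (mon_of_part mu)) 0.
- by rewrite !mulr0 subrr.
- by rewrite e eqxx in ne.
rewrite IH ?subrr //; rewrite ltnS in hk; apply: leq_trans hk.
by rewrite ltn_sub2l //; apply: leq_trans lt _; rewrite -hnu size_psize.
Qed.

End PB.

(** * The logarithm of the symmetric product *)

Definition partmul (k : nat) (mu : intpart) := mkpart [seq (k * i)%N | i <- mu].

Lemma partmul_perm k mu : (0 < k)%N ->
  perm_eq (partmul k mu) [seq (k * i)%N | i <- mu].
Proof.
move=> k0; apply: mkpart_perm_pos; rewrite all_map; apply/allP => i /intpart_pos i0.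
by rewrite /= muln_gt0 k0.
Qed.

Lemma psize_partmul k mu : psize (partmul k mu) = (k * psize mu)%N.
Proof.
rewrite psize_mkpart /psize; elim: (mu : seq nat) => [|a s /= ->]; first by rewrite muln0.
by rewrite mulnDr.
Qed.

Lemma monpowE (mu : intpart) (idx : 'I_(size mu) -> int) : monpow idx = smonpow idx.
Proof.
apply: zmonP => i; rewrite smonpowE /monpow fsfun_fun; case: ifP => // hi.
rewrite big_pred0 // => j; apply/eqP => e; move/negP: hi; apply.
by apply/imfsetP; exists j.
Qed.

Section SymProd.
Variable K : fieldType.
Hypothesis char0 : forall n, n.+1%:R != 0 :> K.
Variable mu : intpart.
Hypothesis mu0 : mu != part0.

Definition binS (w : K) (a : zmon) : ser K := 1 + scal w (monS K a).

Lemma binS_mon0 w a : a != 0 -> binS w a mon0 = 1.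
Proof.
move=> a0; rewrite /binS serDE one_mon0 scalE /monS eq_sym.
have -> : (a == mon0) = false by apply/negbTE.
by rewrite mulr0 addr0.
Qed.

(** The finite product over the indices in S, modulo a monomial supported in S equal
to the symmetric product. *)
Definition symfin (w : K) (S : {fset int}) : ser K :=
  \prod_(h : {ffun 'I_(size mu) -> S}) binS w (smonpow (fun j => val (h j))).

Lemma smonpow_neq0 (idx : 'I_(size mu) -> int) : smonpow idx != 0.
Proof. by rewrite -mondeg_eq0 mondeg_smonpow -/(psize mu) psize_eq0. Qed.

Lemma symfin_mon0 w S : symfin w S mon0 = 1.
Proof. by apply: prod_mon0 => h _; apply: binS_mon0; exact: smonpow_neq0. Qed.

Lemma symprodE w m : symprod w mu m = symfin w (finsupp m) m.
Proof.
rewrite /symprod; congr (_ m); apply: eq_bigr => h _; apply: serP => d.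
by rewrite /binS serDE scalE monpowE.
Qed.

Lemma symprod_mon0 (w : K) : symprod w mu mon0 = 1.
Proof. by rewrite symprodE symfin_mon0. Qed.

(** A factor with some index outside S is 1 plus a monomial that does not divide M. *)
Lemma symfin_sub w (S T : {fset int}) M : (S `<=` T)%fset -> (finsupp M `<=` S)%fset ->
  eqser M (symfin w T) (symfin w S).
Proof.
move=> ST MS.
(* P selects the factors all of whose indices are in S; these make up symfin w S. *)
pose P (h : {ffun 'I_(size mu) -> T}) := [forall i, val (h i) \in S].
pose j (h : {ffun 'I_(size mu) -> S}) := [ffun i => fincl ST (h i)].
have injj : injective j.
  move=> h1 h2 /ffunP e; apply/ffunP => i; have := e i; rewrite !ffunE => e'.
  by apply: val_inj; have := congr1 val e'.
have e1 : \prod_(h : {ffun 'I_(size mu) -> T} | P h) binS w (smonpow (fun i => val (h i)))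
   = symfin w S.
  have PE h : P h = (h \in j @: setT).
    apply/forallP/imsetP => [H|[h' _ ->] i]; last by rewrite ffunE /= (valP (h' i)).
    exists [ffun i => [` H i]%fset] => //; apply/ffunP => i; apply: val_inj.
    by rewrite !ffunE.
  rewrite (eq_bigl _ _ PE) big_imset /=; last by move=> x y _ _; exact: injj.
  rewrite (eq_bigl predT); last by move=> x; rewrite inE.
  apply: eq_bigr => h _; congr (binS w _).
  by apply: eq_bigr => i _; rewrite ffunE.
have e2 : eqser M
    (\prod_(h : {ffun 'I_(size mu) -> T} | ~~ P h) binS w (smonpow (fun i => val (h i))))
    (\prod_(h : {ffun 'I_(size mu) -> T} | ~~ P h) 1); last first.
  rewrite /symfin (bigID P) /= e1 -[X in eqser _ _ X]mulr1.
  by rewrite [X in eqser _ _ X]big1 // in e2; exact: eqserM.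
apply: eqser_prod => h /forallPn[i hi] d dM.
rewrite /binS serDE scalE /monS; case: eqP => [e|_]; last by rewrite mulr0 addr0.
case/negP: hi; apply: (fsubsetP MS); apply: (fsubsetP (mondvd_finsupp dM)).
rewrite mem_finsupp e smonpowE (bigD1 i) //= -lt0n ltn_addr //.
by apply: (@intpart_pos mu); rewrite mem_nth.
Qed.

Lemma symprod_eq (w : K) M : eqser M (symprod w mu) (symfin w (finsupp M)).
Proof.
move=> d dM; rewrite symprodE; apply/esym/symfin_sub; last exact: mondvdnn.
  exact: mondvd_finsupp.
exact: fsubset_refl.
Qed.

Lemma logS_binS w a m : a != 0 ->
  logS (binS w a) m = \sum_(1 <= k < (mondeg m).+1)
    (-1) ^+ k.-1 / k%:R * w ^+ k * (m == a *+ k)%:R.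
Proof.
move=> a0; rewrite logSE; apply: eq_bigr => k _; rewrite -mulrA; congr (_ * _).
have -> : binS w a - 1 = scal w (monS K a) by rewrite /binS addrC addKr.
have -> : scal w (monS K a) ^+ k = scal (w ^+ k) (monS K (a *+ k)) => //.
elim: k => [|k IH]; first by apply: serP => d; rewrite scalE mul1r.
by rewrite exprS IH scalAl scalAr -monSD -mulrS; apply: serP => d; rewrite !scalE mulrA -exprS.
Qed.

Lemma logS_symprod (w : K) m :
  logS (symprod w mu) m = \sum_(1 <= k < (mondeg m).+1)
    (-1) ^+ k.-1 / k%:R * w ^+ k * pmu (@pb K) (partmul k mu) m.
Proof.
have s0 (h : {ffun 'I_(size mu) -> finsupp m}) :
  binS w (smonpow (fun i => val (h i))) mon0 = 1.
  by apply: binS_mon0; exact: smonpow_neq0.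
rewrite (eqser_logS (symprod_mon0 w) (symfin_mon0 w (finsupp m)) (symprod_eq (M := m) w)) ?mondvdnn //.
rewrite /symfin (logS_prod char0) => [|h _] //.
rewrite ser_sumE.
under eq_bigr do rewrite logS_binS ?smonpow_neq0 //.
rewrite exchange_big /= big_nat_cond [RHS]big_nat_cond; apply: eq_bigr => k.
rewrite andbT => /andP[k0 _]; rewrite -mulr_sumr; congr (_ * _).
rewrite pmuE (perm_big _ (partmul_perm _ k0)) big_map.
by rewrite (prod_pbE _ k0 (intpart_all_pos mu) (fsubset_refl _)).
Qed.

(** Even powers cancel in log (1 + x) - log (1 - x), and the k-th powers of the
monomials of z^mu are the monomials of z^(k mu). *)
Lemma logS_symratio (w : K) m :
  logS (mulS (symprod w mu) (invS (symprod (- w) mu))) m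
  = \sum_(1 <= k < (mondeg m).+1 | odd k)
      2%:R / k%:R * w ^+ k * pmu (@pb K) (partmul k mu) m.
Proof.
rewrite -[mulS _ _]/((symprod w mu : ser K) * (invS (symprod (- w) mu))).
rewrite (logSM char0) ?symprod_mon0 ?invS_mon0 // (logSV char0) ?symprod_mon0 // serBE.
rewrite !logS_symprod -sumrB [RHS]big_mkcond /=.
apply: eq_big_nat => k /andP[k0 _].
rewrite -mulrBl; case: k k0 => // k _ /=.
rewrite (exprNn w) [(-1) ^+ k.+1]exprS mulN1r -signr_odd.
case: (odd k) => /=; rewrite ?expr1 ?expr0 ?opprK ?mul1r ?mulN1r ?subrr ?mul0r //.
by rewrite mulrN opprK -[2 / _ * _]mulrA [2 * _]mulr_natl mulr2n.
Qed.
End SymProd.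

(** * Rational functions of q and t *)

Local Notation "x %:F" := (FracField.tofrac x).

Lemma fracE (R : idomainType) (f : {fraction R}) :
  let x := generic_quotient.repr f in f = (\n_x)%:F / (\d_x)%:F /\ \d_x != 0.
Proof.
move=> x; split; last exact: denom_ratioP.
rewrite -[LHS]reprK -/x; unlock FracField.tofrac.
rewrite -[X in _ = _ * X]FracField.pi_inv -[RHS]FracField.pi_mul.
rewrite /FracField.mulf /FracField.invf.
have d0 : \d_x != 0 by exact: denom_ratioP.
rewrite !numden_Ratio ?oner_eq0 // mulr1 mul1r.
by rewrite Ratio_numden.
Qed.

Lemma frac_rep (R : idomainType) (f : {fraction R}) :
  exists n d, d != 0 /\ f = n%:F / d%:F.
Proof. by have [e d0] := fracE f; eexists; eexists; split; [exact: d0 | exact: e]. Qed.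

Section Eval2.
Variables (C S : fieldType) (phi : {rmorphism C -> S}) (a b : S).

(** [eval2] as a composite of ring morphisms. *)
Definition ev2 : {rmorphism {poly {poly C}} -> S} :=
  (horner_eval a \o map_poly (horner_eval b \o map_poly phi)).

Lemma eval2E p : eval2 phi a b p = ev2 p.
Proof. by []. Qed.

Lemma ev2X : ev2 'X = a.
Proof. by rewrite /= map_polyX /horner_eval hornerX. Qed.
Lemma ev2Y : ev2 ('X)%:P = b.
Proof. by rewrite /= map_polyC /= map_polyX /horner_eval hornerC hornerX. Qed.
Lemma ev2C c : ev2 (c%:P)%:P = phi c.
Proof. by rewrite /= map_polyC /= map_polyC /= /horner_eval !hornerC. Qed.
End Eval2.

Lemma poly2_rmorph_eq (C : fieldType) (S : nzRingType)
    (f g : {rmorphism {poly {poly C}} -> S}) :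
  f 'X = g 'X -> f ('X)%:P = g ('X)%:P -> (forall c, f (c%:P)%:P = g (c%:P)%:P) ->
  f =1 g.
Proof.
move=> eX eY eC; elim/poly_ind => [|p c IH]; first by rewrite !rmorph0.
rewrite !rmorphD !rmorphM IH eX; congr (_ + _).
elim/poly_ind: c => [|r c IHr]; first by rewrite !rmorph0.
by rewrite polyCD polyCM !rmorphD !rmorphM IHr eY eC.
Qed.

Section Kqt.
Variable C : fieldType.
Local Notation K := (Kqt C).

Lemma cK_zmod : zmod_morphism (@cK C).
Proof. by move=> x y; rewrite /cK !polyCB tofracB. Qed.
Lemma cK_monoid : monoid_morphism (@cK C).
Proof. by split=> [|x y]; rewrite /cK ?polyC1 ?tofrac1 // !polyCM tofracM. Qed.
HB.instance Definition _ := GRing.isZmodMorphism.Build C K (@cK C) cK_zmod.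
HB.instance Definition _ := GRing.isMonoidMorphism.Build C K (@cK C) cK_monoid.

Lemma Kqt_char0 : (forall n, n.+1%:R != 0 :> C) -> forall n, n.+1%:R != 0 :> K.
Proof. by move=> h n; rewrite -(rmorph_nat (@cK C)) fmorph_eq0. Qed.

Lemma qK_neq0 : qK C != 0.
Proof. by rewrite tofrac_eq0 polyX_eq0. Qed.

Lemma Kqt_rmorph_eq (S : fieldType) (f g : {rmorphism K -> S}) :
  f (qK C) = g (qK C) -> f (tK C) = g (tK C) -> (forall c, f (cK c) = g (cK c)) ->
  f =1 g.
Proof.
move=> eq et ec x; have [n [d [_ ->]]] := frac_rep x; rewrite !fmorph_div.
have e : f \o @FracField.tofrac _ =1 g \o @FracField.tofrac _.
  exact: (@poly2_rmorph_eq C S (f \o @FracField.tofrac _) (g \o @FracField.tofrac _)).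
by congr (_ / _); exact: e.
Qed.

Section Subst.
Variables a b : K.
Hypothesis indep : forall p, p != 0 -> ev2 (@cK C) a b p != 0.

(** Algebraic independence of a and b makes the value independent of the fraction
that represents the rational function. *)
Lemma subst2_frac (n d : {poly {poly C}}) : d != 0 ->
  subst2 a b (n%:F / d%:F) = ev2 (@cK C) a b n / ev2 (@cK C) a b d.
Proof.
move=> d0; set f := n%:F / d%:F; rewrite /subst2.
have [e d'0] := fracE f; rewrite !eval2E.
apply/eqP; rewrite eqr_div ?indep // -!rmorphM; apply/eqP; congr (ev2 _ _ _ _).
apply/eqP; rewrite -tofrac_eq !tofracM -eqr_div ?tofrac_eq0 //.
by rewrite -e.
Qed.

Lemma subst2_zmod : zmod_morphism (subst2 a b).
Proof.
move=> x y; have [n [d [d0 ->]]] := frac_rep x; have [n' [d' [d'0 ->]]] := frac_rep y.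
rewrite -mulNr addf_div ?tofrac_eq0 // -tofracN -!tofracM -tofracD.
rewrite !subst2_frac ?mulf_neq0 // -mulNr addf_div ?indep //.
by rewrite rmorphD !rmorphM rmorphN.
Qed.
Lemma subst2_monoid : monoid_morphism (subst2 a b).
Proof.
split=> [|x y].
  by rewrite -[1 in LHS]divr1 -tofrac1 subst2_frac ?oner_eq0 // rmorph1 divr1.
have [n [d [d0 ->]]] := frac_rep x; have [n' [d' [d'0 ->]]] := frac_rep y.
rewrite mulf_div -!tofracM !subst2_frac ?mulf_neq0 // mulf_div.
by rewrite !rmorphM.
Qed.

Definition subst2R : {rmorphism K -> K} :=
  HB.pack (subst2 a b) (GRing.isZmodMorphism.Build _ _ _ subst2_zmod)
   (GRing.isMonoidMorphism.Build _ _ _ subst2_monoid).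

Lemma subst2_tofrac p : subst2 a b p%:F = ev2 (@cK C) a b p.
Proof. by rewrite -[p%:F]divr1 -tofrac1 subst2_frac ?oner_eq0 // rmorph1 divr1. Qed.
Lemma subst2_q : subst2 a b (qK C) = a.
Proof. by rewrite subst2_tofrac ev2X. Qed.
Lemma subst2_t : subst2 a b (tK C) = b.
Proof. by rewrite subst2_tofrac ev2Y. Qed.
Lemma subst2_c c : subst2 a b (cK c) = cK c.
Proof. by rewrite subst2_tofrac ev2C. Qed.
End Subst.

(** The substitution is induced by a composition of polynomials with q^(k+1) and
c t^(k+1), which are not constant; so it is injective. *)
Lemma indep_pow (c : C) k p : c != 0 -> p != 0 ->
  ev2 (@cK C) (qK C ^+ k.+1) (cK c * tK C ^+ k.+1) p != 0.
Proof.
move=> c0 p0.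
pose P : {rmorphism {poly C} -> {poly C}} := comp_poly (c *: 'X^(k.+1)).
pose Q : {rmorphism {poly {poly C}} -> {poly {poly C}}} := comp_poly ('X^(k.+1)).
have -> : ev2 (@cK C) (qK C ^+ k.+1) (cK c * tK C ^+ k.+1) p
    = (@FracField.tofrac _ \o Q \o map_poly P) p.
  apply: (poly2_rmorph_eq _ _ _ p).
  - by rewrite ev2X /= map_polyX /Q /= comp_polyX rmorphXn.
  - rewrite ev2Y /= map_polyC /= /P /= /Q /= comp_polyX comp_polyC.
    by rewrite -mul_polyC polyCM tofracM !rmorphXn.
  - by move=> d; rewrite ev2C /= map_polyC /= /P /= comp_polyC /Q /= comp_polyC.
rewrite /= tofrac_eq0 comp_poly_eq0 ?size_polyXn //.
have injP : injective P.
  move=> x y e; apply/eqP; rewrite -subr_eq0 -(@comp_poly_eq0 _ _ (c *: 'X^(k.+1))).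
    by have := rmorphB P x y; rewrite /P /= e subrr => ->.
  by rewrite size_scale ?size_polyXn.
by rewrite -(rmorph0 (map_poly P)) (inj_eq (map_inj_poly injP (rmorph0 P))).
Qed.

End Kqt.

Section Frob.
Variable C : fieldType.
Local Notation K := (Kqt C).

Lemma frob_indep k p : p != 0 -> ev2 (@cK C) (qK C ^+ k.+1) (tK C ^+ k.+1) p != 0.
Proof. by move=> p0; rewrite -[tK C ^+ _]mul1r -(rmorph1 (@cK C)) indep_pow ?oner_eq0. Qed.
Lemma negt_indep p : p != 0 -> ev2 (@cK C) (qK C) (- tK C) p != 0.
Proof.
move=> p0; have := @indep_pow C (-1) 0 p; rewrite !expr1 rmorphN rmorph1 mulN1r.
by apply=> //; rewrite oppr_eq0 oner_eq0.
Qed.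

(** The morphism is sealed behind this existence statement, so that simplification
does not unfold it. *)
Fact subst2_sig a b : (forall p, p != 0 -> ev2 (@cK C) a b p != 0) ->
  {s : {rmorphism K -> K} | s =1 subst2 a b}.
Proof. by move=> h; exists (subst2R h). Qed.

(** The substitution (q, t) -> (q^(k+1), t^(k+1)); the shift avoids the case k = 0,
which is not a morphism of fields. *)
Definition frob k : {rmorphism K -> K} := sval (subst2_sig (@frob_indep k)).
Definition negt : {rmorphism K -> K} := sval (subst2_sig negt_indep).

Lemma frobE k f : (0 < k)%N -> subst2 (qK C ^+ k) (tK C ^+ k) f = frob k.-1 f.
Proof. by case: k => // k _; rewrite /frob /=; case: subst2_sig. Qed.
Lemma negtE f : neg_t f = negt f.
Proof. by rewrite /negt /=; case: subst2_sig. Qed.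

Lemma frob_q k : frob k (qK C) = qK C ^+ k.+1.
Proof. by rewrite -[k]/(k.+1.-1) -frobE // (subst2_q (@frob_indep k)). Qed.
Lemma frob_t k : frob k (tK C) = tK C ^+ k.+1.
Proof. by rewrite -[k]/(k.+1.-1) -frobE // (subst2_t (@frob_indep k)). Qed.
Lemma frob_c k c : frob k (cK c) = cK c.
Proof. by rewrite -[k]/(k.+1.-1) -frobE // (subst2_c (@frob_indep k)). Qed.
Lemma negt_q : negt (qK C) = qK C.
Proof. by rewrite -negtE /neg_t (subst2_q negt_indep). Qed.
Lemma negt_t : negt (tK C) = - tK C.
Proof. by rewrite -negtE /neg_t (subst2_t negt_indep). Qed.
Lemma negt_c c : negt (cK c) = cK c.
Proof. by rewrite -negtE /neg_t (subst2_c negt_indep). Qed.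

Lemma frob0 : frob 0 =1 idfun.
Proof.
by apply: Kqt_rmorph_eq => [||c]; rewrite ?frob_q ?frob_t ?frob_c.
Qed.

Lemma frob_comp k j f : frob k (frob j f) = frob (k.+1 * j.+1).-1 f.
Proof.
apply: (@Kqt_rmorph_eq _ _ (frob k \o frob j) (frob (k.+1 * j.+1).-1)) => [||c] /=.
- by rewrite !frob_q rmorphXn /= frob_q -exprM.
- by rewrite !frob_t rmorphXn /= frob_t -exprM.
- by rewrite !frob_c.
Qed.

(** (-t)^k = - t^k for odd k. *)
Lemma negt_frob_odd k f : odd k.+1 -> negt (frob k f) = frob k (negt f).
Proof.
move=> ok; apply: (@Kqt_rmorph_eq _ _ (negt \o frob k) (frob k \o negt)) => [||c] /=.
- by rewrite negt_q !frob_q rmorphXn /= negt_q.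
- by rewrite negt_t rmorphN /= !frob_t rmorphXn /= negt_t exprNn -signr_odd ok expr1 mulN1r.
- by rewrite frob_c !negt_c frob_c.
Qed.

(** (-t)^k = t^k for even k: these terms drop out of F(q,t) - F(q,-t). *)
Lemma negt_frob_even k f : ~~ odd k.+1 -> negt (frob k f) = frob k f.
Proof.
move=> /negbTE ok; apply: (@Kqt_rmorph_eq _ _ (negt \o frob k) (frob k)) => [||c] /=.
- by rewrite !frob_q rmorphXn /= negt_q.
- by rewrite !frob_t rmorphXn /= negt_t exprNn -signr_odd ok expr0 mul1r.
- by rewrite frob_c !negt_c.
Qed.

Lemma frob_qbr k n : frob k (qbrK C n) = qbrK C (k.+1 * n).
Proof. by rewrite /qbrK rmorphB fmorphV !rmorphXn /= frob_q -!exprM. Qed.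
Lemma negt_qbr n : negt (qbrK C n) = qbrK C n.
Proof. by rewrite /qbrK rmorphB fmorphV !rmorphXn /= negt_q. Qed.

Lemma qbrK_neq0 n : (0 < n)%N -> qbrK C n != 0.
Proof.
move=> n0; rewrite /qbrK subr_eq0; apply/eqP => e.
have q0 : qK C ^+ n != 0 by rewrite expf_neq0 // qK_neq0.
have : qK C ^+ (n + n) == 1 by rewrite exprD {1}e mulVf.
rewrite -tofracXn -tofrac1 tofrac_eq; apply/negP/eqP => /(congr1 (size : {poly {poly C}} -> nat)).
rewrite size_polyXn size_poly1 => -[] /eqP.
by rewrite addn_eq0 andbb; case: n n0 {e q0}.
Qed.
End Frob.

Section HasValue.
Variable C : fieldType.
Variables q0 t0 : C.
Local Notation K := (Kqt C).

Definition hval (f : K) (v : C) := has_value id q0 t0 f v.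

Let ev : {rmorphism {poly {poly C}} -> C} := ev2 idfun q0 t0.

Lemma hvalP f v : hval f v <-> exists n d, [/\ ev d != 0, f = n%:F / d%:F & v = ev n / ev d].
Proof. by []. Qed.

Lemma ev_tofrac_neq0 d : ev d != 0 -> d%:F != 0.
Proof. by rewrite tofrac_eq0; apply: contraNneq => ->; rewrite rmorph0. Qed.

Lemma hval_poly p : hval p%:F (ev p).
Proof.
apply/hvalP; exists p, 1; rewrite rmorph1 tofrac1 !divr1; split => //.
exact: oner_neq0.
Qed.
Lemma hval_q : hval (qK C) q0.
Proof. by have := hval_poly 'X; rewrite /ev ev2X. Qed.
Lemma hval_t : hval (tK C) t0.
Proof. by have := hval_poly ('X)%:P; rewrite /ev ev2Y. Qed.
Lemma hval_c c : hval (cK c) c.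
Proof. by have := hval_poly (c%:P)%:P; rewrite /ev ev2C. Qed.
Lemma hval1 : hval 1 1.
Proof. by have := hval_c 1; rewrite rmorph1. Qed.
Lemma hval0 : hval 0 0.
Proof. by have := hval_c 0; rewrite rmorph0. Qed.
Lemma hval_nat n : hval n%:R n%:R.
Proof. by have := hval_c n%:R; rewrite rmorph_nat. Qed.
Lemma hval_int (z : int) : hval z%:~R z%:~R.
Proof. by have := hval_c z%:~R; rewrite rmorph_int. Qed.

Lemma hvalM f g u v : hval f u -> hval g v -> hval (f * g) (u * v).
Proof.
move=> /hvalP[n [d [d0 -> ->]]] /hvalP[n' [d' [d'0 -> ->]]]; apply/hvalP.
exists (n * n'), (d * d'); rewrite !rmorphM mulf_neq0 //.
by split => //; rewrite mulf_div.
Qed.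
Lemma hvalD f g u v : hval f u -> hval g v -> hval (f + g) (u + v).
Proof.
move=> /hvalP[n [d [d0 -> ->]]] /hvalP[n' [d' [d'0 -> ->]]]; apply/hvalP.
exists (n * d' + n' * d), (d * d'); rewrite !rmorphD !rmorphM mulf_neq0 //.
by split => //; rewrite addf_div ?ev_tofrac_neq0.
Qed.
Lemma hvalN f u : hval f u -> hval (- f) (- u).
Proof. by move=> h; rewrite -mulN1r -[- u]mulN1r; apply: hvalM => //; exact: hval_int (-1). Qed.
Lemma hvalV f u : u != 0 -> hval f u -> hval f^-1 u^-1.
Proof.
move=> u0 /hvalP[n [d [d0 -> e]]]; apply/hvalP; exists d, n; rewrite e !invf_div; split => //.
by apply: contraNneq u0 => n0; rewrite e n0 mul0r.
Qed.
Lemma hvalX f u n : hval f u -> hval (f ^+ n) (u ^+ n).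
Proof. by move=> h; elim: n => [|n IH]; [exact: hval1 | rewrite !exprS; exact: hvalM]. Qed.
Lemma hvalXz f u (z : int) : u != 0 -> hval f u -> hval (f ^ z) (u ^ z).
Proof.
move=> u0 h; case: z => n; first exact: hvalX.
by rewrite !NegzE -!exprnN; apply: hvalV; [exact: expf_neq0 | exact: hvalX].
Qed.
Lemma hval_sum (J : Type) (r : seq J) (P : pred J) (F : J -> K) (G : J -> C) :
  (forall j, P j -> hval (F j) (G j)) ->
  hval (\sum_(j <- r | P j) F j) (\sum_(j <- r | P j) G j).
Proof.
by move=> h; elim/big_rec2: _ => [|j x y Pj]; [exact: hval0 | apply: hvalD; exact: h].
Qed.

End HasValue.

(** * Moebius inversion over the divisors of a partition *)

Lemma big_seq_only1 (R : nmodType) (I : eqType) (r : seq I) (P : pred I) (F : I -> R) x :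
  uniq r -> x \in r -> P =1 pred1 x -> \sum_(i <- r | P i) F i = F x.
Proof.
by move=> ur xr Px; rewrite -big_filter (eq_filter Px) filter_pred1_uniq // big_seq1.
Qed.

Lemma moebius_sq p d : prime p -> (0 < d)%N -> (p ^ 2 %| d)%N -> moebius d = 0.
Proof.
move=> pp d0 h; rewrite /moebius; case: ifP => // /allP H.
have pd : p \in primes d.
  by rewrite mem_primes pp d0 (dvdn_trans _ h) // expnS dvdn_mulr.
by move: h; rewrite pfactor_dvdn // (eqP (H _ pd)).
Qed.

Lemma moebius_mulp p e : prime p -> (0 < e)%N -> ~~ (p %| e)%N ->
  moebius (p * e) = - moebius e.
Proof.
move=> pp e0 pe; have p0 := prime_gt0 pp.
have pe' : p \notin primes e by rewrite mem_primes pp e0.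
have P : perm_eq (primes (p * e)) (p :: primes e).
  apply: uniq_perm; rewrite /= ?primes_uniq ?pe' // => r.
  by rewrite primesM // primes_prime // !inE.
rewrite /moebius (perm_size P) (perm_all _ P) /= lognM // logn_prime // eqxx.
have -> : logn p e = 0%N by apply/eqP; rewrite -leqn0 leqNgt logn_gt0.
rewrite /= -[X in if X then _ else _](_ : all (fun r => logn r e == 1%N) (primes e) = _).
  by case: ifP => _; rewrite ?oppr0 // exprS mulN1r.
apply: eq_in_all => r hr; rewrite lognM // (logn_prime _ pp).
by have /negbTE -> : r != p by apply: contraNneq pe' => <-.
Qed.

(** Fix a prime p dividing n.  The divisors divisible by p^2 do not contribute, and
the others come in pairs e, p e with opposite values. *)
Lemma sum_moebius n : (0 < n)%N -> \sum_(d <- divisors n) moebius d = (n == 1%N)%:R.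
Proof.
move=> n0; have [->|n1] := eqVneq n 1%N; first by rewrite big_seq1.
have n1' : (1 < n)%N by rewrite ltn_neqAle eq_sym n1.
set p := pdiv n; have pp : prime p := pdiv_prime n1'.
have p0 := prime_gt0 pp.
rewrite (bigID (fun d => p %| d)%N) /= (bigID (fun d => p ^ 2 %| d)%N) /=.
rewrite big_seq_cond big1 ?add0r => [|d]; last first.
  by rewrite -dvdn_divisors // => /andP[/dvdn_gt0 - /(_ n0) d0 /andP[_]]; exact: moebius_sq.
have P : perm_eq [seq d <- divisors n | (p %| d) && ~~ (p ^ 2 %| d)]%N
   [seq (p * e)%N | e <- divisors n & ~~ (p %| e)%N].
  apply: uniq_perm; rewrite ?filter_uniq ?divisors_uniq //.
    rewrite map_inj_uniq ?filter_uniq ?divisors_uniq // => x y /eqP.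
    by rewrite eqn_pmul2l // => /eqP.
  move=> d; rewrite mem_filter -dvdn_divisors //.
  apply/andP/mapP => [[/andP[/dvdnP[e ->] h2 dn]]|[e]].
    exists e; rewrite 1?mulnC // mem_filter -dvdn_divisors // (dvdn_trans _ dn) ?dvdn_mulr //.
    by rewrite andbT; apply: contra h2; rewrite mulnC expnS expn1 dvdn_pmul2l.
  rewrite mem_filter -dvdn_divisors // => /andP[pe en] ->.
  rewrite dvdn_mulr //= expnS expn1 dvdn_pmul2l // pe; split=> //.
  by rewrite Gauss_dvd ?prime_coprime // en pdiv_dvd.
rewrite -big_filter (perm_big _ P) big_map big_filter.
rewrite -big_split big_seq_cond big1 // => e /andP[].
rewrite -dvdn_divisors // => /dvdn_gt0 - /(_ n0) e0 pe.
by rewrite moebius_mulp //= addNr.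
Qed.

Lemma pdvdP k (mu : intpart) : reflect (forall i, i \in (mu : seq nat) -> k %| i)%N (pdvd k mu).
Proof. exact: allP. Qed.

Lemma pdiv_by_perm k (mu : intpart) : (0 < k)%N -> pdvd k mu ->
  perm_eq (pdiv_by mu k) [seq (i %/ k)%N | i <- mu].
Proof.
move=> k0 /pdvdP h; apply: mkpart_perm_pos; rewrite all_map; apply/allP => i hi /=.
by rewrite divn_gt0 // dvdn_leq ?h // (@intpart_pos mu).
Qed.

Lemma pdiv_byK k (mu : intpart) : (0 < k)%N -> pdvd k mu -> partmul k (pdiv_by mu k) = mu.
Proof.
move=> k0 h; apply: intpart_eq; rewrite (permPl (partmul_perm _ k0)).
apply: (perm_trans (perm_map _ (pdiv_by_perm k0 h))).
rewrite -map_comp map_id_in // => i hi /=.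
by rewrite mulnC divnK //; apply: (pdvdP _ _ h).
Qed.

Lemma pdvd_partmul k (mu : intpart) : (0 < k)%N -> pdvd k (partmul k mu).
Proof.
move=> k0; apply/pdvdP => i; rewrite (perm_mem (partmul_perm _ k0)).
by move=> /mapP[j _ ->]; rewrite dvdn_mulr.
Qed.

Lemma partmul_inj k : (0 < k)%N -> injective (partmul k).
Proof.
move=> k0 mu nu e; apply: intpart_eq.
have := partmul_perm mu k0; rewrite e perm_sym => h.
have := perm_trans h (partmul_perm nu k0) => /(perm_map (fun i => i %/ k)%N).
by rewrite -!map_comp !(eq_map (g := id)) ?map_id // => i /=; rewrite mulKn.
Qed.

Lemma partmulK k (mu : intpart) : (0 < k)%N -> pdiv_by (partmul k mu) k = mu.
Proof. by move=> k0; apply: (partmul_inj k0); rewrite pdiv_byK // pdvd_partmul. Qed.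

Lemma partmul_comp k j mu : (0 < k)%N -> (0 < j)%N ->
  partmul k (partmul j mu) = partmul (k * j) mu.
Proof.
move=> k0 j0; apply: intpart_eq; rewrite (permPl (partmul_perm _ k0)) perm_sym.
have kj0 : (0 < k * j)%N by rewrite muln_gt0 k0.
rewrite (permPl (partmul_perm _ kj0)) perm_sym.
apply: (perm_trans (perm_map _ (partmul_perm _ j0))).
rewrite -map_comp (_ : map _ _ = [seq (k * j * i)%N | i <- mu]) //.
by apply: eq_map => i /=; rewrite mulnA.
Qed.

Lemma pdvd_mul k j (mu : intpart) : (0 < k)%N -> (0 < j)%N ->
  pdvd (k * j) mu = pdvd k mu && pdvd j (pdiv_by mu k).
Proof.
move=> k0 j0; have kj0 : (0 < k * j)%N by rewrite muln_gt0 k0.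
apply/idP/andP => [h|[h1 h2]].
  have e := pdiv_byK kj0 h; rewrite -partmul_comp // in e.
  by rewrite -e pdvd_partmul // partmulK // pdvd_partmul.
by rewrite -(pdiv_byK k0 h1) -(pdiv_byK j0 h2) partmul_comp // pdvd_partmul.
Qed.

Lemma pdiv_by_mul k j (mu : intpart) : (0 < k)%N -> (0 < j)%N -> pdvd (k * j) mu ->
  pdiv_by (pdiv_by mu k) j = pdiv_by mu (k * j).
Proof.
move=> k0 j0 h; have kj0 : (0 < k * j)%N by rewrite muln_gt0 k0.
apply: (partmul_inj kj0); rewrite [RHS]pdiv_byK // -partmul_comp //.
move: h; rewrite pdvd_mul // => /andP[h1 h2].
by rewrite (pdiv_byK j0 h2) (pdiv_byK k0 h1).
Qed.

Lemma partmul_eq0 k mu : (0 < k)%N -> (partmul k mu == part0) = (mu == part0).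
Proof.
by move=> k0; rewrite -!psize_eq0 psize_partmul muln_eq0 -(negbK (k == 0%N)) -lt0n k0.
Qed.

Lemma pdvd_leq k (mu : intpart) : (0 < k)%N -> mu != part0 -> pdvd k mu -> (k <= psize mu)%N.
Proof.
move=> k0 mu0 h; rewrite -(pdiv_byK k0 h) psize_partmul leq_pmulr //.
by rewrite lt0n psize_eq0 -(partmul_eq0 _ k0) pdiv_byK.
Qed.

Section MoebiusInversion.
Variable C : fieldType.
Local Notation K := (Kqt C).
Variable F : intpart -> K.

Lemma reformulatedE mu N : mu != part0 -> (psize mu <= N)%N ->
  reformulated F mu = \sum_(1 <= k < N.+1 | pdvd k mu)
     (moebius k)%:~R / k%:R * frob C k.-1 (F (pdiv_by mu k)).
Proof.
move=> mu0 muN; rewrite /reformulated.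
rewrite [RHS](big_cat_nat (n := (psize mu).+1)) //=.
rewrite [X in _ + X]big_nat_cond [X in _ + X]big1 ?addr0; last first.
  move=> k /andP[/andP[k1 _] h]; have k0 : (0 < k)%N by apply: leq_trans k1.
  by have := pdvd_leq k0 mu0 h; rewrite leqNgt k1.
rewrite big_nat_cond [RHS]big_nat_cond; apply: eq_bigr => k /andP[/andP[k0 _] _].
by rewrite frobE.
Qed.

(** Substituting the definition of g gives the double sum over k and j of
mu(j) / (k j) F_(mu/(k j))(q^(k j),t^(k j)); at fixed l = k j the sum of mu(j) over
the divisors j of l is 1 for l = 1 and 0 otherwise. *)
Lemma moebius_inversion mu : mu != part0 ->
  F mu = \sum_(1 <= k < (psize mu).+1 | pdvd k mu)
     k%:R^-1 * frob C k.-1 (reformulated F (pdiv_by mu k)).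
Proof.
move=> mu0; set N := psize mu.
pose T (l : nat) : K := l%:R^-1 * frob C l.-1 (F (pdiv_by mu l)).
have step k : (0 < k)%N -> pdvd k mu ->
   k%:R^-1 * frob C k.-1 (reformulated F (pdiv_by mu k))
   = \sum_(1 <= j < N.+1) \sum_(1 <= l < N.+1 | (l == k * j)%N && pdvd l mu)
       (moebius j)%:~R * T l.
  move=> k0 h.
  have nu0 : pdiv_by mu k != part0 by rewrite -(partmul_eq0 _ k0) pdiv_byK.
  have nuN : (psize (pdiv_by mu k) <= N)%N.
    by rewrite /N -[in X in (_ <= X)%N](pdiv_byK k0 h) psize_partmul leq_pmull.
  rewrite (reformulatedE nu0 nuN) rmorph_sum mulr_sumr big_mkcond /=.
  apply: eq_big_nat => j /andP[j0 _].
  have kj0 : (0 < k * j)%N by rewrite muln_gt0 k0.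
  case: ifP => hj; last first.
    rewrite big_pred0 // => l; case: eqP => //= ->.
    by rewrite pdvd_mul // h hj.
  have hkj : pdvd (k * j) mu by rewrite pdvd_mul // h hj.
  rewrite (@big_seq_only1 _ _ _ _ _ (k * j)%N) ?iota_uniq //; last first.
  - by move=> l /=; case: eqP => [->|//]; rewrite hkj.
  - by rewrite mem_index_iota kj0 ltnS pdvd_leq.
  rewrite !rmorphM fmorphV rmorph_int rmorph_nat /T /= frob_comp !prednK //.
  by rewrite pdiv_by_mul // natrM invfM !mulrA; congr (_ * _ * _); rewrite mulrC.
have stepN k : (0 < k)%N ->
   (if pdvd k mu then k%:R^-1 * frob C k.-1 (reformulated F (pdiv_by mu k)) else 0)
   = \sum_(1 <= j < N.+1) \sum_(1 <= l < N.+1 | pdvd l mu)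
       (l == k * j)%N%:R * ((moebius j)%:~R * T l).
  move=> k0; transitivity (\sum_(1 <= j < N.+1) \sum_(1 <= l < N.+1 | (l == k * j)%N && pdvd l mu)
       (moebius j)%:~R * T l).
    case: ifP => [/(step _ k0) //|hk]; rewrite big_nat big1 // => j /andP[j0 _].
    rewrite big_pred0 // => l; case: eqP => //= ->.
    by rewrite pdvd_mul // hk.
  apply: eq_bigr => j _; under eq_bigl do rewrite andbC.
  rewrite big_mkcondr; apply: eq_bigr => l _.
  by case: eqP; rewrite ?mul1r ?mul0r.
rewrite [RHS]big_mkcond /=.
transitivity (\sum_(1 <= k < N.+1) \sum_(1 <= j < N.+1) \sum_(1 <= l < N.+1 | pdvd l mu)
       (l == k * j)%N%:R * ((moebius j)%:~R * T l)); last first.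
  by apply: eq_big_nat => k /andP[k0 _]; rewrite stepN.
rewrite exchange_big /=; under eq_bigr do rewrite exchange_big /=.
rewrite exchange_big /=.
transitivity (\sum_(1 <= l < N.+1 | pdvd l mu) (l == 1%N)%:R * T l).
  have N0 : (0 < N)%N by rewrite lt0n psize_eq0.
  have d1 : pdvd 1 mu by apply/pdvdP => i _; exact: dvd1n.
  rewrite [RHS]big_mkcond (bigD1_seq 1%N) ?mem_index_iota ?iota_uniq ?ltnS //= d1.
  rewrite big1 ?addr0 => [|l /negbTE ->]; last by rewrite mul0r if_same.
  rewrite mul1r /T invr1 mul1r frob0 /=; congr (F _).
  rewrite -[LHS](pdiv_byK (ltn0Sn 0) d1); apply: intpart_eq.
  rewrite (permPl (partmul_perm _ (ltn0Sn 0))) (_ : map _ _ = (pdiv_by mu 1 : seq nat)) //.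
  by rewrite -[RHS]map_id; apply: eq_map => i; rewrite mul1n.
rewrite [LHS]big_nat_cond [RHS]big_nat_cond; apply: eq_bigr => l /andP[/andP[l0 lN] hl].
have : (l == 1%N)%:R = (\sum_(d <- divisors l) moebius d)%:~R :> K.
  by rewrite sum_moebius //; case: eqP.
move=> ->; rewrite rmorph_sum mulr_suml /=.
have P : perm_eq (divisors l) [seq j <- index_iota 1 N.+1 | j %| l]%N.
  apply: uniq_perm; rewrite ?divisors_uniq ?filter_uniq ?iota_uniq // => j.
  rewrite mem_filter mem_index_iota -dvdn_divisors //; case: (boolP (j %| l)%N) => //= jl.
  by rewrite (dvdn_gt0 l0 jl) (leq_ltn_trans (dvdn_leq l0 jl) lN).
rewrite (perm_big _ P) big_filter big_mkcond /=; apply: eq_big_nat => j /andP[j0 _].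
rewrite -mulr_suml; case: ifP => jl.
  rewrite -[LHS]mul1r; congr (_ * _); apply/esym.
  have lj0 : (0 < l %/ j)%N by rewrite divn_gt0 // dvdn_leq.
  rewrite (bigD1_seq (l %/ j)%N) ?iota_uniq ?mem_index_iota //=; last first.
    by rewrite lj0 /= (leq_ltn_trans _ lN) // leq_div.
  rewrite divnK // eqxx big1 ?addr0 // => k kl; case: eqP => // e.
  by rewrite e mulnK ?eqxx in kl.
rewrite big_nat big1 ?mul0r // => k _; case: eqP => // e.
by rewrite e dvdn_mull in jl.
Qed.
End MoebiusInversion.

(** * The module of highest weight 0 *)

Section Weights.
Variable N : nat.
Implicit Types x y : weight N.

Lemma ipDr x y z : ip x (fun j => y j + z j) = ip x y + ip x z.
Proof. by rewrite /ip -big_split; apply: eq_bigr => j _; rewrite mulrDr. Qed.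
Lemma ipNr x y : ip x (fun j => - y j) = - ip x y.
Proof. by rewrite /ip -sumrN; apply: eq_bigr => j _; rewrite mulrN. Qed.
Lemma ipC x y : ip x y = ip y x.
Proof. by apply: eq_bigr => j _; rewrite mulrC. Qed.
Lemma ip_ext x y z : y =1 z -> ip x y = ip x z.
Proof. by move=> e; apply: eq_bigr => j _; rewrite e. Qed.
Lemma ip0r x y : y =1 (fun=> 0) -> ip x y = 0.
Proof. by move=> e; rewrite /ip big1 // => j _; rewrite e mulr0. Qed.

(** The coordinates of x extended by zero, so that the pairing with the last simple
root eps_N has the same form as with the other ones. *)
Definition wext x (k : nat) : int := if insub k is Some i then x i else 0.

Lemma wext_ord x (i : 'I_N) : wext x i = x i.
Proof. by rewrite /wext; case: insubP => [u _ /val_inj ->|]; rewrite ?ltn_ord. Qed.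
Lemma wext_out x k : (N <= k)%N -> wext x k = 0.
Proof. by rewrite /wext; case: insubP => // u uk _; rewrite leqNgt uk. Qed.

Lemma ip_sroot x (i : 'I_N) : ip (sroot i) x = x i - wext x i.+1.
Proof.
rewrite /ip /sroot; under eq_bigr do rewrite mulrBl.
rewrite sumrB; congr (_ - _).
  rewrite (bigD1 i) //= eqxx mul1r big1 ?addr0 // => j /negbTE ->; exact: mul0r.
have [h|h] := ltnP i.+1 N.
  rewrite (bigD1 (Ordinal h)) //= eqxx mul1r big1 ?addr0 => [|j].
    by rewrite -(wext_ord x (Ordinal h)).
  by rewrite -val_eqE /= => /negbTE ->; exact: mul0r.
rewrite wext_out // big1 // => j _; case: eqP => e; last exact: mul0r.
by have := ltn_ord j; rewrite e ltnNge h.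
Qed.

(** The simple roots span the weight lattice: the pairings with them give the
coordinates of x recursively from the last one. *)
Lemma ip_nondeg x : (forall i : 'I_N, ip (sroot i) x = 0) -> x =1 (fun=> 0).
Proof.
move=> H i; rewrite -wext_ord.
suff G k : forall j, (N - j <= k)%N -> wext x j = 0 by exact: (G N _ (leq_subr _ _)).
elim: k => [|k IH] j hj; first by rewrite wext_out // -subn_eq0 -leqn0.
have [jN|Nj] := ltnP j N; last exact: wext_out.
have := H (Ordinal jN); rewrite ip_sroot -wext_ord /= => /eqP.
rewrite subr_eq0 => /eqP ->; apply: IH.
by rewrite subnS -ltnS prednK // subn_gt0.
Qed.

Lemma ip_rho2_sroot (i : 'I_N) : 0 < ip (@rho2 N) (sroot i).
Proof.
rewrite ipC ip_sroot; have [h|h] := ltnP i.+1 N; last first.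
  by have := ltn_ord i; rewrite wext_out // /rho2; lia.
by rewrite -[i.+1]/(nat_of_ord (Ordinal h)) wext_ord /rho2 /=; lia.
Qed.
End Weights.

Section Ls.
Variable C : fieldType.
Local Notation L := (Ls C).

Lemma sL_neq0 : sL C != 0.
Proof. by rewrite tofrac_eq0 polyX_eq0. Qed.

Lemma sL_exp_eq1 n : (sL C ^+ n == 1) = (n == 0%N).
Proof.
rewrite -tofracXn -tofrac1 tofrac_eq; apply/eqP/eqP => [|->]; last by rewrite expr0.
by move/(congr1 (size : {poly C} -> nat)); rewrite size_polyXn size_poly1 => -[].
Qed.
Lemma sL_expz_eq1 (z : int) : (sL C ^ z == 1) = (z == 0).
Proof.
case: z => n; first by rewrite -exprnP sL_exp_eq1.
by rewrite NegzE -exprnN invr_eq1 sL_exp_eq1.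
Qed.
Lemma qpow_eq1 (z : int) : (qpow C z == 1) = (z == 0).
Proof. by rewrite /qpow sL_expz_eq1 mulf_eq0 orbF. Qed.
Lemma qpow0 : qpow C 0 = 1.
Proof. by rewrite /qpow mul0r expr0z. Qed.
Lemma qpowD a b : qpow C (a + b) = qpow C a * qpow C b.
Proof. by rewrite /qpow mulrDl expfzDr // sL_neq0. Qed.
Lemma qpow_inj : injective (qpow C).
Proof.
move=> a b e; apply/eqP; rewrite -subr_eq0 -qpow_eq1 qpowD e -qpowD subrr qpow0 //.
Qed.
End Ls.

Section Operators.
Variable L : fieldType.

Lemma kerop_entry (T : finType) (k : T -> T -> L) (x y : T) : entry (kerop k) x y = k x y.
Proof. by rewrite /entry mxE !enum_rankK. Qed.
Lemma entry_mx (T : finType) (X : 'M[L]_#|T|) i j : X i j = entry X (enum_val i) (enum_val j).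
Proof. by rewrite /entry !enum_valK. Qed.
Lemma diagop_mul (T : finType) m (f : T -> L) (X : 'M[L]_(#|T|, m)) i j :
  (diagop f *m X) i j = f (enum_val i) * X i j.
Proof.
rewrite mxE (bigD1 i) //= !mxE eqxx mulr1n big1 ?addr0 // => k ki.
rewrite !mxE (inj_eq enum_val_inj) eq_sym (negbTE ki) mulr0n mul0r //.
Qed.
Lemma mul_diagop (T : finType) m (f : T -> L) (X : 'M[L]_(m, #|T|)) i j :
  (X *m diagop f) i j = X i j * f (enum_val j).
Proof.
rewrite mxE (bigD1 j) //= !mxE eqxx mulr1n big1 ?addr0 // => k kj.
by rewrite !mxE (inj_eq enum_val_inj) (negbTE kj) mulr0n mulr0.
Qed.
End Operators.

Section TrivialModule.
Variables (C : fieldType) (N : nat) (V : wmod C N).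
Local Notation L := (Ls C).
Local Notation d := #|bas V|.
Hypothesis wV : is_wmod V.

(** A grading of the module for which every F_i has negative degree. *)
Definition ht (a : bas V) : int := ip (@rho2 N) (wt a).

(** K_j F_i = q^(- (a_j, a_i)) F_i K_j, and the K_j separate the weights. *)
Lemma Fop_weight i (a b : bas V) : entry (Fop V i) a b != 0 ->
  forall j, wt b j = wt a j + sroot i j.
Proof.
case: wV => _ hF _ _ _ nz j.
suff /ip_nondeg/(_ j) : forall j, ip (sroot j) (fun l => wt b l + - (wt a l + sroot i l)) = 0.
  by move/eqP; rewrite subr_eq0 => /eqP.
move=> {}j; rewrite ipDr ipNr ipDr; apply/eqP; rewrite subr_eq0; apply/eqP.
have /matrixP/(_ (enum_rank a) (enum_rank b)) := hF j i.
rewrite diagop_mul mxE mul_diagop !enum_rankK -/(entry _ a b) mulrCA.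
rewrite mulrC => /(mulfI nz); rewrite -qpowD => /qpow_inj e.
by rewrite e addrAC addNr add0r.
Qed.

Lemma Fop_ht i (a b : bas V) : entry (Fop V i) a b != 0 -> ht a < ht b.
Proof.
move=> /Fop_weight e; rewrite /ht (ip_ext _ e) ipDr ltrDl; exact: ip_rho2_sroot.
Qed.

Definition ht_le (h : int) (x : 'cV[L]_d) := forall a, x (enum_rank a) 0 != 0 -> ht a <= h.

Lemma ht_le_F h i x : ht_le h x -> ht_le (h - 1) (Fop V i *m x).
Proof.
move=> hx a; rewrite mxE => nz.
have [k /andP[nF nx]|h0] := pickP (fun k => (Fop V i (enum_rank a) k != 0) && (x k 0 != 0)).
  have := hx (enum_val k); rewrite enum_valK => /(_ nx) le.
  have e : entry (Fop V i) a (enum_val k) = Fop V i (enum_rank a) k by rewrite /entry enum_valK.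
  by rewrite -e in nF; have := Fop_ht nF; move: le; lia.
case/eqP: nz; apply: big1 => k _; have := h0 k; apply: contraFeq.
by rewrite mulf_eq0 negb_or.
Qed.

Lemma ht_le_word h u x : ht_le h x -> ht_le (h - (size u)%:Z) (wordop (Fop V) u *m x).
Proof.
move=> hx; elim: u => [|i u IH] /=; first by rewrite subr0 mul1mx.
rewrite -mulmxA (_ : h - _ = h - (size u)%:Z - 1); first exact: ht_le_F.
by lia.
Qed.

Lemma ht_le_eq0 h x : ht_le h x -> (forall a, h < ht a) -> x = 0.
Proof.
move=> hx H; apply/matrixP => i j; rewrite ord1 mxE; apply/eqP; apply: contraT => nz.
by have := hx (enum_val i); rewrite enum_valK => /(_ nz); rewrite leNgt H.
Qed.

Section Highest.
Variables (w : 'cV[L]_d) (kap : 'I_N -> int).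
Hypothesis Ew : forall i, Eop V i *m w = 0.
Hypothesis Kw : forall i, Kop V i *m w = qpow C (kap i) *: w.

Lemma Kinv_vec i z (x : 'cV[L]_d) : Kop V i *m x = qpow C z *: x -> Kinv V i *m x = qpow C (- z) *: x.
Proof.
move=> /matrixP e; apply/matrixP => a j; have := e a j.
rewrite !diagop_mul !mxE; have [->|nz] := eqVneq (x a j) 0; first by rewrite !mulr0.
by move/(mulIf nz)/qpow_inj ->.
Qed.

Lemma K_word u i : exists z, Kop V i *m (wordop (Fop V) u *m w) = qpow C z *: (wordop (Fop V) u *m w).
Proof.
case: wV => _ hF _ _ _; elim: u => [|j u [z IH]] /=.
  by exists (kap i); rewrite mul1mx Kw.
exists (- ip (sroot i) (sroot j) + z).
rewrite -mulmxA mulmxA hF -scalemxAl -mulmxA IH -!scalemxAr scalerA -qpowD //.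
Qed.

Variable D : nat.
Hypothesis nil : forall u, (D <= size u)%N -> wordop (Fop V) u *m w = 0.

(** The span of the F-words applied to w.  A submodule when w is annihilated by all
E_i; the words of length at least D act by 0, so this finite sum contains them all. *)
Definition Fspan : 'M[L]_d :=
  (\sum_(k < D) \sum_(u : k.-tuple 'I_N) <<(wordop (Fop V) u *m w)^T>>)%MS.

Lemma word_Fspan u : ((wordop (Fop V) u *m w)^T <= Fspan)%MS.
Proof.
have [uD|uD] := ltnP (size u) D; last by rewrite nil // trmx0 sub0mx.
apply: (sumsmx_sup (Ordinal uD)) => //=; apply: (sumsmx_sup (in_tuple u)) => //=.
by rewrite genmxE.
Qed.

Lemma Fspan_ker (X : 'M[L]_d) :
  (forall u, X *m (wordop (Fop V) u *m w) = 0) -> Fspan *m X^T = 0.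
Proof.
move=> H; apply/eqP; rewrite -submx0 sumsmxMr; apply/sumsmx_subP => k _.
rewrite sumsmxMr; apply/sumsmx_subP => u _.
by rewrite (eqmxMr _ (genmxE _)) -trmx_mul H trmx0 sub0mx.
Qed.

Lemma Fspan_stable (X : 'M[L]_d) :
  (forall u, ((X *m (wordop (Fop V) u *m w))^T <= Fspan)%MS) -> (Fspan *m X^T <= Fspan)%MS.
Proof.
move=> H; rewrite [X in (X *m _ <= _)%MS]/Fspan.
rewrite sumsmxMr; apply/sumsmx_subP => k _; rewrite sumsmxMr; apply/sumsmx_subP => u _.
by rewrite (eqmxMr _ (genmxE _)) -trmx_mul.
Qed.

(** Commuting E_i to the right through a word in the F_j only creates multiples of
shorter words, as w is annihilated by E_i. *)
Lemma E_word i u : ((Eop V i *m (wordop (Fop V) u *m w))^T <= Fspan)%MS.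
Proof.
case: wV => _ _ hEF _ _; elim: u => [|j u IH] /=.
  by rewrite mul1mx Ew trmx0 sub0mx.
have -> : Eop V i *m (Fop V j *m wordop (Fop V) u *m w)
  = Fop V j *m (Eop V i *m (wordop (Fop V) u *m w)) +
    ((i == j)%:R / (qi C i - (qi C i)^-1)) *: 
     (Kop V i *m (wordop (Fop V) u *m w) - Kinv V i *m (wordop (Fop V) u *m w)).
  rewrite -(mulmxA (Fop V j)) (mulmxA (Eop V i)).
  rewrite -{1}(subrK (Fop V j *m Eop V i) (Eop V i *m Fop V j)) hEF mulmxDl.
  by rewrite -scalemxAl mulmxBl -mulmxA addrC.
have [z hz] := K_word u i.
rewrite (Kinv_vec hz) hz -scalerBl linearD linearZ /= addmx_sub //.
  rewrite trmx_mul; apply: submx_trans (submxMr _ IH) _.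
  apply: Fspan_stable => t; rewrite mulmxA.
  exact: (word_Fspan (j :: t)).
by rewrite linearZ /= scalerA scalemx_sub // word_Fspan.
Qed.

Lemma Fspan_submodule i :
  [/\ (Fspan *m (Eop V i)^T <= Fspan)%MS, (Fspan *m (Fop V i)^T <= Fspan)%MS,
      (Fspan *m (Kop V i)^T <= Fspan)%MS & (Fspan *m (Kinv V i)^T <= Fspan)%MS].
Proof.
split; apply: Fspan_stable => u.
- exact: E_word.
- by rewrite mulmxA; exact: (word_Fspan (i :: u)).
- by have [z ->] := K_word u i; rewrite linearZ /= scalemx_sub // word_Fspan.
have [z hz] := K_word u i.
by rewrite (Kinv_vec hz) linearZ /= scalemx_sub // word_Fspan.
Qed.
End Highest.

Hypothesis iV : is_irreducible V.
Variable v : 'cV[L]_d.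
Hypothesis v0 : v != 0.
Hypothesis Ev : forall i, Eop V i *m v = 0.
Hypothesis Kv : forall i, Kop V i *m v = v.

Lemma hw_wt0 a : v (enum_rank a) 0 != 0 -> forall j, wt a j = 0.
Proof.
move=> nz; apply: ip_nondeg => i.
have /matrixP/(_ (enum_rank a) 0) := Kv i; rewrite diagop_mul enum_rankK.
by rewrite -[RHS]mul1r => /(mulIf nz)/eqP; rewrite qpow_eq1 => /eqP.
Qed.

Lemma hw_ht_le : ht_le 0 v.
Proof. by move=> a /hw_wt0 e; rewrite /ht ip0r. Qed.

(** If it did not vanish, F_i v would be a highest weight vector of negative height,
and the submodule which it generates would not contain v. *)
Lemma Fv_eq0 i : Fop V i *m v = 0.
Proof.
apply/eqP; apply: contraT => w0; set w := Fop V i *m v in w0.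
have [_ irr] := iV; case: (wV) => _ hF hEF _ _.
have Kv' j : Kop V j *m v = qpow C 0 *: v by rewrite qpow0 scale1r.
have Ew j : Eop V j *m w = 0.
  have : (Eop V j *m Fop V i) *m v = 
   (((j == i)%:R / (qi C j - (qi C j)^-1)) *: (Kop V j - Kinv V j) + Fop V i *m Eop V j) *m v.
    by rewrite -hEF subrK.
  rewrite -mulmxA => ->; rewrite mulmxDl -mulmxA Ev mulmx0 addr0 -scalemxAl mulmxBl.
  by rewrite (Kinv_vec (Kv' j)) Kv oppr0 qpow0 scale1r subrr scaler0.
have Kw j : Kop V j *m w = qpow C (- ip (sroot j) (sroot i)) *: w.
  by rewrite /w mulmxA hF -scalemxAl -mulmxA Kv.
have hw : ht_le (-1) w by rewrite -[-1]add0r; apply: ht_le_F; exact: hw_ht_le.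
pose D := (\sum_(a : bas V) `|ht a|)%N.
have hD a : - D%:Z <= ht a.
  have : (`|ht a| <= D)%N by rewrite /D (bigD1 a) //= leq_addr.
  by lia.
have nil u : (D <= size u)%N -> wordop (Fop V) u *m w = 0.
  move=> hu; apply: (ht_le_eq0 (ht_le_word (u := u) hw)) => a; apply: lt_le_trans (hD a).
  by move: hu; lia.
have F0 : Fspan w D != 0.
  apply: contraNneq w0 => e; have := word_Fspan nil [::].
  by rewrite e submx0 /= mul1mx -trmx0 (inj_eq (can_inj (@trmxK _ _ _))).
have full := irr (Fspan w D) (Fspan_submodule Ew Kw nil) F0.
(* The projection to nonnegative heights kills the submodule but fixes v. *)
pose P : 'M[L]_d := diagop (fun a => (0 <= ht a)%R%:R).
have Pw : Fspan w D *m P^T = 0.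
  apply: Fspan_ker => u; apply/matrixP => a j; rewrite diagop_mul [RHS]mxE ord1.
  case: lerP => h; last by rewrite mul0r.
  have := ht_le_word (u := u) hw (a := enum_val a); rewrite enum_valK mul1r.
  by case: eqP => // _ /(_ isT); move: h; lia.
have Pv : P *m v = v.
  apply/matrixP => a j; rewrite diagop_mul ord1.
  have [->|nz] := eqVneq (v a 0) 0; first by rewrite mulr0.
  have e : ht (enum_val a) = 0.
    by rewrite /ht ip0r //; apply: hw_wt0; rewrite enum_valK.
  by rewrite e lexx mul1r.
have /submxP[B eB] : (v^T <= Fspan w D)%MS by exact: submx_full.
have : v^T = 0 by rewrite -Pv trmx_mul eB -mulmxA Pw mulmx0.
by move/(congr1 trmx); rewrite trmxK trmx0 => e; case/eqP: v0.
Qed.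

(** The line spanned by v is a submodule. *)
Lemma trivial_dim1 : d = 1%N.
Proof.
have [d0 irr] := iV.
have Kv' j : Kop V j *m v = qpow C 0 *: v by rewrite qpow0 scale1r.
have st i : [/\ (<<v^T>> *m (Eop V i)^T <= <<v^T>>)%MS, (<<v^T>> *m (Fop V i)^T <= <<v^T>>)%MS,
      (<<v^T>> *m (Kop V i)^T <= <<v^T>>)%MS & (<<v^T>> *m (Kinv V i)^T <= <<v^T>>)%MS].
  rewrite !(eqmxMr _ (genmxE _)) !genmxE -!trmx_mul Ev Fv_eq0 Kv.
  by rewrite (Kinv_vec (Kv' i)) oppr0 qpow0 scale1r trmx0 sub0mx submx_refl.
have v0' : <<v^T>>%MS != 0.
  by rewrite -mxrank_eq0 genmxE mxrank_eq0 -trmx0 (inj_eq (can_inj (@trmxK _ _ _))).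
have := irr _ st v0'; rewrite /row_full genmxE => /eqP e.
by apply/eqP; rewrite eqn_leq d0 andbT -[X in (X <= _)%N]e rank_leq_row.
Qed.

(** The module is one-dimensional, spanned by v. *)
Lemma vec_ker (X : 'M[L]_d) : X *m v = 0 -> X = 0.
Proof.
move=> Xv; apply/matrixP => i j; rewrite mxE.
have ord_d (k l : 'I_d) : k = l.
  by case: k l => k hk [l hl]; apply: val_inj => /=; move: hk hl; rewrite trivial_dim1; case: k l => [|//] [|//].
have vj : v j 0 != 0.
  apply: contraNneq v0 => e; apply/eqP/matrixP => k l; rewrite ord1 mxE (ord_d k j) //.
have /matrixP/(_ i 0) := Xv; rewrite mxE (bigD1 j) //= big1 ?addr0 => [|k]; last first.
  by rewrite (ord_d k j) eqxx.
by rewrite mxE => /eqP; rewrite mulf_eq0 (negbTE vj) orbF => /eqP.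
Qed.

End TrivialModule.

Section TrivialBraid.
Variables (C : fieldType) (N : nat) (V : wmod C N).
Local Notation L := (Ls C).
Hypothesis V1 : #|bas V| = 1%N.
Hypothesis E0 : forall i, Eop V i = 0.
Hypothesis wt0 : forall a j, wt (w := V) a j = 0.

Lemma card1_eq (T : finType) (x y : T) : #|T| = 1%N -> x = y.
Proof.
by move=> T1; have /card_le1_eqP := eq_leq T1; apply.
Qed.

Lemma card1_mx (T : finType) (X : 'M[L]_#|T|) : #|T| = 1%N ->
  (forall x, entry X x x = 1) -> X = 1%:M.
Proof.
move=> T1 H; apply/matrixP => i j; rewrite entry_mx mxE.
rewrite -(inj_eq enum_val_inj) (card1_eq (enum_val i) (enum_val j) T1) eqxx.
exact: H.
Qed.

Lemma wordop0 (X : 'I_N -> 'M[L]_#|bas V|) u :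
  (forall i, X i = 0) -> u != [::] -> wordop X u = 0.
Proof. by move=> X0; case: u => [//|i u] _ /=; rewrite X0 mul0mx. Qed.

Variable c : seq 'I_N -> seq 'I_N -> L.
Hypothesis c1 : c [::] [::] = 1.

Lemma card1_prod : #|{: bas V * bas V}| = 1%N.
Proof. by rewrite card_prod V1. Qed.

(** E and F act by 0 and all weights are 0, so only the empty words contribute to R. *)
Lemma Raction1 : Raction c V V = 1%:M.
Proof.
have D1 : diagop (fun x : bas V * bas V => qpow C (ip (wt x.1) (wt x.2))) = 1%:M.
  apply: card1_mx card1_prod _ => x.
  by rewrite kerop_entry eqxx mulr1n ip0r ?qpow0 // => j; exact: wt0.
rewrite /Raction D1 mul1mx big_nat_recl //.
rewrite [X in _ + X]big1 ?addr0 => [|k _]; last first.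
  rewrite big1 // => u _; rewrite big1 // => t _; rewrite (wordop0 E0); last by case: u => -[|].
  by apply/matrixP => i j; rewrite !mxE /entry mxE mul0r mulr0.
rewrite (big_pred1 [tuple]) => [|t]; last by apply/esym/eqP; exact: tuple0.
rewrite (big_pred1 [tuple]) => [|t]; last by apply/esym/eqP; exact: tuple0.
rewrite c1 scale1r; apply: card1_mx card1_prod _ => x.
by rewrite kerop_entry /= /entry !mxE !eqxx mulr1.
Qed.

Lemma Rcheck1 : Rcheck c V = 1%:M.
Proof.
rewrite /Rcheck Raction1 mulmx1; apply: card1_mx card1_prod _ => x.
rewrite kerop_entry (card1_eq x.1 x.2 V1) eqxx //.
Qed.

Lemma card1_ffun n : #|{ffun 'I_n.+1 -> bas V}| = 1%N.
Proof. by rewrite card_ffun V1 exp1n. Qed.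

Lemma braid_op1 n (b : braid n) : braid_op c V b = 1%:M.
Proof.
elim: b => //= x b ->; rewrite mulmx1 Rcheck1 invmx1 if_same.
apply: card1_mx (card1_ffun n) _ => f.
rewrite kerop_entry /entry mxE eqxx.
by rewrite (_ : [forall j, _]) //; apply/forallP => j; rewrite eqxx implybT.
Qed.

Lemma qtrace_op1 n : qtrace_op V n = 1%:M.
Proof.
apply: card1_mx (card1_ffun n) _ => f; rewrite kerop_entry eqxx mulr1n big1 // => j _.
by rewrite ip0r ?qpow0 // => k; exact: wt0.
Qed.

Lemma trace_braid1 n (b : braid n) : \tr (qtrace_op V n *m braid_op c V b) = 1.
Proof. by rewrite qtrace_op1 braid_op1 mulmx1 mxtrace1 card1_ffun. Qed.

End TrivialBraid.

Lemma so_invariant0 (C : fieldType) N n (b : braid n) (x : Ls C) :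
  @is_so_invariant C N part0 n b x -> x = 1.
Proof.
move=> [V [c [wV iV [v v0 hv] [c1 _ _ _ _] ->]]].
have yw i : @young_weight N part0 i = 0 by rewrite /young_weight nth_default.
have Ev i : Eop V i *m v = 0 by have [] := hv i.
have Kv i : Kop V i *m v = v.
  by have [_ ->] := hv i; rewrite ip0r // qpow0 scale1r.
have V1 := trivial_dim1 wV iV v0 Ev Kv.
have E0 i := vec_ker wV iV v0 Ev Kv (Ev i).
have wt0 a j : wt (w := V) a j = 0.
  have [k nz|h] := pickP (fun k => v k 0 != 0).
    by rewrite (card1_eq a (enum_val k) V1); apply: (hw_wt0 Kv); rewrite enum_valK.
  case/eqP: v0; apply/matrixP => k l; rewrite ord1 mxE.
  by apply/eqP; exact: negbFE (h k).
by rewrite trace_braid1 // mulr1 ipC ip0r ?mulr0 ?qpow0.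
Qed.

(** * The constant term of the partition function *)

Section ConstantTerm.
Variable C : fieldType.
Local Notation L := (Ls C).

Lemma cL_zmod : zmod_morphism (@cL C).
Proof. by move=> x y; rewrite /cL polyCB tofracB. Qed.
Lemma cL_monoid : monoid_morphism (@cL C).
Proof. by split=> [|x y]; rewrite /cL ?polyC1 ?tofrac1 // polyCM tofracM. Qed.
HB.instance Definition _ := GRing.isZmodMorphism.Build C L (@cL C) cL_zmod.
HB.instance Definition _ := GRing.isMonoidMorphism.Build C L (@cL C) cL_monoid.

(** A polynomial in t over the field C(s) with the infinitely many roots s^(4N) is
zero, and s^2 is transcendental over C. *)
Lemma ev2_infinitely_many_zeros (p : {poly {poly C}}) (N0 : nat) :
  (forall N, (N0 <= N)%N -> ev2 (@cL C) (sL C ^+ 2) (sL C ^+ (4 * N)) p = 0) -> p = 0.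
Proof.
move=> H; pose P : {poly L} := (map_poly (map_poly (@cL C)) p).[(sL C ^+ 2)%:P].
have PE b : P.[b] = ev2 (@cL C) (sL C ^+ 2) b p.
  pose f : {rmorphism {poly {poly C}} -> L} :=
    (horner_eval b \o horner_eval (sL C ^+ 2)%:P \o map_poly (map_poly (@cL C))).
  apply: (poly2_rmorph_eq (f := f)) => [||c].
  - by rewrite ev2X /= map_polyX /horner_eval hornerX hornerC.
  - by rewrite ev2Y /= map_polyC /= map_polyX /horner_eval hornerC hornerX.
  - by rewrite ev2C /= map_polyC /= map_polyC /horner_eval !hornerC.
have P0 : P = 0.
  apply/eqP; apply: contraT => nz.
  have := @max_poly_roots _ P [seq sL C ^+ (4 * N) | N <- iota N0 (size P)] nz.
  rewrite size_map size_iota ltnn; apply.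
    apply/allP => x /mapP[N]; rewrite mem_iota => /andP[hN _] ->.
    by rewrite rootE PE H.
  rewrite map_inj_uniq ?iota_uniq // => N M /eqP.
  rewrite -!tofracXn tofrac_eq => /eqP/(congr1 (size : {poly C} -> nat)).
  by rewrite !size_polyXn => -[] /eqP; rewrite eqn_pmul2l // => /eqP.
apply/polyP => i; apply/polyP => j; rewrite !coef0.
(* q is the coefficient of t^j in p, as a polynomial in the first variable; its value
   at s^2 is the j-th coefficient of P. *)
pose q := \sum_(k < size p) p`_k`_j *: 'X^k : {poly C}.
have q0 : q = 0.
  apply/eqP; rewrite -(@comp_poly_eq0 _ _ ('X^2)) ?size_polyXn // -tofrac_eq0.
  have /(congr1 (fun r : {poly L} => r`_j)) := P0; rewrite coef0 => e.
  apply/eqP; rewrite -[RHS]e /P /q horner_coef size_map_inj_poly ?rmorph0 //; last first.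
    by apply: map_inj_poly; rewrite ?rmorph0 //; exact: fmorph_inj.
  rewrite coef_sum !raddf_sum /=; apply: eq_bigr => k _.
  rewrite coef_map /= -rmorphXn coefMC coef_map /=.
  by rewrite comp_polyZ comp_Xn_poly -mul_polyC tofracM -!exprM !tofracXn.
have [h|h] := ltnP i (size p); last by rewrite (nth_default _ h) coef0.
have /(congr1 (fun r : {poly C} => r`_i)) := q0; rewrite coef0 /q coef_sum => e.
rewrite -[RHS]e (bigD1 (Ordinal h)) //= coefZ coefXn eqxx mulr1 big1 ?addr0 // => k.
by rewrite -val_eqE /= coefZ coefXn eq_sym => /negbTE ->; rewrite mulr0.
Qed.

Lemma colored_Kauffman0 n (b : braid n) (W : intpart -> Kqt C) :
  is_colored_Kauffman b W -> W part0 = 1.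
Proof.
move=> /(_ part0)[N0 H]; have [m [d [d0 e]]] := frac_rep (W part0).
have h0 : m - d = 0.
  apply: (@ev2_infinitely_many_zeros _ N0.+1) => N hN.
  have [||x [m' [d' [d'0 e' ->]]]] := H N (ltnW hN) _ _; first by rewrite /= ?leq0n.
    exact: leq_ltn_trans (leq0n _) hN.
  move=> /so_invariant0; rewrite !eval2E in d'0 * => /(canRL (mulfVK d'0)); rewrite mul1r => ed.
  have d'z : d' != 0 by apply: contraNneq d'0 => ->; rewrite rmorph0.
  have /eqP : m%:F / d%:F = m'%:F / d'%:F by rewrite -e -e'.
  rewrite eqr_div ?tofrac_eq0 // -!tofracM tofrac_eq => /eqP.
  move/(congr1 (ev2 (@cL C) (sL C ^+ 2) (sL C ^+ (4 * N)))).
  by rewrite !rmorphM ed [RHS]mulrC => /(mulIf d'0) e2; rewrite rmorphB e2 subrr.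
by rewrite e (subr0_eq h0) divff ?tofrac_eq0.
Qed.

Lemma cycle_type_S0 (s : 'S_0) : cycle_type s = part0.
Proof.
apply/eqP; rewrite -psize_eq0 psize_mkpart (_ : enum _ = [::]) //.
apply: size0nil; rewrite -cardE; apply: eq_card0 => c.
by apply/imsetP => -[[]].
Qed.

(** Br_0 has a single diagram, the identity; every line is stable, so an irreducible
representation has dimension 1. *)
Lemma brauer_character0 delta (chi : nat -> intpart -> intpart -> C) :
  is_brauer_characters delta chi -> chi 0%N part0 part0 = 1.
Proof.
move=> H; have [|//|d [rho [[r1 _] [d0 irr] _ hchi]]] := H 0%N part0 0%N.
  exact: psize0.
rewrite -[X in chi _ _ X](cycle_type_S0 1%g) hchi r1 mxtrace1.
case: d rho r1 d0 irr {hchi} => // d rho r1 _ irr.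
have st : brauer_stable rho (delta_mx 0 0).
  move=> x _; rewrite (_ : x = perm_diag 1%g) ?r1 ?trmx1 ?mulmx1 //.
  by apply/ffunP => -[] [].
have nz : delta_mx 0 0 != 0 :> 'M[C]_d.+1 by rewrite -mxrank_eq0 mxrank_delta.
by have := irr _ st nz; rewrite /row_full mxrank_delta => /eqP <-.
Qed.

Lemma ZSO_coef0 delta (chi : nat -> intpart -> intpart -> C) n (b : braid n) W :
  is_brauer_characters delta chi -> is_colored_Kauffman b W ->
  ZSO_coef chi W part0 = 1.
Proof.
move=> hchi hW; rewrite /ZSO_coef psize0 /= big_nat1 partitions_of0 big_seq1.
rewrite (brauer_character0 hchi) (colored_Kauffman0 hW) rmorph1 /zee psize0 big_geq //.
by rewrite invr1 !mulr1.
Qed.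
End ConstantTerm.

(** * Unconditional convergence *)

Section NetConvergence.
Variables (C : numFieldType) (I : choiceType).
Implicit Types (u w : {fset I} -> C).

(** Convergence along the finite subsets of I ordered by inclusion. *)
Definition netcvg u (v : C) : Prop :=
  forall eps : C, 0 < eps -> exists J0 : {fset I}, forall J : {fset I},
    (J0 `<=` J)%fset -> `|u J - v| < eps.

Lemma netcvg_cst v : netcvg (fun=> v) v.
Proof. by move=> eps e0; exists fset0 => J _; rewrite subrr normr0. Qed.

Lemma netcvgD u v u' v' : netcvg u v -> netcvg u' v' ->
  netcvg (fun J => u J + u' J) (v + v').
Proof.
move=> h h' eps e0; have e2 : 0 < eps / 2%:R by rewrite divr_gt0 ?ltr0n.
have [J0 H] := h _ e2; have [J1 H'] := h' _ e2; exists (J0 `|` J1)%fset => J.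
rewrite fsubUset => /andP[s0 s1]; rewrite opprD addrACA.
apply: le_lt_trans (ler_normD _ _) _.
by rewrite [eps]splitr ltrD ?H ?H'.
Qed.

Lemma netcvgM u v u' v' : netcvg u v -> netcvg u' v' ->
  netcvg (fun J => u J * u' J) (v * v').
Proof.
move=> h h' eps e0; have e2 : 0 < eps / 2%:R by rewrite divr_gt0 ?ltr0n.
(* The summands 1 keep the divisors below nonzero; a eventually bounds |u' J|. *)
pose a := `|v'| + 1; pose b := `|v| + 1.
have a0 : 0 < a by rewrite ltr_wpDl.
have b0 : 0 < b by rewrite ltr_wpDl.
have [J0 H] := h _ (divr_gt0 e2 a0).
have [J1 H1] := h' _ (divr_gt0 e2 b0).
have [J2 H2] := h' _ (ltr01 : 0 < 1 :> C).
exists (J0 `|` (J1 `|` J2))%fset => J; rewrite !fsubUset => /and3P[s0 s1 s2].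
have -> : u J * u' J - v * v' = (u J - v) * u' J + v * (u' J - v').
  by rewrite mulrBl mulrBr addrA subrK.
apply: le_lt_trans (ler_normD _ _) _; rewrite !normrM [eps]splitr.
apply: ltr_leD.
  have u'a : `|u' J| <= a.
    rewrite -[u' J](subrK v') addrC; apply: le_trans (ler_normD _ _) _.
    by rewrite lerD2l ltW // H2.
  apply: le_lt_trans (ler_wpM2l (normr_ge0 _) u'a) _.
  by rewrite -ltr_pdivlMr // H.
apply: (@le_trans _ _ (b * `|u' J - v'|)).
  by rewrite ler_wpM2r // /b lerDl.
by rewrite mulrC -ler_pdivlMr // ltW // H1.
Qed.

Lemma netcvg_sum (T : Type) (r : seq T) (P : pred T) (u : T -> {fset I} -> C) (v : T -> C) :
  (forall t, P t -> netcvg (u t) (v t)) ->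
  netcvg (fun J => \sum_(t <- r | P t) u t J) (\sum_(t <- r | P t) v t).
Proof.
move=> h; elim: r => [|t r IH].
  by rewrite big_nil (_ : (fun J => _) = (fun=> 0)); [exact: netcvg_cst | apply: funext => J; rewrite big_nil].
rewrite big_cons (_ : (fun J => _) = (fun J => if P t then u t J + \sum_(t <- r | P t) u t J
    else \sum_(t <- r | P t) u t J)); last by apply: funext => J; rewrite big_cons.
by case: ifP => // Pt; apply: netcvgD => //; exact: h.
Qed.

(** Unconditional summation along a sequence e : nat -> I without repetitions, where
Q and d recognize its terms and recover their ranks.  Beyond a finite set the sums
are controlled by the tails of the absolute series. *)
Lemma netcvg_series (e : nat -> I) (Q : pred I) (d : I -> nat) (b : nat -> C) (s : C) :
  (forall n, Q (e n)) -> (forall n, d (e n) = n) -> (forall x, Q x -> e (d x) = x) ->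
  (forall eps, 0 < eps -> exists T, `|\sum_(0 <= n < T) b n - s| < eps /\
     forall T', \sum_(T <= n < T') `|b n| < eps) ->
  netcvg (fun J => \sum_(x <- enum_fset J | Q x) b (d x)) s.
Proof.
move=> Qe de ed H eps e0; have e2 : 0 < eps / 2%:R by rewrite divr_gt0 ?ltr0n.
have [T [HT HT']] := H _ e2.
exists [fset e n | n in iota 0 T]%fset => J sJ.
(* T' exceeds the ranks of all terms in J. *)
pose T' := (T + \max_(x <- enum_fset J) (d x).+1)%N.
have TT' : (T <= T')%N by exact: leq_addr.
have -> : \sum_(x <- enum_fset J | Q x) b (d x) = \sum_(0 <= n < T' | e n \in J) b n.
  rewrite -big_filter -[RHS]big_filter -(big_map d predT b); apply: perm_big.
  apply: uniq_perm; rewrite ?filter_uniq ?iota_uniq //.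
    rewrite map_inj_in_uniq ?filter_uniq ?enum_fset_uniq // => x y.
    by rewrite !mem_filter => /andP[Qx _] /andP[Qy _] exy; rewrite -(ed _ Qx) exy ed.
  move=> n; rewrite mem_filter mem_index_iota /=; apply/mapP/andP => [[x]|[nJ _]].
    rewrite mem_filter => /andP[Qx xJ] ->; rewrite ed //; split=> //.
    apply: leq_trans (leq_addl _ _).
    by rewrite (big_rem x) //= leq_maxl.
  by exists (e n); rewrite ?de // mem_filter Qe nJ.
rewrite (big_cat_nat (n := T)) //= big_mkcond /=.
have -> : \sum_(0 <= n < T) (if e n \in J then b n else 0) = \sum_(0 <= n < T) b n.
  apply: eq_big_nat => n /andP[_ nT]; rewrite (fsubsetP sJ) //.
  by apply/imfsetP; exists n; rewrite //= mem_iota.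
rewrite addrAC [eps]splitr; apply: le_lt_trans (ler_normD _ _) _.
apply: ltrD => //; apply: le_lt_trans (HT' T').
apply: le_trans (ler_norm_sum _ _ _) _.
rewrite big_mkcond /=; apply: ler_sum => n _.
by case: ifP => //.
Qed.

End NetConvergence.

Section Geometric.
Variable F : fieldType.
(** The partial sums of sum_n n x^n, for the limit x / (1 - x)^2. *)
Lemma sum_nX (x : F) T : x != 1 ->
  \sum_(0 <= n < T) n%:R * x ^+ n
  = x / (1 - x) ^+ 2 - x ^+ T * (T%:R * (1 - x) + x) / (1 - x) ^+ 2.
Proof.
move=> x1; have nz : 1 - x != 0 by rewrite subr_eq0 eq_sym.
elim: T => [|T IH]; first by rewrite big_nil expr0 !mul1r mul0r add0r subrr.
rewrite big_nat_recr //= IH -[T.+1%:R]natr1 (exprS x T).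
move: (x ^+ T) (T%:R : F) => y z. by field.
Qed.
End Geometric.

Section GeometricBound.
Variable R : realType.

Lemma bernoulli_le (h : R) n : 0 <= h -> 1 + n%:R * h <= (1 + h) ^+ n.
Proof.
move=> h0; elim: n => [|n IH]; first by rewrite mul0r addr0 expr0.
rewrite exprS; apply: (@le_trans _ _ ((1 + h) * (1 + n%:R * h))); last first.
  by rewrite ler_wpM2l // addr_ge0.
rewrite -natr1 !mulrDl !mulrDr !mul1r !mulr1.
have : 0 <= h * (n%:R * h) by rewrite !mulr_ge0.
by move: (h * _) => z z0; lra.
Qed.

(** With s the square root of r, s^T (2 T + 1) is bounded and s^T tends to 0. *)
Lemma geometric_small (r : R) : 0 <= r -> r < 1 -> forall eps, 0 < eps ->
  exists T, r ^+ T * (2 * T%:R + 1) < eps.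
Proof.
move=> r0 r1 eps e0; have [rz|rz] := eqVneq r 0.
  by exists 1%N; rewrite rz expr1 mul0r.
pose s := Num.sqrt r.
have s0 : 0 < s by rewrite sqrtr_gt0 lt_neqAle eq_sym rz.
have ss : s ^+ 2 = r by rewrite sqr_sqrtr.
have s1 : s < 1 by rewrite -(ltr_pXn2r (n := 2)) // ?nnegrE ?ltW // ss expr1n.
pose h := s^-1 - 1.
have h0 : 0 < h by rewrite subr_gt0 invf_gt1.
have key n : s ^+ n * (1 + n%:R * h) <= 1.
  rewrite -ler_pdivlMl ?exprn_gt0 // mulr1 -exprVn.
  have -> : s^-1 = 1 + h by rewrite /h addrC subrK.
  exact: bernoulli_le (ltW h0).
pose B := 2 / h + 1.
have B0 : 0 < B by rewrite /B addr_gt0 ?divr_gt0.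
have hB n : s ^+ n * (2 * n%:R + 1) <= B.
  have k := key n; have sn0 : 0 < s ^+ n by exact: exprn_gt0.
  have sn1 : s ^+ n <= 1 by rewrite exprn_ile1 // ltW.
  rewrite mulrDr mulr1 lerD // mulrCA ler_wpM2l //.
  rewrite -[h^-1]mul1r ler_pdivlMr // -mulrA; apply: le_trans k.
  by rewrite ler_wpM2l ?lerDr // ltW.
pose n := Num.bound (B / (eps * h)).
have hn : B / (eps * h) < n%:R.
  by apply: archi_boundP; rewrite divr_ge0 ?mulr_ge0 // ltW.
exists n; rewrite -ss -exprM mulnC mulnS muln1 exprD -mulrA.
have sn0 : 0 < s ^+ n by exact: exprn_gt0.
apply: le_lt_trans (ler_wpM2l (ltW sn0) (hB n)) _.
rewrite ltr_pdivrMr ?mulr_gt0 // in hn.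
have k : s ^+ n * (n%:R * h) <= 1.
  by apply: le_trans (key n); rewrite ler_wpM2l ?lerDr // ltW.
apply: (@lt_le_trans _ _ (s ^+ n * (n%:R * (eps * h)))); first by rewrite ltr_pM2l.
rewrite (_ : s ^+ n * (n%:R * (eps * h)) = eps * (s ^+ n * (n%:R * h))); last by ring.
by rewrite -[leRHS]mulr1 ler_wpM2l // ltW.
Qed.

Lemma geometric_series_small (x : R[i]) : `|x| < 1 ->
  forall eps, 0 < eps -> exists T,
    `|\sum_(0 <= n < T) n%:R * x ^+ n - x / (1 - x) ^+ 2| < eps /\
    forall T', \sum_(T <= n < T') `|n%:R * x ^+ n| < eps.
Proof.
move=> x1 eps e0.
have rE : (complex.Re `|x|)%:C%C = `|x| by apply: RRe_real; exact: normr_real.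
have eE : (complex.Re eps)%:C%C = eps by apply: RRe_real; exact: gtr0_real.
set r := complex.Re `|x| in rE; set e := complex.Re eps in eE.
have r0 : 0 <= r by rewrite -lecR rE normr_ge0.
have r1 : r < 1 by rewrite -ltcR rE.
have e'0 : 0 < e by rewrite -ltcR eE.
have d0 : 0 < (1 - r) ^+ 2 by rewrite exprn_gt0 // subr_gt0.
have [T hT] := geometric_small r0 r1 (mulr_gt0 e'0 d0).
have {}hT : `|x| ^+ T * (2 * T%:R + 1) < eps * (1 - `|x|) ^+ 2.
  rewrite -rE -eE; move: hT; rewrite -ltcR !rmorphM rmorphD !rmorphXn rmorphB rmorphM.
  by rewrite rmorph1 !rmorph_nat.
have p0 : 0 < 1 - `|x| by rewrite subr_gt0.
have pp0 : 0 < (1 - `|x|) ^+ 2 by rewrite exprn_gt0.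
have hT' : `|x| ^+ T * (2 * T%:R + 1) / (1 - `|x|) ^+ 2 < eps by rewrite ltr_pdivrMr.
have x_neq1 : x != 1 by apply: contraTneq x1 => ->; rewrite normr1 ltxx.
have nx_neq1 : `|x| != 1 by rewrite lt_eqF.
exists T; split.
  rewrite sum_nX // addrAC subrr sub0r normrN; apply: le_lt_trans hT'.
  rewrite !normrM normfV !normrX ler_pM ?invr_ge0 ?mulr_ge0 ?exprn_ge0 //.
    rewrite ler_wpM2l ?exprn_ge0 //; apply: le_trans (ler_normD _ _) _.
    rewrite lerD ?(ltW x1) // normrM normr_nat [T%:R * _]mulrC ler_wpM2r //.
    apply: le_trans (ler_normB _ _) _.
    by rewrite normr1 -[2]/(1 + 1) lerD2l ltW.
  rewrite lef_pV2 ?posrE ?exprn_gt0 // ?normr_gt0 ?subr_eq0 1?eq_sym //.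
  apply: lerXn2r; rewrite ?nnegrE ?(ltW p0) //.
  by rewrite lerBlDr; apply: le_trans (ler_normD _ _); rewrite subrK normr1.
move=> T'; have [T'T|TT'] := leqP T' T; first by rewrite big_geq.
apply: le_lt_trans hT'.
have -> : \sum_(T <= n < T') `|n%:R * x ^+ n|
  = \sum_(0 <= n < T') n%:R * `|x| ^+ n - \sum_(0 <= n < T) n%:R * `|x| ^+ n.
  rewrite [X in X - _](big_cat_nat (n := T)) //= ?(ltnW TT') // addrAC subrr add0r.
  by apply: eq_bigr => n _; rewrite normrM normr_nat normrX.
rewrite !sum_nX // opprB addrC addrA subrK.
apply: (@le_trans _ _ (`|x| ^+ T * (T%:R * (1 - `|x|) + `|x|) / (1 - `|x|) ^+ 2)).
  have h : 0 <= T'%:R * (1 - `|x|) + `|x| by rewrite addr_ge0 ?mulr_ge0 ?ler0n ?(ltW p0).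
  by rewrite gerDl oppr_le0 divr_ge0 ?(ltW pp0) // mulr_ge0 ?exprn_ge0.
rewrite ler_pM2r ?invr_gt0 // ler_wpM2l ?exprn_ge0 // lerD ?(ltW x1) //.
rewrite [T%:R * _]mulrC ler_wpM2r //; apply: (@le_trans _ _ 1); last by rewrite ler1n.
by rewrite gerBl.
Qed.
End GeometricBound.

(** * Transporting identities of series along a relation *)

Section SeriesRelation.
Variables (I : Type) (K1 K2 : fieldType) (rel : (I -> K1) -> K2 -> Prop).
Hypothesis rel0 : rel (fun=> 0) 0.
Hypothesis rel1 : rel (fun=> 1) 1.
Hypothesis relD : forall u v u' v', rel u v -> rel u' v' -> rel (fun i => u i + u' i) (v + v').
Hypothesis relM : forall u v u' v', rel u v -> rel u' v' -> rel (fun i => u i * u' i) (v * v').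

(** A relation compatible with sums and products, applied coefficientwise.  It will be
the graph of a ring morphism, the evaluation of rational functions, or the
convergence of nets. *)
Definition relS (f : I -> ser K1) (g : ser K2) := forall m, rel (fun i => f i m) (g m).

Lemma rel_sum (T : Type) (r : seq T) (u : T -> I -> K1) (v : T -> K2) :
  (forall t, rel (u t) (v t)) ->
  rel (fun i => \sum_(t <- r) u t i) (\sum_(t <- r) v t).
Proof.
move=> h; elim: r => [|t r IH].
  by rewrite big_nil (_ : (fun i => _) = (fun=> 0)) //; apply: funext => i; rewrite big_nil.
rewrite big_cons (_ : (fun i => _) = (fun i => u t i + \sum_(t <- r) u t i)); first exact: relD.
by apply: funext => i; rewrite big_cons.
Qed.

Lemma relS_M f g f' g' : relS f g -> relS f' g' -> relS (fun i => f i * f' i) (g * g').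
Proof. by move=> h h' m; apply: rel_sum => d; exact: relM. Qed.
Lemma relS_1 : relS (fun=> 1) 1.
Proof. by move=> m; rewrite /relS !ser1E; case: (m == mon0). Qed.
Lemma relS_X f g n : relS f g -> relS (fun i => f i ^+ n) (g ^+ n).
Proof.
move=> h; elim: n => [|n IH]; first exact: relS_1.
rewrite exprS (_ : (fun i => _) = (fun i => f i * f i ^+ n)); first exact: relS_M.
by apply: funext => i; rewrite exprS.
Qed.
Lemma relS_subser a c1 c2 f g : (forall n, rel (fun=> c1 n) (c2 n)) -> relS f g ->
  relS (fun i => subser a c1 (f i)) (subser a c2 g).
Proof. by move=> hc h m; apply: rel_sum => n; apply: relM => //; exact: relS_X. Qed.
Lemma relS_expS f g : (forall n, rel (fun=> n`!%:R^-1) n`!%:R^-1) -> relS f g ->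
  relS (fun i => expS (f i)) (expS g).
Proof.
move=> hc h; rewrite expSE (_ : (fun i => _) = (fun i => subser 0 (fun n => n`!%:R^-1) (f i))).
  exact: relS_subser.
by apply: funext => i; rewrite expSE.
Qed.
End SeriesRelation.

(** A ring morphism is a relation compatible with sums and products. *)
Lemma logS_rmorph (K1 K2 : fieldType) (s : {rmorphism K1 -> K2}) (f : ser K1) :
  logS (fun m => s (f m)) =1 (fun m => s (logS f m)).
Proof.
pose rel (u : unit -> K1) (v : K2) := s (u tt) = v.
have rD u v u' v' : rel u v -> rel u' v' -> rel (fun i => u i + u' i) (v + v').
  by move=> <- <-; rewrite /rel rmorphD.
have rM u v u' v' : rel u v -> rel u' v' -> rel (fun i => u i * u' i) (v * v').
  by move=> <- <-; rewrite /rel rmorphM.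
have r0 : rel (fun=> 0) 0 by rewrite /rel rmorph0.
have r1 : rel (fun=> 1) 1 by rewrite /rel rmorph1.
move=> m; rewrite !logSE; apply/esym.
apply: (@relS_subser _ _ _ rel r0 r1 rD rM 1 _ _ (fun=> f - 1)) => [n|d].
  by rewrite /rel fmorph_div rmorphXn rmorphN rmorph1 rmorph_nat.
by rewrite /rel !serBE rmorphB !ser1E rmorph_nat.
Qed.

(** * The logarithm of the quotient of partition functions *)

Section Terms.
Variables (n : intpart -> nat -> int -> int) (B : intpart -> nat).

Definition zrange (b : nat) : seq int := [seq (i%:Z - b%:Z) | i <- iota 0 b.*2.+1].

Lemma mem_zrange b z : (z \in zrange b) = (`|z| <= b%:Z).
Proof.
apply/mapP/idP => [[j]|h]; first by rewrite mem_iota => hi ->; lia.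
exists (absz (z + b%:Z)); last by lia.
by rewrite mem_iota; lia.
Qed.
Lemma uniq_zrange b : uniq (zrange b).
Proof. by rewrite map_inj_uniq ?iota_uniq // => i j; lia. Qed.

(** The contribution of the partition nu and of the odd integer k to the coefficient of
pb_(k nu) in the logarithm, over any field: it is used with q and t formal, and with
their values. *)
Definition hterm (S : fieldType) (q t : S) (nu : intpart) (k : nat) : S :=
  2%:R / k%:R * (zee nu)%:R^-1 * (q ^+ k - q ^- k) ^- 2 *
  \sum_(g <- iota 0 (B nu).+1) \sum_(b <- zrange (B nu)) \sum_(i <- iota 0 g.+1)
    (n nu g b)%:~R * (q ^ (g%:Z - (i.*2)%:Z) * t ^ b) ^+ k.

Definition hcoef (S : fieldType) (q t : S) (mu : intpart) : S :=
  \sum_(1 <= k < (psize mu).+1 | pdvd k mu && odd k) hterm q t (pdiv_by mu k) k.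

Lemma hval_hterm (C : fieldType) (q0 t0 : C) nu k :
  (forall n, n.+1%:R != 0 :> C) -> q0 != 0 -> t0 != 0 -> (0 < k)%N ->
  q0 ^+ k - q0 ^- k != 0 -> (0 < zee nu)%N ->
  hval q0 t0 (hterm (qK C) (tK C) nu k) (hterm q0 t0 nu k).
Proof.
move=> ch q00 t00 k0 qk z0.
have nz j : (0 < j)%N -> j%:R != 0 :> C by case: j.
apply: hvalM; first apply: hvalM; first apply: hvalM; first apply: hvalM.
- exact: hval_nat.
- by apply: hvalV; [exact: nz | exact: hval_nat].
- by apply: hvalV; [exact: nz | exact: hval_nat].
- apply: hvalV; first by rewrite expf_neq0.
  apply: hvalX; apply: hvalD; first by apply: hvalX; exact: hval_q.
  apply: hvalN; apply: hvalV; first by rewrite expf_neq0.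
  by apply: hvalX; exact: hval_q.
apply: hval_sum => g _; apply: hval_sum => b _; apply: hval_sum => i _.
apply: hvalM; first exact: hval_int.
apply: hvalX; apply: hvalM; apply: hvalXz => //; [exact: hval_q | exact: hval_t].
Qed.
End Terms.

Lemma zee_gt0 mu : (0 < zee mu)%N.
Proof.
rewrite /zee big_nat prodn_cond_gt0 // => j /andP[j0 _].
by rewrite muln_gt0 expn_gt0 j0 fact_gt0.
Qed.

Lemma psum_ext (K : fieldType) (p : nat -> ser K) c c' : c =1 c' -> psum p c = psum p c' :> ser K.
Proof.
by move=> e; apply: serP => m; apply: eq_bigr => k _; apply: eq_bigr => mu _; rewrite e.
Qed.

Section LogZw.
Variable C : fieldType.
Hypothesis ch : forall n, n.+1%:R != 0 :> C.
Local Notation K := (Kqt C).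
Variables (a F : intpart -> K).
Let F' mu := if mu == part0 then 0 else F mu.
Hypothesis a0 : a part0 = 1.
Hypothesis hF : logS (psum (@pb K) a) =1 psum (@pb K) F'.

Let chK : forall n, n.+1%:R != 0 :> K := Kqt_char0 ch.

(** The equation Z * Der (log Z) = Der Z read on the coefficients of the power sums;
it holds in this form because the power sums are linearly independent. *)
Lemma log_recursion : pconv a (fun mu => (psize mu)%:R * F' mu) =1 (fun mu => (psize mu)%:R * a mu).
Proof.
apply: (psum_pb_inj chK) => m.
have Z0 : psum (@pb K) a mon0 = 1 by rewrite (psum_mon0 (homog_pb K)).
have := @Der_logS K chK (psum (@pb K) a) Z0.
have -> : (logS (psum (@pb K) a) : ser K) = psum (@pb K) F' by apply: funext.
rewrite !(Der_psum (homog_pb K)) (psumM (homog_pb K)) => e.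
by rewrite e.
Qed.

Lemma homog_pb_w n : (0 < n)%N -> homog n (@pb_w C n : ser K).
Proof. by move=> n0 m h; rewrite /pb_w /scaleS homog_pb // mulr0. Qed.

Lemma psum_pb_w c :
  psum (@pb_w C) c = psum (@pb K) (fun mu => c mu / qbrK_part C mu) :> ser K.
Proof.
rewrite (psum_scale (@pb K) (fun n => (qbrK C n)^-1)); apply: psum_ext => mu.
by rewrite /pscale /qbrK_part prodfV.
Qed.

(** The recursion between the coefficients of Z and of its logarithm makes no reference
to the power sums, which may be rescaled. *)
Lemma logS_Zw : logS (psum (@pb_w C) a) = psum (@pb_w C) F' :> ser K.
Proof.
apply: (logS_uniq chK).
- by rewrite (psum_mon0 homog_pb_w).
- by rewrite (psum_mon0 homog_pb_w) /F' eqxx.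
rewrite !(Der_psum homog_pb_w) (psumM homog_pb_w).
by apply: psum_ext; exact: log_recursion.
Qed.

Lemma negt_pmu_pb mu m : negt C (pmu (@pb K) mu m) = pmu (@pb K) mu m.
Proof.
rewrite (pmu_pbE _ _ (fsubset_refl _)) rmorph_sum; apply: eq_bigr => h _.
by rewrite rmorph_nat.
Qed.

Lemma negt_qbrK_part mu : negt C (qbrK_part C mu) = qbrK_part C mu.
Proof. by rewrite /qbrK_part rmorph_prod; apply: eq_bigr => i _; rewrite negt_qbr. Qed.

Definition logratio : ser K :=
  psum (@pb K) (fun mu => (F' mu - negt C (F' mu)) / qbrK_part C mu).

Lemma logratioE (c : intpart -> K) : c part0 = 0 ->
  (forall mu, mu != part0 -> (F mu - negt C (F mu)) / qbrK_part C mu = c mu) ->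
  logratio = psum (@pb K) c.
Proof.
move=> c0 hc; apply: psum_ext => mu; rewrite /F'; case: eqP => [->|/eqP/hc //].
by rewrite rmorph0 subrr mul0r c0.
Qed.

Lemma Zw_ratio :
  mulS (psum (@pb_w C) a) (invS (fun m => neg_t (psum (@pb_w C) a m))) = expS logratio :> ser K.
Proof.
set Zw : ser K := psum (@pb_w C) a.
have -> : (fun m => neg_t (Zw m)) = (fun m => negt C (Zw m)) by apply: funext => m; rewrite negtE.
set Zn : ser K := fun m => negt C (Zw m).
have Z0 : Zw mon0 = 1 by rewrite /Zw (psum_mon0 homog_pb_w).
have Zn0 : Zn mon0 = 1 by rewrite /Zn Z0 rmorph1.
have I0 := invS_mon0 Zn.
rewrite -[LHS]/(Zw * invS Zn) -[LHS](logSK chK) ?serM0 ?Z0 ?I0 ?mulr1 //.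
congr (expS _); rewrite (logSM chK) // (logSV chK) //.
apply: serP => m; rewrite serBE /Zn logS_rmorph logS_Zw psum_pb_w.
rewrite /logratio !(psumE_size (homog_pb K)) rmorph_sum -sumrB; apply: eq_bigr => mu _.
by rewrite rmorphM fmorph_div negt_pmu_pb negt_qbrK_part !mulrBl.
Qed.
End LogZw.

Section FieldIdentities.
Variable S : fieldType.

Lemma LMOV_normalization (two z q p x : S) : two != 0 -> z != 0 -> q != 0 -> p != 0 ->
  x = two / z * q ^- 2 * p * (z * q ^+ 2 * x / (two * p)).
Proof. by move=> h1 h2 h3 h4; field; rewrite h1 h2 h3 h4. Qed.

Lemma hterm_normalization (two z q p k X : S) : p != 0 ->
  k^-1 * (two / z * q ^- 2 * p * X) / p = two / k / z * q ^- 2 * X.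
Proof.
move=> p0; rewrite -!mulrA [k^-1 * _]mulrCA; congr (_ * (_ * _)).
by rewrite [p * _]mulrCA divff // mulr1.
Qed.
Lemma exprzXC (x : S) n (z : int) : (x ^+ n) ^ z = (x ^ z) ^+ n.
Proof. by rewrite !exprnP !exprz_exp mulrC. Qed.
End FieldIdentities.

Section LMOV.
Variable C : fieldType.
Hypothesis ch : forall n, n.+1%:R != 0 :> C.
Local Notation K := (Kqt C).
Let chK : forall n, n.+1%:R != 0 :> K := Kqt_char0 ch.
Variables (F : intpart -> K) (Nc nc : intpart -> nat -> int -> int).
Hypothesis hLMOV : orthogonal_LMOV F Nc.
Hypothesis hnc : @character_expansion C Nc nc.

Lemma supp_bounded_le b b' f : (b <= b')%N -> supp_bounded b f -> supp_bounded b' f.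
Proof. by move=> bb h g z /h[hg hz]; split; lia. Qed.

Lemma sum_iota_widen (V : nmodType) b b' (f : nat -> V) : (b <= b')%N ->
  (forall g, (b < g)%N -> f g = 0) ->
  \sum_(0 <= g < b.+1) f g = \sum_(g <- iota 0 b'.+1) f g.
Proof.
move=> bb f0; rewrite -[iota 0 _]/(index_iota 0 b'.+1).
rewrite [RHS](big_cat_nat (n := b.+1)) //= [X in _ + X]big_nat [X in _ + X]big1 ?addr0 // => g.
by move=> /andP[/f0].
Qed.

Lemma sum_zrange_widen (V : nmodType) b b' (f : int -> V) : (b <= b')%N ->
  (forall z, ~~ (`|z| <= b%:Z) -> f z = 0) ->
  \sum_(0 <= i < b.*2.+1) f (i%:Z - b%:Z) = \sum_(z <- zrange b') f z.
Proof.
move=> bb f0; rewrite -(big_map (fun i : nat => i%:Z - b%:Z) predT f).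
rewrite -[map _ _]/(zrange b) [RHS](bigID (mem (zrange b))) /=.
rewrite [X in _ + X]big1 ?addr0 => [|z]; last by rewrite mem_zrange; exact: f0.
rewrite -[RHS]big_filter; apply: perm_big.
apply: uniq_perm; rewrite ?filter_uniq ?uniq_zrange // => z.
by rewrite mem_filter /= !mem_zrange; lia.
Qed.

(** The integrality hypothesis solved for g(q,t) - g(q,-t), and rewritten with the
integers n.  The bounds on the supports of N and n are enlarged to a common B. *)
Lemma LMOV_coef mu : exists B : nat, mu != part0 -> supp_bounded B (nc mu) /\
  reformulated F mu - negt C (reformulated F mu)
  = 2%:R / (zee mu)%:R * qbrK C 1 ^- 2 * qbrK_part C mu *
    \sum_(g <- iota 0 B.+1) \sum_(b <- zrange B) \sum_(i <- iota 0 g.+1)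
      (nc mu g b)%:~R * (qK C ^ (g%:Z - (i.*2)%:Z) * tK C ^ b).
Proof.
have [->|mu0] := eqVneq mu part0; first by exists 0%N.
have [B1 [s1 e1]] := hLMOV mu0; have [B2 [s2 s2' e2]] := hnc mu0.
pose B := maxn B1 B2; have B1B : (B1 <= B)%N := leq_maxl _ _.
have B2B : (B2 <= B)%N := leq_maxr _ _.
exists B => _; split; first exact: supp_bounded_le s2'.
have z0 : (zee mu)%:R != 0 :> K by have := zee_gt0 mu; case: (zee mu).
have q0 : qbrK C 1 != 0 by exact: qbrK_neq0.
have p0 : qbrK_part C mu != 0.
  rewrite /qbrK_part prodf_seq_neq0; apply/allP => i hi; apply: qbrK_neq0.
  exact: (@intpart_pos mu).
have two0 : 2%:R != 0 :> K by exact: chK.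
rewrite -negtE [LHS](LMOV_normalization _ two0 z0 q0 p0); congr (_ * _); rewrite e1.
have zN g b : ~~ ((g <= B1)%N && (`|b| <= B1%:Z)) -> Nc mu g b = 0.
  by move=> h; apply/eqP; apply: contraNT h => /s1[-> ->].
have zN2 g b : (B2 < g)%N -> Nc mu g b = 0.
  by move=> h; apply/eqP; apply: contraTT h => /s2[]; lia.
have zn g b : (B2 < g)%N -> nc mu g b = 0.
  by move=> h; apply/eqP; apply: contraTT h => /s2'[]; lia.
transitivity (\sum_(g <- iota 0 B.+1) \sum_(b <- zrange B)
   (Nc mu g b)%:~R * (qK C - (qK C)^-1) ^+ g * tK C ^ b).
  rewrite -(sum_iota_widen B1B) => [|g hg]; last first.
    rewrite big1 // => b _; rewrite zN ?mul0r //; lia.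
  apply: eq_bigr => g _.
  rewrite -(sum_zrange_widen (f := fun b => (Nc mu g b)%:~R * (qK C - (qK C)^-1) ^+ g * tK C ^ b) B1B) // => b hb.
  by rewrite zN ?mul0r //; lia.
rewrite exchange_big [RHS]exchange_big /=; apply: eq_bigr => b _.
rewrite -mulr_suml.
have := e2 b; rewrite (sum_iota_widen B2B) => [|g hg]; last by rewrite zN2 ?mul0r.
rewrite (sum_iota_widen B2B) => [->|g hg]; last by rewrite zn ?mul0r.
rewrite mulr_suml; apply: eq_bigr => g _.
rewrite -mulr_sumr -mulrA mulr_suml; congr (_ * _); apply: eq_bigr => i _ //.
Qed.

Section Bounds.
Variable B : intpart -> nat.
Hypothesis hB : forall mu, mu != part0 -> supp_bounded (B mu) (nc mu) /\
  reformulated F mu - negt C (reformulated F mu)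
  = 2%:R / (zee mu)%:R * qbrK C 1 ^- 2 * qbrK_part C mu *
    \sum_(g <- iota 0 (B mu).+1) \sum_(b <- zrange (B mu)) \sum_(i <- iota 0 g.+1)
      (nc mu g b)%:~R * (qK C ^ (g%:Z - (i.*2)%:Z) * tK C ^ b).

Lemma frob_qbrK_part k mu : frob C k (qbrK_part C mu) = qbrK_part C (partmul k.+1 mu).
Proof.
rewrite /qbrK_part rmorph_prod (perm_big _ (partmul_perm _ (ltn0Sn k))) big_map.
by apply: eq_bigr => i _; rewrite frob_qbr.
Qed.

(** Under q -> q^k the quantum integers [1] and [nu] become [k] and [k nu]; the latter
cancels against the normalization of z * q^rho. *)
Lemma frob_hterm nu k : nu != part0 -> (0 < k)%N ->
  k%:R^-1 * frob C k.-1 (reformulated F nu - negt C (reformulated F nu))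
    / qbrK_part C (partmul k nu)
  = hterm nc B (qK C) (tK C) nu k.
Proof.
case: k => // k nu0 _; have [_ ->] := hB nu0.
have p0 : qbrK_part C (partmul k.+1 nu) != 0.
  rewrite /qbrK_part prodf_seq_neq0; apply/allP => i hi; apply: qbrK_neq0.
  exact: (@intpart_pos (partmul k.+1 nu)).
rewrite !rmorphM !fmorphV rmorphXn !rmorph_nat /= frob_qbr muln1 frob_qbrK_part.
rewrite /hterm -/(qbrK C k.+1); set S := frob _ _ _.
have -> : S = \sum_(g <- iota 0 (B nu).+1) \sum_(b <- zrange (B nu)) \sum_(i <- iota 0 g.+1)
    (nc nu g b)%:~R * (qK C ^ (g%:Z - (i.*2)%:Z) * tK C ^ b) ^+ k.+1.
  rewrite /S rmorph_sum; apply: eq_bigr => g _; rewrite rmorph_sum; apply: eq_bigr => b _.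
  rewrite rmorph_sum; apply: eq_bigr => i _.
  rewrite !rmorphM rmorph_int !fmorphXz /= frob_q frob_t exprMn.
  by rewrite !exprzXC.
set X := \sum_(_ <- _) _; move: X => X.
exact: hterm_normalization.
Qed.

Lemma log_coef_difference mu : mu != part0 ->
  (F mu - negt C (F mu)) / qbrK_part C mu = hcoef nc B (qK C) (tK C) mu.
Proof.
move=> mu0; rewrite (moebius_inversion F mu0) rmorph_sum -sumrB mulr_suml /hcoef.
rewrite big_nat_cond [RHS]big_nat_cond [RHS]big_mkcond [LHS]big_mkcond /=.
apply: eq_bigr => k _.
have [/andP[k0 _]|] := boolP (0 < k < (psize mu).+1)%N => //=.
case hk : (pdvd k mu) => //=.
rewrite rmorphM fmorphV rmorph_nat.
set nu := pdiv_by mu k.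
have nu0 : nu != part0 by rewrite -(partmul_eq0 _ k0) pdiv_byK.
have [ok|ek] := boolP (odd k).
  rewrite -(frob_hterm nu0 k0) pdiv_byK // negt_frob_odd ?prednK // rmorphB mulrBr //.
by rewrite negt_frob_even ?prednK // subrr mul0r.
Qed.

End Bounds.
End LMOV.

(** * The infinite product *)

Section Evaluation.
Variable R : realType.
Local Notation C := R[i].
Local Notation K := (Kqt C).
Variables (n : intpart -> nat -> int -> int) (B : intpart -> nat).
Hypothesis hB : forall mu, mu != part0 -> supp_bounded (B mu) (n mu).
Variables q0 t0 : C.
Hypotheses (q00 : q0 != 0) (q01 : `|q0| < 1) (t00 : t0 != 0).

Lemma complex_char0 : forall k, k.+1%:R != 0 :> C.
Proof. by move=> k; rewrite pnatr_eq0. Qed.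

Lemma q0X_lt1 k : (0 < k)%N -> `|q0 ^+ k| < 1.
Proof. by move=> k0; rewrite normrX exprn_ilt1 // -lt0n. Qed.
Lemma q0X_neq1 k : (0 < k)%N -> q0 ^+ k != 1.
Proof. by move=> /q0X_lt1; apply: contraTneq => ->; rewrite normr1 ltxx. Qed.

Lemma qbr0_neq0 k : (0 < k)%N -> q0 ^+ k - q0 ^- k != 0.
Proof.
move=> k0; rewrite subr_eq0; apply/eqP => e.
have qk : q0 ^+ k != 0 by rewrite expf_neq0.
have : q0 ^+ (k + k) == 1 by rewrite exprD {1}e mulVf.
by rewrite (negbTE (q0X_neq1 _)) // addn_gt0 k0.
Qed.

(** The sum of m q0^(2 k m) over m, in the form in which it occurs in the logarithm of
the partition function. *)
Lemma qbr0_sqr k : (0 < k)%N ->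
  (q0 ^+ k - q0 ^- k) ^- 2 = q0 ^+ (2 * k) / (1 - q0 ^+ (2 * k)) ^+ 2.
Proof.
move=> k0; have qk : q0 ^+ k != 0 by rewrite expf_neq0.
have h1 : 1 - q0 ^+ (2 * k) != 0 by rewrite subr_eq0 eq_sym q0X_neq1 // muln_gt0.
have h2 := qbr0_neq0 k0.
rewrite mulnC exprM in h1 *; move: (q0 ^+ k) qk h1 h2 => x x0 h1 h2.
have -> : x - x^-1 = - (1 - x ^+ 2) / x.
  by rewrite opprB mulrBl mul1r expr2 mulfK.
by rewrite exprMn sqrrN exprVn invfM invrK mulrC.
Qed.

Lemma hval_pmu_pb mu m : hval q0 t0 (pmu (@pb K) mu m) (pmu (@pb C) mu m).
Proof.
rewrite !(pmu_pbE _ _ (fsubset_refl _)); apply: hval_sum => h _; exact: hval_nat.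
Qed.

(** The logarithm of the infinite product. *)
Definition log_product : ser C := psum (@pb C) (hcoef n B q0 t0).

Lemma hcoef0 (S : fieldType) (q t : S) : hcoef n B q t part0 = 0.
Proof. by rewrite /hcoef psize0 big_geq. Qed.

Lemma hval_psum_hcoef m : hval q0 t0 (psum (@pb K) (hcoef n B (qK C) (tK C)) m) (log_product m).
Proof.
rewrite /log_product (psumE_size (homog_pb K)) (psumE_size (homog_pb C)).
apply: hval_sum => mu _; apply: hvalM; last exact: hval_pmu_pb.
apply: hval_sum => k /andP[_ ok]; have k0 : (0 < k)%N by case: k ok.
by apply: hval_hterm => //; [exact: complex_char0 | exact: qbr0_neq0 | exact: zee_gt0].
Qed.

Lemma hval_expS (f : ser K) (g : ser C) : (forall m, hval q0 t0 (f m) (g m)) ->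
  forall m, hval q0 t0 (expS f m) (expS g m).
Proof.
pose rel (u : unit -> K) (v : C) := hval q0 t0 (u tt) v.
move=> h; apply: (@relS_expS _ _ _ rel _ _ _ _ (fun=> f)) => //.
- exact: hval0.
- exact: hval1.
- by move=> u v u' v'; exact: hvalD.
- by move=> u v u' v'; exact: hvalM.
move=> k; apply: hvalV; last exact: hval_nat.
by rewrite pnatr_eq0 -lt0n fact_gt0.
Qed.

Let I : choiceType := (intpart * nat * int * nat * nat)%type.

Definition logfactor (x : I) : ser C :=
  let: (mu, g, b, m, k) := x in
  let w := q0 ^ (g%:Z - (k.*2)%:Z + (m.*2)%:Z) * t0 ^ b in
  scal (m%:R * (n mu g b)%:~R / (zee mu)%:R)
    (logS (mulS (symprod w mu) (invS (symprod (- w) mu)))).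

Lemma prod_lmov_factor (r : seq I) :
  \big[@mulS C/@oneS C]_(x <- r | lmov_index x) lmov_factor q0 t0 n x
  = expS (\sum_(x <- r | lmov_index x) logfactor x) :> ser C.
Proof.
rewrite (expS_sum complex_char0) => [|[[[[mu g] b] m] k] _]; last first.
  by rewrite /logfactor scalE logS_mon0 mulr0.
by apply: eq_bigr => -[[[[mu g] b] m] k] _.
Qed.

Section Coefficient.
Variable M : zmon.

(** The contribution of the k-th term of the logarithm of a factor to the coefficient
of M, up to the dependence on m, which is m q^(2 k m). *)
Definition amp nu g b i k : C :=
  2%:R / k%:R * (n nu g b)%:~R / (zee nu)%:R * (q0 ^ (g%:Z - (i.*2)%:Z) * t0 ^ b) ^+ k
   * pmu (@pb C) (partmul k nu) M.

Definition term nu g b i mm : C :=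
  \sum_(1 <= k < (mondeg M).+1 | odd k)
    amp nu g b i k * (mm%:R * (q0 ^+ (2 * k)) ^+ mm).

Lemma logfactorE nu g b mm i : nu != part0 ->
  logfactor (nu, g, b, mm, i) M = term nu g b i mm.
Proof.
move=> nu0; rewrite /logfactor scalE (logS_symratio complex_char0 nu0) mulr_sumr /term.
apply: eq_bigr => k _; rewrite /amp.
have -> : (q0 ^ (g%:Z - (i.*2)%:Z + (mm.*2)%:Z) * t0 ^ b) ^+ k
    = (q0 ^ (g%:Z - (i.*2)%:Z) * t0 ^ b) ^+ k * (q0 ^+ (2 * k)) ^+ mm.
  rewrite expfzDr // -(exprnP q0 mm.*2) mulrAC exprMn -!exprM.
  by congr (_ * q0 ^+ _); rewrite -mul2n mulnAC.
move: (_ ^+ k) ((q0 ^+ _) ^+ mm) (pmu _ _ _) => x y p.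
rewrite !mulrA; move: (k%:R^-1) ((zee nu)%:R^-1) => k' z.
by rewrite -!mulrA; ring.
Qed.

Lemma term0 nu g b i : term nu g b i 0 = 0.
Proof. by rewrite /term big1 // => k _; rewrite mul0r mulr0. Qed.

Lemma amp_out nu g b i k : n nu g b = 0 -> amp nu g b i k = 0.
Proof. by rewrite /amp => ->; rewrite mulr0 !mul0r. Qed.

Lemma amp_large nu g b i k : (0 < k)%N -> (mondeg M < psize nu)%N -> amp nu g b i k = 0.
Proof.
move=> k0 h; rewrite /amp homog_pmu ?mulr0 //; first exact: homog_pb.
by rewrite psize_partmul neq_ltn (leq_trans h) // leq_pmull.
Qed.

Lemma sum_delta (V : pzRingType) (J : eqType) (r : seq J) (a : J) (F : J -> V) : uniq r ->
  \sum_(i <- r) (a == i)%:R * F i = (a \in r)%:R * F a.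
Proof.
move=> ur; have [ar|ar] := boolP (a \in r).
  rewrite (bigD1_seq a) //= eqxx big1 ?addr0 // => i /negbTE.
  by rewrite eq_sym => ->; rewrite mul0r.
rewrite mul0r big_seq big1 // => i ir; case: eqP => [e|_]; last by rewrite mul0r.
by rewrite e ir in ar.
Qed.

Let PL := [seq nu <- parts_upto (mondeg M) | nu != part0].
Let e nu g b i mm : I := (nu, g, b, mm, i).
Let rank (x : I) : nat := x.1.2.

(** Only finitely many (nu, g, b, i) contribute to the coefficient of M: nu is bounded
by the degree of M, and g and b by the support of n.  The sums are indexed by these,
and m remains free. *)
Lemma logfactor_split (x : I) :
  (if lmov_index x then logfactor x M else 0)
  = \sum_(nu <- PL) \sum_(g <- iota 0 (B nu).+1) \sum_(b <- zrange (B nu))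
      \sum_(i <- iota 0 g.+1) (x == e nu g b i (rank x))%:R * term nu g b i (rank x).
Proof.
case: x => [[[[mu g] b] mm] i].
have LFE := @logfactorE mu g b mm i; set LF := logfactor _ M in LFE *.
rewrite /rank /=.
transitivity (\sum_(nu <- PL) (mu == nu)%:R * \sum_(g' <- iota 0 (B nu).+1) (g == g')%:R *
  \sum_(b' <- zrange (B nu)) (b == b')%:R * \sum_(i' <- iota 0 g'.+1) (i == i')%:R *
    term nu g' b' i' mm); last first.
  apply: eq_bigr => nu _; rewrite mulr_sumr; apply: eq_bigr => g' _.
  rewrite mulrA mulr_sumr; apply: eq_bigr => b' _.
  rewrite mulrA mulr_sumr; apply: eq_bigr => i' _.
  rewrite mulrA -!natrM !mulnb; congr (_%:R * _); congr nat_of_bool.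
  by rewrite /e !xpair_eqE eqxx andbT.
rewrite sum_delta ?filter_uniq ?uniq_parts_upto // sum_delta ?iota_uniq //.
rewrite sum_delta ?uniq_zrange // sum_delta ?iota_uniq //.
rewrite mem_filter mem_parts_upto !mem_iota mem_zrange /= !add0n !ltnS.
have [->|mu0] /= := eqVneq mu part0; first by rewrite mul0r.
have [->|mm0] := posnP mm; first by rewrite term0 !mulr0.
have [ig|gi] := leqP i g; last by rewrite mul0r !mulr0.
rewrite LFE // mul1r.
have term_eq0 : (forall k, (0 < k)%N -> amp mu g b i k = 0) -> term mu g b i mm = 0.
  move=> h; rewrite /term big_nat_cond big1 // => k /andP[/andP[k0 _] _].
  by rewrite h // mul0r.
have [hm|hm] := leqP (psize mu) (mondeg M); last first.
  by rewrite mul0r term_eq0 // => k k0; exact: amp_large.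
have [hgb|hgb] := boolP ((g <= B mu)%N && (`|b| <= (B mu)%:Z)).
  by case/andP: hgb => -> ->; rewrite !mul1r.
rewrite term_eq0 ?mulr0 // => k _; apply: amp_out.
by apply/eqP; apply: contraNT hgb => /(hB mu0)[-> ->].
Qed.

Definition limit nu g b i : C :=
  \sum_(1 <= k < (mondeg M).+1 | odd k)
    amp nu g b i k * (q0 ^+ (2 * k) / (1 - q0 ^+ (2 * k)) ^+ 2).

Lemma netcvg_term nu g b i :
  netcvg (fun J : {fset I} =>
    \sum_(x <- enum_fset J) (x == e nu g b i (rank x))%:R * term nu g b i (rank x))
    (limit nu g b i).
Proof.
rewrite (_ : (fun J => _) = (fun J : {fset I} => \sum_(1 <= k < (mondeg M).+1 | odd k)
   amp nu g b i k * \sum_(x <- enum_fset J | x == e nu g b i (rank x))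
     (rank x)%:R * (q0 ^+ (2 * k)) ^+ (rank x))); last first.
  apply: funext => J; under [RHS]eq_bigr do rewrite mulr_sumr.
  rewrite exchange_big /= [RHS]big_mkcond /=; apply: eq_bigr => x _.
  by rewrite /term; case: eqP => _; rewrite ?mul1r ?mul0r.
apply: (netcvg_sum (index_iota 1 (mondeg M).+1) (P := odd)
  (u := fun k J => amp nu g b i k * \sum_(x <- enum_fset J | x == e nu g b i (rank x))
     (rank x)%:R * (q0 ^+ (2 * k)) ^+ (rank x))) => k ok.
apply: netcvgM; first exact: netcvg_cst.
have k0 : (0 < k)%N by case: k ok.
apply: (@netcvg_series _ _ (e nu g b i) (fun x => x == e nu g b i (rank x)) rank
    (fun mm => mm%:R * (q0 ^+ (2 * k)) ^+ mm)).
- by move=> mm; rewrite /rank /= eqxx.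
- by move=> mm.
- by move=> x /eqP <-.
by move=> eps; apply: geometric_series_small; apply: q0X_lt1; rewrite muln_gt0.
Qed.

Lemma netcvg_logfactor :
  netcvg (fun J : {fset I} => (\sum_(x <- enum_fset J | lmov_index x) logfactor x) M)
   (\sum_(nu <- PL) \sum_(g <- iota 0 (B nu).+1) \sum_(b <- zrange (B nu))
      \sum_(i <- iota 0 g.+1) limit nu g b i).
Proof.
rewrite (_ : (fun J => _) = (fun J : {fset I} =>
   \sum_(nu <- PL) \sum_(g <- iota 0 (B nu).+1) \sum_(b <- zrange (B nu))
      \sum_(i <- iota 0 g.+1) \sum_(x <- enum_fset J)
        (x == e nu g b i (rank x))%:R * term nu g b i (rank x))); last first.
  apply: funext => J; rewrite ser_sumE big_mkcond /=.
  under eq_bigr do rewrite logfactor_split.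
  rewrite exchange_big; apply: eq_bigr => nu _ /=.
  rewrite exchange_big; apply: eq_bigr => g _ /=.
  rewrite exchange_big; apply: eq_bigr => b _ /=.
  by rewrite exchange_big.
apply: netcvg_sum => nu _; apply: netcvg_sum => g _; apply: netcvg_sum => b _.
by apply: netcvg_sum => i _; exact: netcvg_term.
Qed.

(** Grouping the terms with k nu = mu turns a sum over nu and k into a sum over mu and
the odd k dividing mu. *)
Lemma limit_log_product :
  \sum_(nu <- PL) \sum_(g <- iota 0 (B nu).+1) \sum_(b <- zrange (B nu))
      \sum_(i <- iota 0 g.+1) limit nu g b i = log_product M.
Proof.
pose h := hterm n B q0 t0.
transitivity (\sum_(1 <= k < (mondeg M).+1 | odd k) \sum_(nu <- PL)
   h nu k * pmu (@pb C) (partmul k nu) M).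
  rewrite [RHS]exchange_big /=; apply: eq_bigr => nu _.
  under eq_bigr do under eq_bigr do rewrite exchange_big /=.
  under eq_bigr do rewrite exchange_big /=.
  rewrite exchange_big /= big_nat_cond [RHS]big_nat_cond; apply: eq_bigr => k /andP[/andP[k0 _] _].
  rewrite /h /hterm qbr0_sqr // !mulr_sumr !mulr_suml; apply: eq_bigr => g _.
  rewrite !mulr_sumr !mulr_suml; apply: eq_bigr => b _.
  rewrite !mulr_sumr !mulr_suml; apply: eq_bigr => i _.
  rewrite /amp; move: (_ ^+ k) (_ / _ ^+ 2) (pmu _ _ _) => x y p.
  move: (k%:R^-1) ((zee nu)%:R^-1) => k' z; ring.
rewrite /log_product (psumE_size (homog_pb C)).
transitivity (\sum_(mu <- partitions_of (mondeg M)) \sum_(1 <= k < (mondeg M).+1 | odd k)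
   (pdvd k mu)%:R * (h (pdiv_by mu k) k * pmu (@pb C) mu M)); last first.
  rewrite big_seq [RHS]big_seq; apply: eq_bigr => mu; rewrite mem_partitions_of => /eqP hmu.
  rewrite /hcoef hmu mulr_suml [RHS]big_mkcond [LHS]big_mkcond /=; apply: eq_bigr => k _.
  by case: (pdvd k mu); case: (odd k); rewrite /= ?mul1r ?mul0r.
rewrite [RHS]exchange_big /= [LHS]big_nat_cond [RHS]big_nat_cond.
apply: eq_bigr => k /andP[/andP[k0 kM] _].
have P : perm_eq [seq mu <- partitions_of (mondeg M) | pdvd k mu]
    [seq partmul k nu | nu <- PL & psize (partmul k nu) == mondeg M].
  apply: uniq_perm; first by rewrite filter_uniq ?uniq_partitions_of.
    rewrite map_inj_uniq ?filter_uniq ?uniq_parts_upto //; exact: partmul_inj.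
  move=> mu; rewrite mem_filter mem_partitions_of; apply/andP/mapP => [[hk /eqP hM]|[nu]].
    exists (pdiv_by mu k); last by rewrite pdiv_byK.
    rewrite !mem_filter mem_parts_upto pdiv_byK // hM eqxx -(partmul_eq0 _ k0) pdiv_byK //.
    rewrite -psize_eq0 hM -lt0n (leq_trans k0) //=.
    by rewrite -hM -[in leqRHS](pdiv_byK k0 hk) psize_partmul leq_pmull.
  by rewrite mem_filter => /andP[h1 _] ->; rewrite pdvd_partmul.
transitivity (\sum_(mu <- partitions_of (mondeg M) | pdvd k mu) h (pdiv_by mu k) k * pmu (@pb C) mu M).
  rewrite -[RHS]big_filter (perm_big _ P) big_map [RHS]big_filter.
  rewrite [LHS](bigID (fun nu => psize (partmul k nu) == mondeg M)) /= [X in _ + X]big1 ?addr0.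
    by apply: eq_bigr => nu _; rewrite partmulK.
  move=> nu hnu; rewrite homog_pmu ?mulr0 //; first exact: homog_pb.
  by rewrite eq_sym.
rewrite big_mkcond; apply: eq_bigr => mu _.
by case: (pdvd k mu); rewrite ?mul1r ?mul0r.
Qed.
End Coefficient.

Lemma product_cvg M :
  coef_uprod_cvg lmov_index (lmov_factor q0 t0 n) M (expS log_product M).
Proof.
pose rel (u : {fset I} -> C) (v : C) := netcvg u v.
suff H : relS rel (fun J => expS (\sum_(x <- enum_fset J | lmov_index x) logfactor x)) (expS log_product).
  move=> eps e0; have [J0 HJ] := H M _ e0; exists J0 => J sJ.
  by rewrite prod_lmov_factor; exact: HJ.
apply: relS_expS.
- exact: netcvg_cst.
- exact: netcvg_cst.
- by move=> u v u' v'; exact: netcvgD.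
- by move=> u v u' v'; exact: netcvgM.
- by move=> k; exact: netcvg_cst.
by move=> m; rewrite /rel -limit_log_product; exact: netcvg_logfactor.
Qed.
End Evaluation.

Theorem theorem4p1 (R : realType) (n : nat) (b : braid n)
  (hknot : closure_is_knot b)
  (delta : R[i]) (hdelta : forall r : nat, brauer_semisimple delta r)
  (chi : nat -> intpart -> intpart -> R[i])
  (hchi : is_brauer_characters delta chi)
  (W : intpart -> Kqt R[i]) (hW : is_colored_Kauffman b W)
  (F : intpart -> Kqt R[i])
  (hF : is_log_expansion (ZSO chi W (@pb (Kqt R[i]))) F)
  (Nc : intpart -> nat -> int -> int) (hLMOV : orthogonal_LMOV F Nc)
  (nc : intpart -> nat -> int -> int)
  (hnc : @character_expansion R[i] Nc nc)
  (q0 t0 : R[i]) (hq0 : q0 != 0) (hq1 : `|q0| < 1) (ht0 : t0 != 0) (M : zmon) :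
  let Zw := ZSO chi W (@pb_w R[i]) in
  let Zw_neg := fun m : zmon => neg_t (Zw m) in
  exists2 v : R[i],
    has_value id q0 t0 (mulS Zw (invS Zw_neg) M) v
    & coef_uprod_cvg lmov_index (lmov_factor q0 t0 nc) M v.
Proof.
move=> Zw Zw_neg.
have [B hB] := choice (LMOV_coef (@complex_char0 R) hLMOV hnc).
have hB1 mu : mu != part0 -> supp_bounded (B mu) (nc mu) by move=> /hB[].
exists (expS (log_product nc B q0 t0) M); last exact: product_cvg.
have a0 : ZSO_coef chi W part0 = 1 by exact: ZSO_coef0 hchi hW.
have -> : mulS Zw (invS Zw_neg) = expS (psum (@pb (Kqt R[i])) (hcoef nc B (qK _) (tK _))).
  rewrite /Zw_neg /Zw /ZSO (Zw_ratio (@complex_char0 R) a0 hF); congr (expS _).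
  by apply: logratioE; [exact: hcoef0 | exact: log_coef_difference].
by apply: hval_expS => m; exact: hval_psum_hcoef.
Qed.
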